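(* Let $k\ge 2$ be a fixed integer. Then the decision problem HAS-$k$-qWNU (given a finite algebra $\mathbf{A}$ with finitely many basic operations, presented by the tables of its basic operations, decide whether $\mathbf{A}$ has a $k$-ary quasi weak near unanimity term operation) is solvable in time polynomial in the input size $\|\mathbf{A}\|$.
   Context: An algebra $\mathbf{A}$ consists of a non-empty set $A$ (its universe) and a set of basic operations $f_i\colon A^{n_i}\to A$. The term operations of $\mathbf{A}$ are the operations on $A$ obtained by evaluating terms built from variables and the symbols of the basic operations (in particular, projections are term operations). ``$\mathbf{A}$ has an operation of a given kind'' means that some term operation of $\mathbf{A}$ is of this kind. Algebras are not assumed to be idempotent. A $k$-ary operation $w$ on $A$ is a quasi weak near unanimity ($k$-qWNU) operation if for all $x,y\in A$ $$w(y,x,\dots,x,x)=w(x,y,x,\dots,x)=\dots=w(x,x,\dots,x,y),$$ i.e. the value of $w$ on the $k$-tuple having $y$ in position $i$ and $x$ in all other positions does not depend on $i\in\{1,\dots,k\}$. Idempotence of $w$ is not required. HAS-$k$-qWNU is the following decision problem. INPUT: an algebra $\mathbf{A}$ on a finite set with finitely many basic operations, given by the list of tables of its basic operations. QUESTION: does $\mathbf{A}$ have a $k$-ary quasi weak near unanimity operation? The number $k$ is fixed and is not part of the input. The input size $\|\mathbf{A}\|$ is the sum of the sizes of the tables of the basic operations; it is assumed that the input algebra has at least one basic operation, so that $\|\mathbf{A}\|\ge |A|$. *)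

(* Defs.v *)
From HB Require Import structures.
From mathcomp Require Import all_boot all_order all_algebra.

Set Implicit Arguments.
Unset Strict Implicit.
Unset Printing Implicit Defensive.

(** * Finite algebras and their term operations *)

(** Nullary basic operations are allowed. *)
Record algebra := Algebra {
  carrier : finType;
  carrier_gt0 : 0 < #|carrier|;
  nops : nat;
  arity : 'I_nops -> nat;
  op : forall f : 'I_nops, (arity f).-tuple carrier -> carrier
}.

Inductive term (A : algebra) (k : nat) : Type :=
| Var of 'I_k
| App (f : 'I_(nops A)) of ('I_(arity f) -> term A k).

Fixpoint eval (A : algebra) (k : nat) (t : term A k)
    (v : k.-tuple (carrier A)) : carrier A :=
  match t with
  | Var i => tnth v i
  | App f args => op [tuple eval (args j) v | j < arity f]
  end.

Definition term_operation (A : algebra) (k : nat)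
    (w : k.-tuple (carrier A) -> carrier A) : Prop :=
  exists t : term A k, forall v, w v = eval t v.

Definition qWNU_operation (T : Type) (k : nat) (w : k.-tuple T -> T) : Prop :=
  forall (x y : T) (i j : 'I_k),
    w [tuple if l == i then y else x | l < k] =
    w [tuple if l == j then y else x | l < k].

Definition has_qWNU (k : nat) (A : algebra) : Prop :=
  exists w : k.-tuple (carrier A) -> carrier A,
    term_operation w /\ qWNU_operation w.

(** The size of a table is its number of rows.  Writing a row down takes longer
    than that, but on admissible inputs with at least two elements only by a
    factor polynomial in [alg_size]. *)
Definition alg_size (A : algebra) : nat :=
  \sum_(f < nops A) #|carrier A| ^ arity f.

(** The second condition follows from the first when all arities are positive;
    it only excludes algebras all of whose operations are constants and which
    have fewer operations than elements. *)
Definition admissible (A : algebra) : Prop :=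
  0 < nops A /\ #|carrier A| <= alg_size A.

(** * Presentation of an algebra as a word *)

Variant symbol := Tally | EndNum | EndRow | EndTable.

Definition symbol_code (s : symbol) : bool * bool :=
  match s with
  | Tally => (false, false)
  | EndNum => (false, true)
  | EndRow => (true, false)
  | EndTable => (true, true)
  end.

Definition symbol_decode (c : bool * bool) : symbol :=
  match c with
  | (false, false) => Tally
  | (false, true) => EndNum
  | (true, false) => EndRow
  | (true, true) => EndTable
  end.

Lemma symbol_codeK : cancel symbol_code symbol_decode.
Proof. by case. Qed.

HB.instance Definition _ := Finite.copy symbol (can_type symbol_codeK).

(** Numbers are written in unary; since all of them are at most [#|carrier A|],
    hence at most [alg_size A] on admissible inputs, this is polynomially
    equivalent to binary. *)
Definition encode_nat (m : nat) : seq symbol := rcons (nseq m Tally) EndNum.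

Definition encode_elt (T : finType) (x : T) : seq symbol :=
  encode_nat (enum_rank x).

(** The row of the arguments [x1, ..., xr] lists [x1, ..., xr] followed by the
    value of the operation at these arguments. *)
Definition encode_row (T : finType) (r : nat) (g : r.-tuple T -> T)
    (v : r.-tuple T) : seq symbol :=
  rcons (flatten [seq encode_elt x | x <- rcons v (g v)]) EndRow.

Definition encode_table (T : finType) (r : nat) (g : r.-tuple T -> T) :
    seq symbol :=
  rcons (flatten [seq encode_row g v | v <- enum {: r.-tuple T}]) EndTable.

Definition encode_alg (A : algebra) : seq symbol :=
  encode_nat #|carrier A| ++
  flatten [seq encode_table (@op A f) | f <- enum 'I_(nops A)].

(** * Deterministic multitape Turing machines *)

Variant move := MoveLeft | Stay | MoveRight.

(** [verdict q] is [None] when [q] is not a halting state; otherwise it is the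
    answer (accept or reject) given by halting in [q]. *)
Record TM (I : finType) := MkTM {
  state : finType;
  tape_symbol : finType;
  blank : tape_symbol;
  inj : I -> tape_symbol;
  inj_inj : injective inj;
  inj_neq_blank : forall a, inj a != blank;
  ntapes : nat; (* number of tapes besides the input tape *)
  start : state;
  verdict : state -> option bool;
  delta : state -> {ffun 'I_ntapes.+1 -> tape_symbol} ->
          state * {ffun 'I_ntapes.+1 -> tape_symbol * move}
}.

(** A two-way infinite tape which is blank outside a finite part.  The symbols
    on the left of the head are listed from the nearest to the farthest. *)
Record tape (G : Type) := Tape { lefts : seq G; scanned : G; rights : seq G }.

Definition write_move (G : Type) (b : G) (T : tape G) (am : G * move) :
    tape G :=
  let: Tape l _ r := T in
  let: (a, m) := am in
  match m with
  | MoveLeft => Tape (behead l) (head b l) (a :: r)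
  | Stay => Tape l a r
  | MoveRight => Tape (a :: l) (head b r) (behead r)
  end.

Record config (I : finType) (M : TM I) := Config {
  cstate : state M;
  ctapes : {ffun 'I_(ntapes M).+1 -> tape (tape_symbol M)}
}.

Definition step (I : finType) (M : TM I) (c : config M) : config M :=
  if verdict (cstate c) is Some _ then c else
  let d := delta (cstate c) [ffun i => scanned (ctapes c i)] in
  Config d.1 [ffun i => write_move (blank M) (ctapes c i) (d.2 i)].

(** The head of the input tape starts on the first letter of the input. *)
Definition init (I : finType) (M : TM I) (w : seq I) : config M :=
  let u := [seq inj M a | a <- w] in
  Config (start M)
    [ffun i => if i == ord0 then Tape [::] (head (blank M) u) (behead u)
               else Tape [::] (blank M) [::]].

Definition answers_within (I : finType) (M : TM I) (w : seq I) (t : nat)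
    (b : bool) : Prop :=
  exists2 s, s <= t & verdict (cstate (iter s (@step I M) (init M w))) = Some b.

(** The problem "given [x] with [dom x], decide [P x]", where [x] is presented
    by the word [enc x], is solvable in time polynomial in [size_of x]. *)
Definition poly_time_solvable (I : finType) (X : Type) (enc : X -> seq I)
    (size_of : X -> nat) (dom P : X -> Prop) : Prop :=
  exists (M : TM I) (p : {poly nat}),
    forall x, dom x ->
      exists2 b : bool, answers_within M (enc x) (p.[size_of x])%R b & (b <-> P x).

(* Main.v *)
Require Import Defs.
From HB Require Import structures.
From mathcomp Require Import all_boot all_order all_algebra all_fingroup.
From mathcomp Require Import zify.

Set Implicit Arguments.
Unset Strict Implicit.
Unset Printing Implicit Defensive.

(** A has a k-qWNU operation iff for every k-tuple c the subalgebra of A^k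
    generated by the permutations of c contains a constant tuple.  From right to
    left, a term that works for some pairs (x, y) is corrected for one more pair
    by composing it with a term that sends the permutations of the tuple of its
    values at that pair to a constant.  From left to right one shows that a
    nonempty symmetric invariant relation of a k-qWNU contains a constant tuple;
    after passing to an idempotent operation and to a minimal subuniverse the
    argument is one about the binary relations "x and y are two entries of a
    tuple whose other entries lie in a given set".

    Since k is fixed, A^k has polynomial size, so a Turing machine can compute the
    subalgebra generated by the permutations of c, one c after the other, by
    closing a bit array indexed by A^k under the rows of the tables.  For one
    element the word may be arbitrarily longer than its number of rows, but then
    the answer is yes, and this is visible from the second letter. *)

(** * Symmetric invariant relations *)

(** A direct search for a term would treat all pairs at once, that is, generate a subalgebra of a
    power whose exponent grows with [|A|] and whose size can be exponential; the local condition
    needs only [|A|^k] closures in the fixed power [A^k]. The price is the passage from a term to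
    constants for arbitrary [c]: the qWNU identities speak only of tuples with all entries but one
    equal, so it must be shown that a nonempty symmetric invariant relation contains such a tuple.
    The tool is relations with a center, that is, with an element related to everything: under
    idempotence and minimality these are full.

    On the machine side [A^k] is too large to be indexed by one register bounded by the length of
    the word. The loop language therefore has one array whose head only steps right or returns to
    the start, and an address is reached by nested loops, one digit per coordinate. No offsets into
    tables are computed: all [k]-tuples of positions of the word are tried, and those that are not
    starts of rows of one table are discarded. *)

Lemma perm_place (n : nat) (s : seq 'I_n.+1) : uniq s ->
  exists p : {perm 'I_n.+1}, forall t : 'I_n.+1, t < size s -> p t = nth ord0 s t.
Proof.
move=> us; set s' := s ++ [seq i <- enum 'I_n.+1 | i \notin s].
have us' : uniq s'.
  rewrite cat_uniq us filter_uniq ?enum_uniq // andbT.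
  by apply/hasPn => i; rewrite mem_filter => /andP[].
have ss' : size s' = n.+1.
  rewrite -(card_uniqP us') -[RHS]card_ord; apply: eq_card => i.
  by rewrite mem_cat mem_filter mem_enum inE andbT orbN.
have inj : injective (fun t : 'I_n.+1 => nth ord0 s' t).
  by move=> i j /eqP; rewrite nth_uniq ?ss' // => /eqP/val_inj.
by exists (perm inj) => t tlt; rewrite permE nth_cat tlt.
Qed.

Section Symmetric.

Variables (T : finType) (n : nat).
Local Notation I := 'I_n.+2.
Local Notation tup := {ffun I -> T}.
Variable w : tup -> T.
Local Notation W f := (w [ffun r => f r]).

Definition wclosed (B : {set T}) := forall z : I -> T, (forall r, z r \in B) -> W z \in B.
Definition wclosed2 (P : {set T * T}) := forall z z' : I -> T,
  (forall r, (z r, z' r) \in P) -> (W z, W z') \in P.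

Lemma eq_W (f g : I -> T) : f =1 g -> W f = W g.
Proof. by move=> fg; congr w; apply/ffunP=> i; rewrite !ffunE. Qed.

Hypothesis w_idem : forall x, W (fun=> x) = x.
Hypothesis w_wnu : forall (x y : T) (i j : I),
  W (fun l => if l == i then y else x) = W (fun l => if l == j then y else x).

Variable Q : {set tup}.
Hypothesis Q_sym : forall q (s : {perm I}), q \in Q -> [ffun l => q (s l)] \in Q.
Hypothesis Q_closed : forall M : I -> tup, (forall r, M r \in Q) ->
  [ffun l => W (fun r => M r l)] \in Q.
Variable q0 : tup.
Hypothesis Qq0 : q0 \in Q.

Hypothesis Q_big : forall B, wclosed B -> (exists2 q, q \in Q & forall l, q l \in B) ->
  forall x, x \in B.

(** Some tuple of [Q] has its [l]-th entry in the [l]-th set of the list, with no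
    condition beyond the length of the list.  By symmetry of [Q] only the multiset
    of the sets in the list matters. *)
Definition sat (F : seq {set T}) := [exists q in Q, [forall l : I, q l \in nth setT F l]].

Lemma satP F : reflect (exists2 q, q \in Q & forall l : I, q l \in nth setT F l) (sat F).
Proof.
apply: (iffP existsP) => [[q /andP[qQ /forallP Fq]]|[q qQ Fq]]; first by exists q.
by exists q; rewrite qQ; apply/forallP.
Qed.

(** The witness is the coordinatewise image under [w] of one witness for each [F r]. The closure
    under [w] of the relations defined below by [sat] comes from here. *)
Lemma sat_W (F : I -> seq {set T}) (G : seq {set T}) :
  (forall r, sat (F r)) ->
  (forall l (z : I -> T), (forall r, z r \in nth setT (F r) l) -> W z \in nth setT G l) ->
  sat G.
Proof.
move=> sF FG.
have /fin_all_exists2[M MQ MF] : forall r, exists2 q, q \in Q &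
    forall l : I, q l \in nth setT (F r) l.
  by move=> r; apply/satP.
by apply/satP; eexists; [exact: (Q_closed MQ) | move=> l; rewrite ffunE; apply: FG].
Qed.

Lemma sat_place (F : seq {set T}) (q : tup) (s : seq I) : q \in Q -> uniq s ->
  size F <= size s ->
  (forall t, t < size F -> q (nth ord0 s t) \in nth setT F t) -> sat F.
Proof.
move=> qQ us sF Ft; have [p ps] := perm_place us.
apply/satP; exists [ffun l => q (p l)]; first exact: Q_sym.
move=> l; rewrite ffunE; case: (ltnP l (size F)) => [ls|ls].
  by rewrite ps; [apply: Ft | apply: leq_trans sF].
by rewrite nth_default ?inE.
Qed.

(** The bound on the length matters: [sat] ignores members of the list beyond position [n.+1], so a
    longer list could lose or gain a condition when permuted. *)
Lemma sat_perm (F G : seq {set T}) : size G <= n.+2 -> perm_eq F G -> sat G -> sat F.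
Proof.
move=> sG /(perm_iotaP setT)[Is Isp FE] /satP[q qQ qG].
have lt i : i \in Is -> i < n.+2.
  by rewrite (perm_mem Isp) mem_iota /= => /leq_trans; apply.
apply: (@sat_place _ q [seq inord i | i <- Is] qQ); rewrite ?FE ?size_map //.
  rewrite map_inj_in_uniq ?(perm_uniq Isp) ?iota_uniq // => x y xI yI /(congr1 val) /=.
  by rewrite !inordK ?lt.
move=> t tlt; rewrite (nth_map 0) // (nth_map 0) //.
have := qG (inord (nth 0 Is t)); rewrite inordK //; apply: lt; exact: mem_nth.
Qed.

Lemma sat_sub (F G : seq {set T}) : (forall l, nth setT F l \subset nth setT G l) ->
  sat F -> sat G.
Proof.
by move=> FG /satP[q qQ qF]; apply/satP; exists q => // l; apply: (subsetP (FG l)).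
Qed.

Definition cnt (B : {set T}) (q : tup) := #|[set l | q l \in B]|.
Definition mcnt (B : {set T}) := \max_(q in Q) cnt B q.

Lemma mcnt_ge B q : q \in Q -> cnt B q <= mcnt B.
Proof. by move=> qQ; apply: (@leq_bigmax_cond _ _ (fun q => cnt B q)). Qed.

Lemma mcnt_ex B : exists2 q, q \in Q & cnt B q = mcnt B.
Proof.
have Q0 : 0 < #|Q| by apply/card_gt0P; exists q0.
by have [q qQ qE] := eq_bigmax_cond (fun q => cnt B q) Q0; exists q; rewrite // -qE.
Qed.

(** Otherwise some tuple of [Q] lies entirely in [B], and [Q_big] makes [B] everything. *)
Lemma mcnt_lt B : wclosed B -> (exists x, x \notin B) -> mcnt B < n.+2.
Proof.
move=> Bcl [x xB]; have [q qQ <-] := mcnt_ex B.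
rewrite ltn_neqAle -{2}[n.+2]card_ord max_card andbT; apply/eqP => full.
move/negP: xB; apply; apply: Q_big => //; exists q => // l.
have : l \in [set l | q l \in B].
  have /eqP-> : [set l | q l \in B] == [set: I].
    by rewrite eqEcard subsetT cardsT card_ord; have /eq_leq := esym full.
  by rewrite inE.
by rewrite inE.
Qed.

Lemma sat_nseq (B : {set T}) m : m <= n.+2 -> sat (nseq m B) = (m <= mcnt B).
Proof.
move=> mn; apply/idP/idP => [/satP[q qQ qB]|].
  apply: leq_trans (mcnt_ge B qQ); rewrite /cnt.
  have -> : m = #|[set l : I | l < m]|.
    by rewrite -sum1dep_card -(big_ord_widen _ (fun=> 1) mn) sum1_card card_ord.
  apply: subset_leq_card; apply/subsetP => l; rewrite !inE => lm.
  by have := qB l; rewrite nth_nseq lm.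
have [q qQ <-] := mcnt_ex B => mB.
apply: (@sat_place _ q (enum [set l | q l \in B]) qQ (enum_uniq _)).
  by rewrite size_nseq -cardE.
move=> t; rewrite size_nseq nth_nseq => tm; rewrite tm.
have : nth ord0 (enum [set l | q l \in B]) t \in enum [set l | q l \in B].
  by apply: mem_nth; rewrite -cardE; apply: leq_trans mB.
by rewrite mem_enum inE.
Qed.

Lemma shift_perm (i : I) : exists s : {perm I}, forall l, s l = (l + i)%R.
Proof.
have inj : injective (fun l : I => (l + i)%R) by move=> x y /GRing.addIr.
by exists (perm inj) => l; rewrite permE.
Qed.

(** * Pairs of entries of a tuple of the relation *)

Definition edges : {set T * T} := [set xy | sat [:: [set xy.1]; [set xy.2]]].

Lemma edges_closed : wclosed2 edges.
Proof.
move=> z z' zz'; rewrite inE.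
apply: (sat_W (F := fun r => [:: [set z r]; [set z' r]])).
  by move=> r; have := zz' r; rewrite inE.
by case=> [|[|l]] y yz; rewrite /= ?nth_nil ?inE //; apply/eqP/eq_W => r; apply/set1P/yz.
Qed.

Lemma edges_pair q i j : q \in Q -> i != j -> (q i, q j) \in edges.
Proof.
move=> qQ ij; rewrite inE; apply: (@sat_place _ q [:: i; j]) => //=; first by rewrite inE ij.
by case=> [|[|t]] //= _; rewrite inE.
Qed.

(** The [y] that work form a closed set, so by [Q_big] one tuple of [Q] with all entries working is
    enough. Its row 0 is [q] shifted by one, its other rows are [q]. In column [l] the WNU identity
    moves the odd entry [q (l + 1)] from row 0 to row [l]; then each row pairs entries of [q] at two
    different positions. *)
Lemma edges_univ q y : q \in Q -> (y, W q) \in edges.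
Proof.
move=> qQ; pose B := [set y | (y, W q) \in edges].
suff : y \in B by rewrite inE.
apply: Q_big.
  move=> z zB; rewrite inE -[X in (_, X)]w_idem.
  by apply: edges_closed => r; have := zB r; rewrite inE.
have [s sE] := shift_perm 1%R.
exists [ffun l => W (fun r => (if r == 0%R then [ffun l => q (s l)] else q) l)].
  by apply: Q_closed => r; case: eqP => _ //; apply: Q_sym.
move=> l; rewrite ffunE inE.
have -> : W (fun r => (if r == 0%R then [ffun l => q (s l)] else q) l) =
   W (fun r => if r == l then q (l + 1)%R else q l).
  rewrite -(w_wnu _ _ 0%R); apply: eq_W => r.
  by case: eqP; rewrite // ffunE sE.
apply: edges_closed => r; case: (altP eqP) => [->|rl].
  by apply: edges_pair; rewrite // -GRing.subr_eq0 GRing.addrC GRing.addKr.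
by apply: edges_pair; rewrite // eq_sym.
Qed.

(** By [Q_big] it suffices that all entries of one tuple are joined to everything. Applying [w] to
    all cyclic shifts of [q0] makes every column again a shift of [q0], so that [edges_univ] applies
    to every entry of the result. *)
Lemma edges_full x y : (x, y) \in edges.
Proof.
pose Z := [set u | [forall y, (y, u) \in edges]].
suff : y \in Z by rewrite inE => /forallP.
apply: Q_big.
  move=> z zZ; rewrite inE; apply/forallP => y'; rewrite -[y']w_idem.
  by apply: edges_closed => r; have := zZ r; rewrite inE => /forallP.
have [s sE] : exists s : I -> {perm I}, forall i l, s i l = (l + i)%R.
  by have /fin_all_exists[f fE] := shift_perm; exists f.
exists [ffun l => W (fun r => [ffun l => q0 (s r l)] l)].
  by apply: Q_closed => r; apply: Q_sym.
move=> l; rewrite ffunE inE; apply/forallP => y'.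
have -> : W (fun r => [ffun l => q0 (s r l)] l) = W [ffun r => q0 (s l r)].
  by apply: eq_W => r; rewrite !ffunE !sE GRing.addrC.
by apply: edges_univ; apply: Q_sym.
Qed.

(** * Binary relations with a center *)

Definition nb (P : {set T * T}) u := [set y | (u, y) \in P].
Definition center (P : {set T * T}) := [set u | [forall y, (u, y) \in P]].
Definition psym (P : {set T * T}) := forall x y, (x, y) \in P -> (y, x) \in P.

Lemma nb_closed P u : wclosed2 P -> wclosed (nb P u).
Proof.
move=> Pc z zP; rewrite inE -[u]w_idem; apply: Pc => r.
by have := zP r; rewrite inE.
Qed.

Lemma nb_W P (u z : I -> T) : wclosed2 P -> (forall r, z r \in nb P (u r)) ->
  W z \in nb P (W u).
Proof. by move=> Pc zu; rewrite inE; apply: Pc => r; have := zu r; rewrite inE. Qed.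

Lemma center_closed P : wclosed2 P -> wclosed (center P).
Proof.
move=> Pc z zP; rewrite inE; apply/forallP => y; rewrite -[y]w_idem; apply: Pc => r.
by have := zP r; rewrite inE => /forallP.
Qed.

(** A counterexample to [no_center] below. *)
Record good P : Prop := Good {
  good_sym : psym P;
  good_closed : wclosed2 P;
  good_center : exists c, c \in center P;
  good_proper : exists xy, xy \notin P }.

Lemma centerP (P : {set T * T}) c : reflect (forall y, (c, y) \in P) (c \in center P).
Proof. by rewrite inE; apply: forallP. Qed.

Lemma nb_center P c : c \in center P -> nb P c = setT.
Proof. by move=> /centerP cP; apply/setP => y; rewrite !inE cP. Qed.

Lemma center_nb P c u : psym P -> c \in center P -> c \in nb P u.
Proof. by move=> Ps /centerP cP; rewrite inE; apply: Ps. Qed.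

Lemma center_proper P : good P -> exists x, x \notin center P.
Proof.
by case=> _ _ _ [[x y] xyP]; exists x; apply: contra xyP => /centerP.
Qed.

Lemma nb_proper P u : psym P -> u \notin center P -> exists x, x \notin nb P u.
Proof.
move=> Ps; rewrite inE => /forallPn[y uy]; exists y; by rewrite inE.
Qed.

(** A good relation with a maximal center [C] and, among those with this center,
    minimal, is contradictory.  With [j] the largest number of entries in [C] of a
    tuple of [Q], maximality forces every element outside [C] to have [C] as its
    set of neighbours; the WNU then produces a tuple with [j.+1] entries in [C]. *)
Section Extremal.

Variable P : {set T * T}.
Hypothesis gP : good P.
Hypothesis Pmax : forall P', good P' -> center P \subset center P' -> center P' = center P.
Hypothesis Pmin : forall P', good P' -> center P \subset center P' -> P' \subset P -> P' = P.

Local Notation C := (center P).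
Local Notation j := (mcnt C).
Let Ps := good_sym gP.
Let Pc := good_closed gP.
Let Cc : wclosed C := center_closed Pc.

(** By [edges_full] even a pair [(c, c)] with [c] in the center occurs at two different positions of
    a tuple. *)
Lemma j_ge2 : 2 <= j.
Proof.
have [c cC] := good_center gP; rewrite -sat_nseq //.
have := edges_full c c; rewrite inE; apply: sat_sub.
by case=> [|[|l]] //=; rewrite ?sub1set.
Qed.

Lemma j_lt : j < n.+2.
Proof. exact: mcnt_lt Cc (center_proper gP). Qed.

(** It asks for [i.+1] entries in all. With [B = nb P a], [i = mcnt B] and both arguments equal to
    [a] this is one entry more than possible. *)
Definition link i B : {set T * T} :=
  [set uv | sat [:: nb P uv.1, nb P uv.2 & nseq i.-1 B]].

Lemma link_sym i (B : {set T}) : i < n.+2 -> psym (link i B).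
Proof.
move=> ik x y; rewrite !inE /=; apply: sat_perm; first by rewrite /= size_nseq; lia.
by rewrite -cat1s -[_ :: nb P y :: _]cat1s -[_ :: nseq _ _]cat1s -[nb P y :: nseq _ _]cat1s perm_catCA.
Qed.

Lemma link_closed i (B : {set T}) : wclosed B -> wclosed2 (link i B).
Proof.
move=> Bc z z' zz'; rewrite inE /=.
apply: (sat_W (F := fun r => [:: nb P (z r), nb P (z' r) & nseq i.-1 B])).
  by move=> r; have := zz' r; rewrite inE.
case=> [|[|l]] y yz; [exact: nb_W|exact: nb_W|].
move: yz => /=; rewrite nth_nseq; case: ifP => _ yz; [exact: Bc|by rewrite inE].
Qed.

Section Outside.

Variable a : T.
Hypothesis aC : a \notin C.
Local Notation B := (nb P a).
Local Notation i := (mcnt B).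

Let Bc : wclosed B := @nb_closed P a Pc.

Lemma i_lt : i < n.+2.
Proof. exact: mcnt_lt Bc (nb_proper Ps aC). Qed.

Lemma i_ge : j <= i.
Proof.
rewrite -sat_nseq ?(ltnW j_lt) //.
have : sat (nseq j C) by rewrite sat_nseq // ltnW // j_lt.
apply: sat_sub => l; rewrite !nth_nseq; case: ifP => // _.
by apply/subsetP => c; apply: center_nb.
Qed.

(** The suitable [y] form a closed set that contains every entry of a tuple with [i] entries in [B]:
    taking away one position leaves at least [i.-1] of these. *)
Lemma i_ex y : sat ([set y] :: nseq i.-1 B).
Proof.
pose Y := [set y | sat ([set y] :: nseq i.-1 B)].
suff : y \in Y by rewrite inE.
apply: Q_big => [z zY|].
  rewrite inE; apply: (sat_W (F := fun r => [set z r] :: nseq i.-1 B)).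
    by move=> r; have := zY r; rewrite inE.
  case=> [|l] y' /= yz; first by rewrite inE; apply/eqP/eq_W => r; apply/set1P.
  move: yz; rewrite nth_nseq; case: ifP => _ yz; [exact: Bc|by rewrite inE].
have [q qQ qi] := mcnt_ex B; exists q => // l; rewrite inE.
pose S := [set l | q l \in B]; pose s := enum (S :\ l).
have ss : i.-1 <= size s.
  rewrite -cardE; have := cardsD1 l S; have -> : #|S| = i by exact: qi.
  by case: (l \in S) => /= ?; lia.
apply: (@sat_place _ q (l :: s) qQ).
- by rewrite /= enum_uniq mem_enum !inE eqxx.
- by rewrite /= size_nseq.
case=> [|t] /=; first by rewrite inE.
rewrite size_nseq ltnS nth_nseq => ti; rewrite ti.
have : nth ord0 s t \in s by apply: mem_nth; apply: leq_trans ss.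
by rewrite mem_enum !inE => /andP[].
Qed.

(** An element of [C] imposes no condition, everything being its neighbour, and the other condition
    is met by an element of [C] supplied by [i_ex]. The pair [(a, a)] is missing because [i] is
    maximal. *)
Lemma link_good : good (link i B) /\ C \subset center (link i B).
Proof.
have RC : C \subset center (link i B).
  apply/subsetP => u uC; apply/centerP => v; rewrite inE /= nb_center //.
  have [c cC] := good_center gP.
  apply: (@sat_perm _ (rcons (nb P v :: nseq i.-1 B) setT)).
  - by rewrite /= size_rcons size_nseq /=; have := i_lt; have := i_ge; have := j_ge2; lia.
  - by rewrite perm_sym perm_rcons.
  have := i_ex c; apply: sat_sub => -[|l] /=; first by rewrite sub1set center_nb.
  rewrite nth_rcons size_nseq; case: ltnP => // li.
  by rewrite if_same subsetT.
split=> //; split.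
- exact: link_sym i_lt.
- exact: link_closed.
- by have [c cC] := good_center gP; exists c; apply: (subsetP RC).
exists (a, a); rewrite inE /=; apply/negP => h.
have : sat (nseq i.+1 B).
  have ip : 0 < i by apply: leq_trans i_ge; apply: leq_trans j_ge2.
  by rewrite -[in nseq _ _](prednK ip).
by rewrite sat_nseq ?ltnn // i_lt.
Qed.

(** A neighbour [v] of [y] belongs to the center of [link i B]: the entry in [C] is adjacent to any
    [u], and the entry [y] is adjacent to [v]. By maximality this center is [C]. *)
Lemma min_ex y : sat [:: C, [set y] & nseq i.-1 B] -> nb P y = C.
Proof.
move=> sy; have [gR RC] := link_good; have RE := Pmax gR RC.
apply/eqP; rewrite eqEsubset; apply/andP; split; last first.
  by apply/subsetP => c; apply: center_nb.
apply/subsetP => v vy; rewrite -RE; apply/centerP => u.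
apply: (link_sym i_lt); rewrite inE /=; move: sy; apply: sat_sub => -[|[|l]] //=.
  by apply/subsetP => c; apply: center_nb.
by rewrite sub1set inE; apply: Ps; rewrite inE in vy.
Qed.

End Outside.

(** Since [i < n.+2], a tuple with one entry in [C] and [i.-1] others in [B] has yet another entry,
    and [min_ex] applies to that one. *)
Lemma bot_ex : exists2 d, nb P d = C & d \notin C.
Proof.
have [a aC] := center_proper gP; have [c cC] := good_center gP.
pose B := nb P a; pose i := mcnt B.
have /satP[q qQ qF] : sat [:: C, setT & nseq i.-1 B].
  apply: (@sat_perm _ (C :: rcons (nseq i.-1 B) setT)).
  - by rewrite /= size_rcons size_nseq /=; have := i_lt aC; have := i_ge a; have := j_ge2; rewrite -/i; lia.
  - by rewrite perm_cons perm_sym perm_rcons.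
  have := i_ex aC c; apply: sat_sub => -[|l] /=; first by rewrite sub1set.
  rewrite nth_rcons size_nseq; case: ltnP => // li.
  by rewrite if_same subsetT.
have nbt : nb P (q 1%R) = C.
  apply: (min_ex aC); apply/satP; exists q => // l; have := qF l.
  case: l => -[|[|l]] lt //= _; rewrite inE; apply/eqP; congr (q _); exact: val_inj.
exists (q 1%R) => //; apply/negP => tC.
by have [x] := center_proper gP; rewrite -nbt nb_center // inE.
Qed.

Lemma link_bot : good (link j C) /\ C \subset center (link j C).
Proof. by have [d dC dn] := bot_ex; have := link_good dn; rewrite dC. Qed.

(** The intersection of both relations is good, its center contains [C], and [P] is minimal. *)
Lemma P_sub_link : P \subset link j C.
Proof.
have [[Rs Rc _ _] CR] := link_bot.
suff : P :&: link j C = P by move/setIidPl.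
have CI : C \subset center (P :&: link j C).
  apply/subsetP => c cC; apply/centerP => y; rewrite in_setI (centerP _ _ cC).
  exact: (centerP _ _ (subsetP CR c cC)).
apply: Pmin; rewrite ?subsetIl //; split.
- by move=> x y; rewrite !in_setI => /andP[/Ps-> /Rs->].
- move=> z z' zz'; rewrite in_setI Pc ?Rc // => r; by have := zz' r; rewrite in_setI => /andP[].
- by have [c cC] := good_center gP; exists c; apply: (subsetP CI).
by have [xy xyP] := good_proper gP; exists xy; rewrite in_setI (negPf xyP).
Qed.

Lemma j_pred : nseq j C = [:: C, C & nseq j.-2 C].
Proof. by have := j_ge2; case: j => [|[|]]. Qed.

Lemma sat_j : sat (nseq j C). Proof. by rewrite sat_nseq // ltnW // j_lt. Qed.

Lemma sat_j1 : ~~ sat (nseq j.+1 C). Proof. by rewrite sat_nseq ?ltnn // j_lt. Qed.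

Lemma sat_jT : sat (setT :: nseq j C).
Proof.
apply: (@sat_perm _ (rcons (nseq j C) setT)).
- by rewrite size_rcons size_nseq j_lt.
- by rewrite perm_sym perm_rcons.
have := sat_j; apply: sat_sub => l.
rewrite nth_rcons nth_nseq size_nseq; case: ltnP => // _; by rewrite if_same.
Qed.

(** Again [j.+1] entries in all. The condition is symmetric in both arguments and the parameter [r],
    so that the parameter can be exchanged with an argument. *)
Definition triple r : {set T * T} :=
  [set uv | sat [:: nb P uv.1, nb P uv.2, nb P r & nseq j.-2 C]].

Lemma triple_size r u v : size [:: nb P u, nb P v, nb P r & nseq j.-2 C] <= n.+2.
Proof. by rewrite /= size_nseq; have := j_ge2; have := j_lt; lia. Qed.

Lemma triple_sym r : psym (triple r).
Proof.
move=> x y; rewrite !inE /=; apply: sat_perm; first exact: triple_size.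
by apply/seq.permP => p /=; lia.
Qed.

Lemma triple_closed r : wclosed2 (triple r).
Proof.
move=> z z' zz'; rewrite inE /=.
apply: (sat_W (F := fun s => [:: nb P (z s), nb P (z' s), nb P r & nseq j.-2 C])).
  by move=> s; have := zz' s; rewrite inE.
case=> [|[|[|l]]] y yz; [exact: nb_W|exact: nb_W|exact: nb_closed|].
move: yz => /=; rewrite nth_nseq; case: ifP => _ yz; [exact: Cc|by rewrite inE].
Qed.

Lemma triple_ctrC r : C \subset center (triple r).
Proof.
apply/subsetP => c cC; apply/centerP => s; rewrite inE /= nb_center //.
have := sat_jT; rewrite j_pred; apply: sat_sub => -[|[|[|l]]] //=;
  by apply/subsetP => c'; apply: center_nb.
Qed.

(** For [t] in [nb P r] the inclusion [P_sub_link] gives a tuple with [j.-1] entries in [C] besides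
    the neighbours of [r] and [t]; one of them serves as neighbour of [s]. *)
Lemma triple_ctr_nb r : nb P r \subset center (triple r).
Proof.
apply/subsetP => t; rewrite inE => rt; apply/centerP => s.
have := subsetP P_sub_link _ rt; rewrite !inE /= => h.
apply: (@sat_perm _ [:: nb P r, nb P t, nb P s & nseq j.-2 C]); first exact: triple_size.
  by apply/seq.permP => p /=; lia.
move: h; have -> : nseq j.-1 C = C :: nseq j.-2 C by have := j_ge2; case: j => [|[|]].
apply: sat_sub => -[|[|[|l]]] //=; by apply/subsetP => c'; apply: center_nb.
Qed.

Lemma triple_full r : center (triple r) != C -> forall xy, xy \in triple r.
Proof.
move=> rC xy; apply: contraNT rC => xyn; apply/eqP/Pmax; last exact: triple_ctrC.
split; [exact: triple_sym|exact: triple_closed| |by exists xy].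
by have [c cC] := good_center gP; exists c; apply: (subsetP (triple_ctrC r)).
Qed.

(** If [u] had a neighbour outside [C], the center of [triple u] would exceed [C], so [triple u]
    would be full. By symmetry [u] would then lie in the center of [triple d], where [nb P d = C];
    so [triple d] would be full too, and its pair [(d, d)] gives [j.+1] entries in [C]. *)
Lemma nb_out u : u \notin C -> nb P u = C.
Proof.
move=> uC; apply/eqP; apply/contraT => nbu.
have Cnb : C \subset nb P u by apply/subsetP => c; apply: center_nb.
have [t tu tC] : exists2 t, t \in nb P u & t \notin C.
  have : ~~ (nb P u \subset C) by move: nbu; rewrite eqEsubset Cnb andbT.
  by case/subsetPn => t; exists t.
have Ou : forall xy, xy \in triple u.
  apply: triple_full; apply: contraNneq tC => <-; exact: (subsetP (triple_ctr_nb u)).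
have [d dC dn] := bot_ex.
have : (d, d) \in triple d.
  apply: triple_full; apply: contraNneq uC => <-; apply/centerP => t'.
  have := Ou (t', d); rewrite !inE /=; apply: sat_perm; first exact: triple_size.
  by apply/seq.permP => p /=; lia.
rewrite inE /= dC; have := sat_j1.
by rewrite -[nseq _ _]/(C :: nseq j C) j_pred => /negP.
Qed.

(** * Sets of arguments absorbed by the center *)

Definition absorbs (A : {set I}) :=
  [forall z : tup, [forall r, (r \notin A) ==> (z r \in C)] ==> (w z \in C)].

Lemma absorbsP (A : {set I}) : reflect
  (forall z : I -> T, (forall r, r \notin A -> z r \in C) -> W z \in C) (absorbs A).
Proof.
apply: (iffP forallP) => [h z zA|h z].
  have /implyP := h [ffun r => z r]; apply; apply/forallP => r; rewrite ffunE.
  by apply/implyP/zA.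
apply/implyP => /forallP zA; have -> : z = [ffun r => z r] by apply/ffunP => r; rewrite ffunE.
by apply: h => r; apply/implyP.
Qed.

Lemma absorbsN (A : {set I}) : ~~ absorbs A ->
  exists2 z : I -> T, (forall r, r \notin A -> z r \in C) & W z \notin C.
Proof.
case/forallPn => z; rewrite negb_imply => /andP[/forallP zA wz]; exists z.
  by move=> r; apply/implyP.
by rewrite (_ : [ffun r => z r] = z) //; apply/ffunP => r; rewrite ffunE.
Qed.

(** If both fail to absorb, the two witnesses are related by [P] in every row, as one of them is in
    [C] there. Hence their values are related although both lie outside [C], against [nb_out]. *)
Lemma absorbs_disjoint (A A' : {set I}) : [disjoint A & A'] -> ~~ absorbs A -> absorbs A'.
Proof.
move=> /pred0P dis /absorbsN[z zA wz]; apply: contraNT wz => /absorbsN[z' zA' wz'].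
rewrite -(nb_out wz') inE; apply: Pc => r.
case: (boolP (r \in A')) => [rA'|/zA' /centerP //].
apply: Ps; apply/centerP; apply: zA; apply/negP => rA.
by have := dis r; rewrite /= rA rA'.
Qed.

(** The entries of [e] at positions 1 to [j] are in [C]; in [sw l] the doubtful entry is at position
    [l] instead of 0. If these tuples are used as rows such that in every column the rows with a
    doubtful entry are absorbed, positions 0 to [j] of the result are all in [C], one too many. *)
Lemma extremal_false : False.
Proof.
have /satP[e eQ eC] := sat_jT.
have {}eC (l : I) : 0 < l <= j -> e l \in C.
  move=> /andP[l0 lj]; have := eC l; case: (nat_of_ord l) l0 lj => // m _ mj /=.
  by rewrite nth_nseq mj.
have no_all q : q \in Q -> ~ (forall l : I, l <= j -> q l \in C).
  move=> qQ qC; have /negP := sat_j1; apply; apply/satP; exists q => // l.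
  rewrite nth_nseq ltnS; case: leqP => [/qC //|]; by rewrite inE.
have jlt := j_lt; have j2 := j_ge2.
pose o2 : I := Ordinal (leq_ltn_trans j2 jlt).
pose sw (l : I) : tup := [ffun m => e (tperm 0%R l m)].
have swQ l : sw l \in Q by apply: (Q_sym _ eQ).
have sw0 l : sw l 0%R = e l by rewrite ffunE tpermL.
have swl l : sw l l = e 0%R by rewrite ffunE tpermR.
have swD l m : m != 0%R -> m != l -> sw l m = e m.
  by move=> m0 ml; rewrite ffunE tpermD // eq_sym.
have v1 : nat_of_ord (1%R : I) = 1 by [].
have e1 : e 1%R \in C by apply: eC; rewrite v1 /=; exact: ltnW.
have e2 : e o2 \in C by apply: eC; rewrite /= j2.
have o21 : o2 != 1%R by [].
have o20 : o2 != 0%R by [].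
have in0 (m : I) : m != 0%R -> m <= j -> e m \in C.
  by move=> m0 mj; apply: eC; rewrite mj andbT lt0n.
(* Three sets can be served because positions 0, 1 and 2 are all at most [j]. *)
have part3 (A1 A2 A3 : {set I}) : A1 :|: A2 :|: A3 = setT -> absorbs A1 -> absorbs A2 -> absorbs A3 -> False.
  move=> cov /absorbsP h1 /absorbsP h2 /absorbsP h3.
  pose M r := if r \in A1 then e else if r \in A2 then sw 1%R else sw o2.
  have MQ r : M r \in Q by rewrite /M; case: ifP => // _; case: ifP.
  apply: (no_all _ (Q_closed MQ)) => l lj; rewrite ffunE.
  case: (altP (l =P 0%R)) => [->|l0].
    apply: h1 => r rA1; rewrite /M (negPf rA1); case: ifP => _; by rewrite sw0.
  case: (altP (l =P 1%R)) => [->|l1].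
    apply: h2 => r rA2; rewrite /M (negPf rA2); case: ifP => _ //.
    by rewrite swD // eq_sym.
  case: (altP (l =P o2)) => [->|l2].
    apply: h3 => r rA3; rewrite /M; case: ifP => // rA1.
    have -> : r \in A2 by have := in_setT r; rewrite -cov !inE rA1 (negPf rA3) orbF.
    by rewrite swD.
  apply: Cc => r; rewrite /M; case: ifP => _; [exact: in0|case: ifP => _; rewrite swD //; exact: in0].
have [x xC] := center_proper gP.
have nT : ~~ absorbs setT.
  apply/negP => /absorbsP h; move/negP: xC; apply; rewrite -(w_idem x); apply: h => r.
  by rewrite inE.
(* Proper subsets of [A0] absorb by minimality, its complement by [absorbs_disjoint]; so [part3]
   forces [A0] to be a singleton. *)
have [A0 /minsetP[A0n A0min]] := ex_minset (ex_intro (fun A => ~~ absorbs A) _ nT).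
have [i iA0] : exists i, i \in A0.
  apply/set0Pn; apply: contraNneq A0n => ->; apply/absorbsP => z zC; apply: Cc => r.
  by apply: zC; rewrite inE.
have A0i : A0 = [set i].
  apply/eqP; apply/contraT => ne; exfalso.
  apply: (part3 [set i] (A0 :\ i) (~: A0)).
  - apply/setP => r; rewrite !inE; case: eqP => //= _; exact: orbN.
  - apply/negPn/negP => h; move/negP: ne; apply; apply/eqP/esym/A0min => //; by rewrite sub1set.
  - apply/negPn/negP => h; have := A0min _ h (subsetDl _ _) => A0E.
    by move: iA0; rewrite -A0E !inE eqxx.
  - by apply: absorbs_disjoint A0n; rewrite -setI_eq0 setICr.
pose M r := if r == i then e else sw 1%R.
have MQ r : M r \in Q by rewrite /M; case: ifP.
apply: (no_all _ (Q_closed MQ)) => l lj; rewrite ffunE.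
case: (altP (l =P 0%R)) => [->|l0].
  have -> : W (fun r => M r 0%R) = W (fun r => if r == i then e 0%R else e 1%R).
    by apply: eq_W => r; rewrite /M; case: eqP; rewrite // sw0.
  (* The doubtful entry of column 0 stands in row [i], which is not absorbed; the WNU identity moves
     it to row [i + 1], which is. *)
  rewrite (w_wnu _ _ i (i + 1)%R).
  have /absorbsP : absorbs [set (i + 1)%R].
    apply: absorbs_disjoint A0n; rewrite A0i disjoints1 inE eq_sym.
    by rewrite -GRing.subr_eq0 GRing.addrC GRing.addKr.
  by apply=> r; rewrite inE => /negPf->.
case: (altP (l =P 1%R)) => [->|l1].
  have /absorbsP : absorbs (~: A0) by apply: absorbs_disjoint A0n; rewrite -setI_eq0 setICr.
  by apply=> r; rewrite A0i in_setC in_set1 negbK /M => /eqP->; rewrite eqxx.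
apply: Cc => r; rewrite /M; case: ifP => _; [exact: in0|rewrite swD //; exact: in0].
Qed.

End Extremal.

Definition goodb (P : {set T * T}) := [&& [forall x, forall y, ((x, y) \in P) ==> ((y, x) \in P)],
  [forall z : tup, forall z' : tup, [forall r, (z r, z' r) \in P] ==> ((w z, w z') \in P)],
  center P != set0 & P != setT].

Lemma goodP (P : {set T * T}) : reflect (good P) (goodb P).
Proof.
apply: (iffP and4P) => [[/forallP Ps /forallP Pc /set0Pn[c cP] PT]|[Ps Pc [c cP] [xy xyP]]].
  split.
  - by move=> x y; have /forallP/(_ y)/implyP := Ps x.
  - move=> z z' zz'; have /forallP/(_ [ffun r => z' r])/implyP := Pc [ffun r => z r].
    by apply; apply/forallP => r; rewrite !ffunE.
  - by exists c.
  - have : ~~ (setT \subset P) by rewrite subTset.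
    by case/subsetPn => xy; exists xy.
split.
- by apply/forallP => x; apply/forallP => y; apply/implyP/Ps.
- apply/forallP => z; apply/forallP => z'; apply/implyP => /forallP zz'.
  have fE (f : tup) : f = [ffun r => f r] by apply/ffunP => r; rewrite ffunE.
  by rewrite (fE z) (fE z'); apply: Pc.
- by apply/set0Pn; exists c.
- by apply: contraNneq xyP => ->; rewrite inE.
Qed.

Lemma no_center (P : {set T * T}) : psym P -> wclosed2 P -> (exists c, c \in center P) -> forall xy, xy \in P.
Proof.
move=> Ps Pc Pctr xy; apply/contraT => xyP; exfalso.
have /goodP g0 : good P by split=> //; exists xy.
(* A lexicographic weight: first a larger center, then a smaller relation. The factor [N] exceeds
   the number of pairs. *)
pose N := #|{: T * T}|.+1; pose mu (P' : {set T * T}) := #|center P'| * N + (N - #|P'|).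
case: (@arg_maxnP _ P goodb mu g0) => P' /goodP gP' max.
have lt (P'' : {set T * T}) : #|P''| < N by rewrite ltnS max_card.
apply: (extremal_false gP') => [P'' /goodP /max m sub|P'' /goodP /max m sub sub'].
  apply/eqP; rewrite eq_sym eqEcard sub /=; have := lt P''; have := lt P'.
  move: m; rewrite /mu; nia.
apply/eqP; rewrite eqEcard sub' /=; have := subset_leq_card sub.
have aux a b p p' M : a <= b -> p < M -> p' < M ->
    b * M + (M - p) <= a * M + (M - p') -> p' <= p.
  by move=> ab pM p'M; have := leq_mul ab (leqnn M); lia.
by move=> cN; apply: (aux _ _ _ _ N cN (lt _) (lt _) m).
Qed.

(** * Common neighbours and almost constant tuples *)

Definition comp (H : {set T * T}) : {set T * T} :=
  [set xy | [exists v, ((xy.1, v) \in H) && ((v, xy.2) \in H)]].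

Lemma compP (H : {set T * T}) x y : reflect (exists2 v, (x, v) \in H & (v, y) \in H) ((x, y) \in comp H).
Proof.
rewrite inE; apply: (iffP existsP) => [[v /andP[]]|[v xv vy]]; exists v => //.
by rewrite /= xv.
Qed.

Lemma comp_closed (H : {set T * T}) : wclosed2 H -> wclosed2 (comp H).
Proof.
move=> Hc z z' zz'.
have /fin_all_exists2[v vz vz'] : forall r, exists2 v, (z r, v) \in H & (v, z' r) \in H.
  by move=> r; apply/compP.
by apply/compP; exists (W v); apply: Hc.
Qed.

Lemma comp_sym (H : {set T * T}) : psym H -> psym (comp H).
Proof. by move=> Hs x y /compP[v xv vy]; apply/compP; exists v; apply: Hs. Qed.

(** If every two elements have a common neighbour, so do any finitely many: fix all
    but two of them; then "having a common neighbour with the fixed ones" is a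
    relation with a nonempty center. *)
Lemma full_comp (H : {set T * T}) : psym H -> wclosed2 H -> (forall xy, xy \in comp H) ->
  forall xy, xy \in H.
Proof.
move=> Hs Hc Hf.
have common (s : seq T) : exists v, forall a, a \in s -> (v, a) \in H.
  have [m] := ubnP (size s); elim: m s => // m IH [|a [|b [|c s]]] /= sm.
  - by exists (q0 ord0).
  - have /compP[v av _] := Hf (a, a); exists v => x; rewrite inE => /eqP->; exact: Hs.
  - have /compP[v av bv] := Hf (a, b); exists v => x; rewrite !inE.
    by case/orP => /eqP->; [exact: Hs|].
  pose P := [set xy | [exists v, [forall x, (x \in [:: xy.1, xy.2, c & s]) ==> ((v, x) \in H)]]].
  have PP x y : reflect (exists v, forall a, a \in [:: x, y, c & s] -> (v, a) \in H) ((x, y) \in P).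
    rewrite inE; apply: (iffP existsP) => -[v vP]; exists v.
      by move=> a' a's; have /forallP/(_ a')/implyP := vP; apply.
    by apply/forallP => a'; apply/implyP; apply: vP.
  have : (a, b) \in P; last by move/PP.
  apply: no_center.
  - by move=> x y /PP[v vP]; apply/PP; exists v => x' x's; apply: vP; move: x's; rewrite !inE orbCA.
  - move=> z z' zz'.
    have /fin_all_exists[v vP] : forall r, exists v, forall a, a \in [:: z r, z' r, c & s] -> (v, a) \in H.
      by move=> r; apply/PP.
    apply/PP; exists (W v) => x; rewrite !inE => /or3P[/eqP->|/eqP->|xs].
    + by apply: Hc => r; apply: vP; rewrite inE eqxx.
    + by apply: Hc => r; apply: vP; rewrite !inE eqxx orbT.
    + by rewrite -(w_idem x); apply: Hc => r; apply: vP; rewrite !inE xs !orbT.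
  exists c; apply/centerP => y; apply/PP.
  have [v vP] := IH [:: y, c & s] sm; exists v => x; rewrite !inE => xs; apply: vP.
  by rewrite !inE; move: xs; do 3!case: eqP => //=; rewrite ?orbT.
apply: no_center => //; have [v vP] := common (enum T); exists v; apply/centerP => y.
by apply: vP; rewrite mem_enum.
Qed.

(** In the induction step, [H] holds of the pairs that occur together with [m.+1] further entries
    [a]. By [no_center] and [full_comp] it is full once everything is reachable from [a] in two
    steps of [H]. By [Q_big] this need only be checked for the entries of one tuple, and the
    induction hypothesis gives one with [m.+2] entries [a]; two more positions are left for the
    intermediate vertices. *)
Lemma almost_const m a x : m < n -> sat [:: [set x] & nseq m.+1 [set a]].
Proof.
elim: m a x => [|m IH] a x mn.
  by have := edges_full x a; rewrite inE.
pose H : {set T * T} := [set xy | sat [:: [set xy.1], [set xy.2] & nseq m.+1 [set a]]].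
have Hs : psym H.
  move=> y z; rewrite !inE /=; apply: sat_perm; first by rewrite /= size_nseq; lia.
  by apply/seq.permP => p /=; lia.
have Hc : wclosed2 H.
  move=> z z' zz'; rewrite inE.
  apply: (sat_W (F := fun r => [:: [set z r], [set z' r] & nseq m.+1 [set a]])).
    by move=> r; have := zz' r; rewrite inE.
  case=> [|[|l]] y yz; try by rewrite /= inE; apply/eqP/eq_W => r; apply/set1P/yz.
  have nE (A B : {set T}) : nth setT [:: A, B & nseq m.+1 [set a]] l.+2 =
      if l < m.+1 then [set a] else setT by rewrite -(nth_nseq setT).
  rewrite nE; have {}yz r := yz r; move: yz; case: ifP => lm yz; last by rewrite inE.
  have {}yz r : y r = a by apply/set1P; have := yz r; rewrite nE lm.
  by rewrite inE -[a]w_idem; apply/eqP/eq_W => r; rewrite yz.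
have Ha : a \in center (comp H).
  pose B := [set x | (a, x) \in comp H].
  have Ba : forall x, x \in B; last by apply/centerP => y; have := Ba y; rewrite inE.
  apply: Q_big => [z zB|].
    rewrite inE -[X in (X, _)]w_idem; apply: comp_closed => // r; have := zB r; by rewrite inE.
  have /satP[q qQ qF] := IH a a (ltnW mn).
  have qa (l : I) : l <= m.+1 -> q l = a.
    by have := qF l; rewrite -[_ :: _]/(nseq m.+2 _) nth_nseq ltnS => + lm; rewrite lm => /set1P.
  (* Positions 0 to [m] hold the copies of [a] that [H] asks for, so any two later positions are
     joined. Position [m.+1] also holds [a] and is free to act as an end of an edge. *)
  have qH (l l' : I) : l != l' -> m < l -> m < l' -> (q l, q l') \in H.
    move=> ll' lm l'm; rewrite inE.
    have [s us [ss [sn sm]]] : exists2 s : seq I, uniq s & size s = m.+1 /\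
        (forall t, t <= m -> nth ord0 s t = t :> nat) /\ forall x, x \in s -> x <= m.
      exists [seq inord t | t <- iota 0 m.+1].
        rewrite map_inj_in_uniq ?iota_uniq // => t t'; rewrite !mem_iota => tm t'm.
        by move=> /(congr1 val); rewrite /= !inordK; lia.
      rewrite size_map size_iota; split=> //; split=> [t tm|y /mapP[t]].
        by rewrite (nth_map 0) ?size_iota // nth_iota // inordK; lia.
      by rewrite mem_iota => tm ->; rewrite inordK; lia.
    apply: (@sat_place _ q [:: l, l' & s]) => //.
    - rewrite /= us inE (negPf ll') andbT /=; apply/andP; split; apply/negP => /sm; lia.
    - by rewrite /= size_nseq ss.
    have nE (X Y : {set T}) t : nth setT [:: X, Y & nseq m.+1 [set a]] t.+2 =
        if t < m.+1 then [set a] else setT by rewrite -(nth_nseq setT).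
    case=> [|[|t]]; try by rewrite inE.
    rewrite nE /= size_nseq !ltnS => tm; rewrite tm.
    by rewrite inE qa // sn //; lia.
  have Hin m' : m' <= n.+1 -> nat_of_ord (inord m' : I) = m' by move=> ?; rewrite inordK.
  exists q => // l; rewrite inE; apply/compP.
  have aE : a = q (inord m.+1) by rewrite qa // Hin; lia.
  case: (ltnP m.+1 l) => lm.
    pose l' : I := if l == inord m.+2 then inord m.+3 else inord m.+2.
    have l'm : m.+1 < l' by rewrite /l'; case: ifP => _; rewrite Hin; lia.
    have l'l : l' != l.
      rewrite /l'; case: (l =P inord m.+2) => [->|/eqP]; last by rewrite eq_sym.
      by apply/eqP => /(congr1 val); rewrite /= !Hin; lia.
    exists (q l'); last by apply: qH => //; lia.
    rewrite aE; apply: qH; rewrite ?Hin; try lia.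
    by apply/eqP => /(congr1 val); rewrite /= Hin; lia.
  have Hq : (a, q (inord m.+2)) \in H.
    rewrite aE; apply: qH; rewrite ?Hin; try lia.
    by apply/eqP => /(congr1 val); rewrite /= !Hin; lia.
  by exists (q (inord m.+2)) => //; rewrite (qa l) //; apply: Hs.
have Hf : forall xy, xy \in H.
  apply: full_comp => //; apply: no_center; [exact: comp_sym|exact: comp_closed|by exists a].
by have := Hf (x, a); rewrite inE.
Qed.

(** From a tuple of [Q] with at most one exceptional entry, take as row [r] the shift that brings
    this entry to position [r]. In column [l] it stands in row [l], and by the WNU identity the
    value of [w] does not depend on [l]. *)
Lemma const_ex : exists a, [ffun=> a] \in Q.
Proof.
have [q qQ [i [a [b qE]]]] : exists2 q, q \in Q &
    exists i a b, forall l, q l = if l == i then b else a.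
  (* With only two positions every tuple has this form. *)
  case: (posnP n) => [n0|npos].
    exists q0 => //; exists 0%R, (q0 1%R), (q0 0%R) => l.
    case: eqP => [->//|l0]; congr (q0 _); apply: val_inj => /=.
    have : nat_of_ord l <> 0 by move=> l1; apply: l0; exact: val_inj.
    by have := ltn_ord l; lia.
  set a := q0 0%R; have /satP[q qQ qF] : sat (nseq n.+1 [set a]).
    by have := @almost_const n.-1 a a; rewrite prednK // => -> //; lia.
  exists q => //; exists ord_max, a, (q ord_max) => l; case: eqP => [->//|/eqP lm].
  have := qF l; rewrite nth_nseq; have -> : l < n.+1.
    by have := ltn_ord l; rewrite ltnS leq_eqVlt => /orP[/eqP lE|//]; case/eqP: lm; exact: val_inj.
  by move/set1P.
exists (W (fun r => if r == 0%R then b else a)).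
have /fin_all_exists[s sE] := shift_perm.
have -> : [ffun=> W (fun r => if r == 0%R then b else a)] =
   [ffun l => W (fun r => [ffun l => q (s (i - r)%R l)] l)].
  apply/ffunP => l; rewrite !ffunE (w_wnu _ _ _ l); apply: eq_W => r.
  have lE : (l + (i - r) == i)%R = (r == l).
    rewrite GRing.addrCA -[X in _ == X]GRing.addr0.
    by rewrite (inj_eq (@GRing.addrI _ i)) GRing.subr_eq0 eq_sym.
  by rewrite ffunE sE qE lE.
by apply: Q_closed => r; apply: Q_sym.
Qed.

End Symmetric.

(** * From quasi WNU to idempotent operations *)

Lemma iter_idem (T : finType) (u : T -> T) :
  exists2 m, 0 < m & forall x, iter m u (iter m u x) = iter m u x.
Proof.
(* The factorial is at least the length before the cycle and a multiple of the length of the cycle,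
   for every orbit at once. *)
exists #|T|`!; first exact: fact_gt0.
move=> x; rewrite -iterD.
have /injectivePn[i [j ij eij]] : ~~ injectiveb (fun t : 'I_#|T|.+1 => iter t u x).
  by apply/negP => /injectiveP/leq_card; rewrite card_ord ltnn.
wlog ltij : i j ij eij / i < j.
  move=> h; case: (ltngtP i j) => [ltij|ltji|/val_inj eqij]; first exact: (h i j).
    by apply: (h j i); rewrite // eq_sym.
  by rewrite eqij eqxx in ij.
have per N t : i <= N -> iter (N + t * (j - i)) u x = iter N u x.
  move=> iN; elim: t => [|t IH]; first by rewrite addn0.
  rewrite -IH mulSn -(subnK iN).
  have -> : N - i + i + (j - i + t * (j - i)) = (N - i + t * (j - i)) + j by lia.
  have -> : N - i + i + t * (j - i) = (N - i + t * (j - i)) + i by lia.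
  by rewrite !iterD -eij.
have iT : i <= #|T|`! by apply: leq_trans (fact_geq _); rewrite -ltnS.
have /dvdnP[t tE] : j - i %| #|T|`!.
  by apply: dvdn_fact; have := ltn_ord j; lia.
by rewrite [X in iter (_ + X)]tE per.
Qed.

Section General.

Variables (T : finType) (n : nat).
Local Notation I := 'I_n.+2.
Local Notation tup := {ffun I -> T}.
Variable Q : {set tup}.
Hypothesis Q_sym : forall q (s : {perm I}), q \in Q -> [ffun l => q (s l)] \in Q.

Lemma mem_ext (q q' : tup) : q \in Q -> q =1 q' -> q' \in Q.
Proof. by move=> qQ /ffunP <-. Qed.

(** [D] is replaced by a minimal closed subset that still contains all entries of
    some tuple of [Q]. *)
Lemma const_sub (w : tup -> T) (D : {set T}) :
  wclosed w D ->
  (forall x, x \in D -> w [ffun=> x] = x) ->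
  (forall (x y : T) (i j : I), x \in D -> y \in D ->
    w [ffun l => if l == i then y else x] = w [ffun l => if l == j then y else x]) ->
  (forall M : I -> tup, (forall r, M r \in Q) -> [ffun l => w [ffun r => M r l]] \in Q) ->
  (exists2 q, q \in Q & forall l, q l \in D) ->
  exists a, [ffun=> a] \in Q.
Proof.
move=> Dc Didem Dwnu Qc Dq.
pose bigb (B : {set T}) := [&& B \subset D, [forall z : tup, [forall r, z r \in B] ==> (w z \in B)] &
  [exists q in Q, [forall l, q l \in B]]].
have bigP (B : {set T}) : reflect [/\ B \subset D, wclosed w B & exists2 q, q \in Q & forall l, q l \in B] (bigb B).
  apply: (iffP and3P) => [[BD /forallP Bc /existsP[q /andP[qQ /forallP qB]]]|[BD Bc [q qQ qB]]].
    split=> //; last by exists q.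
    move=> z zB; have /implyP := Bc [ffun r => z r]; apply; apply/forallP => r.
    by rewrite ffunE.
  split=> //; last by apply/existsP; exists q; rewrite qQ; apply/forallP.
  apply/forallP => z; apply/implyP => /forallP zB.
  by rewrite (_ : z = [ffun r => z r]); [exact: Bc | apply/ffunP => r; rewrite ffunE].
have Db : bigb D by apply/bigP; split.
have [B /minsetP[/bigP[BD Bc [q qQ qB]] Bmin]] := ex_minset (ex_intro bigb _ Db).
pose T' : finType := {x : T | x \in B}.
have wB (z : {ffun I -> T'}) : w [ffun r => val (z r)] \in B by apply: Bc => r; exact: valP.
pose w' (z : {ffun I -> T'}) : T' := exist (fun x => x \in B) _ (wB z).
pose Q' : {set {ffun I -> T'}} := [set q : {ffun I -> T'} | [ffun l => val (q l)] \in Q].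
have w'E (f : I -> T') : val (w' [ffun r => f r]) = w [ffun r => val (f r)].
  by congr w; apply/ffunP => r; rewrite !ffunE.
have valD (x : T') : val x \in D := subsetP BD _ (valP x).
pose q' : {ffun I -> T'} := [ffun l => exist (fun x => x \in B) _ (qB l)].
have [] := @const_ex T' n w' _ _ Q' _ _ q'.
- by move=> x; apply: val_inj; rewrite w'E Didem.
- move=> x y i j; apply: val_inj; rewrite !w'E.
  transitivity (w [ffun l => if l == i then val y else val x]).
    by congr w; apply/ffunP => l; rewrite !ffunE; case: eqP.
  rewrite (Dwnu _ _ _ j) //; congr w; apply/ffunP => l; by rewrite !ffunE; case: eqP.
- move=> q1 s; rewrite !inE => /(Q_sym s); congr (_ \in Q).
  by apply/ffunP => l; rewrite !ffunE.
- move=> M MQ; rewrite inE.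
  have MQ' r : [ffun l => val (M r l)] \in Q by have := MQ r; rewrite inE.
  have := Qc (fun r => [ffun l => val (M r l)]) MQ'; congr (_ \in Q).
  apply/ffunP => l; rewrite !ffunE w'E; congr w; apply/ffunP => r; by rewrite !ffunE.
- by rewrite inE; move: qQ; congr (_ \in Q); apply/ffunP => l; rewrite !ffunE.
- move=> B' B'c [p pQ' pB'] x.
  have BE : [set val y | y in B'] = B.
    apply: Bmin; last by apply/subsetP => _ /imsetP[y _ ->]; exact: valP.
    apply/bigP; split.
    + apply: subset_trans BD; by apply/subsetP => _ /imsetP[y _ ->]; exact: valP.
    + move=> z zB'.
      have /fin_all_exists2[f fB' fE] : forall r, exists2 y, y \in B' & z r = val y.
        by move=> r; apply/imsetP.
      have -> : w [ffun r => z r] = val (w' [ffun r => f r]).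
        by rewrite w'E; congr w; apply/ffunP => r; rewrite !ffunE.
      by apply: imset_f; apply: B'c.
    exists [ffun l => val (p l)]; first by rewrite inE in pQ'.
    by move=> l; rewrite ffunE imset_f.
  have : val x \in [set val y | y in B'] by rewrite BE; exact: valP.
  by case/imsetP => y yB' /val_inj ->.
move=> a; rewrite inE => aQ; exists (val a).
by move: aQ; congr (_ \in Q); apply/ffunP => l; rewrite !ffunE.
Qed.

Theorem symmetric_const (w : tup -> T) (q0 : tup) :
  (forall (x y : T) (i j : I),
    w [ffun l => if l == i then y else x] = w [ffun l => if l == j then y else x]) ->
  (forall M : I -> tup, (forall r, M r \in Q) -> [ffun l => w [ffun r => M r l]] \in Q) ->
  q0 \in Q -> exists a, [ffun=> a] \in Q.
Proof.
move=> wnu Qc q0Q; pose u x := w [ffun=> x].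
have [[//|m] _ uE] := iter_idem u.
pose D := [set x | iter m.+1 u x == x].
have Qu q : q \in Q -> [ffun l => u (q l)] \in Q.
  move=> qQ; apply: mem_ext (Qc (fun=> q) (fun=> qQ)) _ => l.
  by rewrite !ffunE; congr w; apply/ffunP => r; rewrite !ffunE.
have Qit t q : q \in Q -> [ffun l => iter t u (q l)] \in Q.
  move=> qQ; elim: t => [|t /Qu h]; first by apply: mem_ext qQ _ => l; rewrite !ffunE.
  by apply: mem_ext h _ => l; rewrite !ffunE.
(* On constant tuples [w] is [u], which the inner [m] iterations complete to [iter m.+1 u], the
   identity on [D]; the outer [m.+1] iterations bring every value into [D]. *)
pose v z := iter (m.+1 + m) u (w z).
have vD z : v z \in D.
  by rewrite inE /v -iterD addnA iterD [iter (_ + _) _ _]iterD uE -!iterD.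
apply: (@const_sub v D).
- by move=> z _; apply: vD.
- by move=> x; rewrite inE => /eqP xE; rewrite /v -[w _]/(iter 1 u x) -iterD -addnA addn1 iterD xE xE.
- by move=> x y i j _ _; rewrite /v (wnu x y i j).
- move=> M MQ; have := Qit (m.+1 + m) _ (Qc _ MQ); congr (_ \in Q).
  by apply/ffunP => l; rewrite !ffunE.
exists [ffun l => iter m.+1 u (q0 l)]; first exact: Qit.
by move=> l; rewrite ffunE inE uE.
Qed.

End General.

(** * The local characterisation *)

Section Local.

Variables (A : algebra) (k : nat).
Local Notation T := (carrier A).
Local Notation state := {ffun 'I_k -> T}.

Definition op_state (f : 'I_(nops A)) (args : 'I_(arity f) -> state) : state :=
  [ffun l => op [tuple args j l | j < arity f]].

Inductive gen (c : state) : state -> Prop :=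
| gen_perm (s : {perm 'I_k}) : gen c [ffun l => c (s l)]
| gen_op (f : 'I_(nops A)) (args : 'I_(arity f) -> state) :
    (forall j, gen c (args j)) -> gen c (op_state args).

Definition gen_closed (c : state) (X : {set state}) :=
  (forall s : {perm 'I_k}, [ffun l => c (s l)] \in X) /\
  (forall f (args : 'I_(arity f) -> state), (forall j, args j \in X) -> op_state args \in X).

Lemma gen_sub c X v : gen_closed c X -> gen c v -> v \in X.
Proof. by case=> Xs Xf; elim=> // f args _ IH; apply: Xf. Qed.

(** The inductive definition does not decide membership. A set of generated tuples that is not
    closed can be enlarged by one more, and this must stop at the number of all tuples. *)
Lemma gen_set c : exists X : {set state}, forall v, v \in X <-> gen c v.
Proof.
suff [X [Xg Xc]] : exists X : {set state}, (forall v, v \in X -> gen c v) /\ gen_closed c X.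
  by exists X => v; split=> [/Xg//|]; apply: gen_sub.
suff H m : exists X : {set state}, (forall v, v \in X -> gen c v) /\
    (gen_closed c X \/ m <= #|X|).
  have [X [Xg [Xc|]]] := H #|{: state}|.+1; first by exists X.
  by rewrite ltnNge max_card.
elim: m => [|m [X [Xg [Xc|mX]]]]; first by exists set0; split=> [v|]; rewrite ?inE //; right.
  by exists X; split=> //; left.
have add v : gen c v -> v \notin X -> exists X : {set state}, (forall v, v \in X -> gen c v) /\
    (gen_closed c X \/ m < #|X|).
  move=> gv vX; exists (v |: X); split; first by move=> u /setU1P[->//|/Xg].
  by right; rewrite cardsU1 vX.
case: (boolP [forall s : {perm 'I_k}, [ffun l => c (s l)] \in X]) => [/forallP Xs|]; last first.
  by case/forallPn => s; apply: add; apply: gen_perm.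
case: (boolP [forall f, [forall args : {ffun 'I_(arity f) -> state},
    [forall j, args j \in X] ==> (op_state args \in X)]]) => [/forallP Xf|].
  exists X; split=> //; left; split=> // f args argsX.
  have /forallP/(_ [ffun j => args j])/implyP := Xf f.
  have -> : op_state [ffun j => args j] = op_state args.
    by apply/ffunP => l; rewrite !ffunE; congr op; apply: eq_mktuple => j; rewrite ffunE.
  by apply; apply/forallP => j; rewrite ffunE.
case/forallPn => f /forallPn[args]; rewrite negb_imply => /andP[/forallP aX].
by apply: add; apply: gen_op => j; apply: Xg.
Qed.

Lemma gen_term (m : nat) (t : term A m) c (M : 'I_m -> state) :
  (forall r, gen c (M r)) -> gen c [ffun l => eval t [tuple M r l | r < m]].
Proof.
move=> Mg; elim: t => [i|f args IH].
  have -> : [ffun l => eval (Var A i) [tuple M r l | r < m]] = M i.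
    by apply/ffunP => l; rewrite ffunE /= tnth_mktuple.
  exact: Mg.
have := gen_op IH; congr (gen c _); apply/ffunP => l; rewrite !ffunE /=.
by congr op; apply: eq_mktuple => j; rewrite ffunE.
Qed.

(** Permuting coordinates commutes with the operations and maps generators to generators. *)
Lemma gen_comp_perm c v (s : {perm 'I_k}) : gen c v -> gen c [ffun l => v (s l)].
Proof.
elim=> [s'|f args _ IH].
  have := gen_perm c (s * s'); congr (gen c _).
  by apply/ffunP => l; rewrite !ffunE permM.
have := gen_op IH; congr (gen c _); apply/ffunP => l; rewrite !ffunE.
by congr op; apply: eq_mktuple => j; rewrite ffunE.
Qed.

(** Renaming the variables of a term permutes its values on the near constant tuples, which realises
    the generators of [gen c] by terms. *)
Fixpoint tperm_term (s : {perm 'I_k}) (t : term A k) : term A k :=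
  match t with
  | Var i => Var A (s i)
  | App f args => App (fun j => tperm_term s (args j))
  end.

Lemma eval_tperm s t v : eval (tperm_term s t) v = eval t [tuple tnth v (s i) | i < k].
Proof.
elim: t => [i|f args IH] /=; first by rewrite tnth_mktuple.
by congr op; apply: eq_mktuple => j.
Qed.

Definition near_tuple (x y : T) (i : 'I_k) := [tuple if l == i then y else x | l < k].

Definition equalizes (t : term A k) (xy : T * T) :=
  exists a, forall i, eval t (near_tuple xy.1 xy.2 i) = a.

Lemma eval_tperm_near s t x y i :
  eval (tperm_term s t) (near_tuple x y i) = eval t (near_tuple x y (s^-1 i)%g).
Proof.
rewrite eval_tperm; congr eval; apply: eq_mktuple => l.
by rewrite tnth_mktuple -[l == _](inj_eq (@perm_inj _ s)) permKV.
Qed.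

Lemma equalizes_perm s t xy : equalizes t xy -> equalizes (tperm_term s t) xy.
Proof. by case=> a ta; exists a => i; rewrite eval_tperm_near. Qed.

Hypothesis k_gt0 : 0 < k.

Lemma equalizes_all (S : seq (T * T)) :
  (forall c, exists a, gen c [ffun=> a]) ->
  exists t, forall xy, xy \in S -> equalizes t xy.
Proof.
move=> loc; elim: S => [|[x y] S [t tS]]; first by exists (Var A (Ordinal k_gt0)).
pose c : state := [ffun i => eval t (near_tuple x y i)].
(* In place of an explicit composition, the induction on [gen] carries along the values at [(x, y)]
   and the equalities already won for [S]; renaming variables and applying operations preserve the
   latter. *)
have real v : gen c v -> exists2 t', (forall xy, xy \in S -> equalizes t' xy) &
    forall i, eval t' (near_tuple x y i) = v i.
  elim=> [s|f args _ IH].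
    exists (tperm_term s^-1 t) => [xy xyS|i]; first by apply: equalizes_perm; apply: tS.
    by rewrite eval_tperm_near invgK !ffunE.
  have [t' t'S t'x] : exists2 t' : 'I_(arity f) -> term A k,
      (forall j xy, xy \in S -> equalizes (t' j) xy) &
      forall j i, eval (t' j) (near_tuple x y i) = args j i.
    clear -IH k_gt0; elim: (arity f) args IH => [|m IHm] args IH.
      by exists (fun=> Var A (Ordinal k_gt0)) => -[].
    have [t0 t0S t0x] := IH ord0.
    have [t1 t1S t1x] := IHm (fun j => args (lift ord0 j)) (fun j => IH _).
    exists (fun j => if unlift ord0 j is Some j' then t1 j' else t0) => j.
      by case: unliftP => [j' _|_]; [apply: t1S|apply: t0S].
    by case: unliftP => [j' ->|->]; [apply: t1x|apply: t0x].
  exists (App t') => [xy xyS|i].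
    have /fin_all_exists[a aE] : forall j, exists a, forall i, eval (t' j) (near_tuple xy.1 xy.2 i) = a.
      by move=> j; apply: t'S.
    exists (op [tuple a j | j < arity f]) => i /=.
    by congr op; apply: eq_mktuple => j.
  by rewrite ffunE /=; congr op; apply: eq_mktuple => j.
have [a /real[t' t'S t'x]] := loc c.
exists t' => xy; rewrite inE => /orP[/eqP->|/t'S//].
by exists a => i; rewrite t'x ffunE.
Qed.

End Local.

Theorem qWNU_local (n : nat) (A : algebra) :
  has_qWNU n.+2 A <-> (forall c : {ffun 'I_n.+2 -> carrier A}, exists a, gen c [ffun=> a]).
Proof.
split=> [[w [[t wt] ww]] c|loc].
  have [X XE] := gen_set c.
  pose v (z : {ffun 'I_n.+2 -> carrier A}) := w [tuple z i | i < n.+2].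
  have [] := @symmetric_const _ n X _ v [ffun l => c ((1%g : {perm 'I_n.+2}) l)].
  - by move=> q s /XE /(gen_comp_perm s) /XE.
  - move=> x y i j; rewrite /v; have := ww x y i j; congr (w _ = w _);
      by apply: eq_mktuple => l; rewrite ffunE.
  - move=> M MX; apply/XE; have := gen_term t (fun r => (XE _).1 (MX r)).
    congr (gen c _); apply/ffunP => l; rewrite !ffunE /v wt; congr eval.
    by apply: eq_mktuple => r; rewrite ffunE.
  - by apply/XE/gen_perm.
  by move=> a /XE; exists a.
have [t tS] := equalizes_all (k := n.+2) isT (enum {: carrier A * carrier A}) loc.
exists (fun v => eval t v); split; first by exists t.
by move=> x y i j; have [a aE] := tS (x, y) (mem_enum _ _); rewrite !aE.
Qed.

(** * Turing machine programs *)

Section Fragments.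

Variables (N G : finType) (b : G).

Local Notation syms := {ffun N -> G}.
Local Notation acts := {ffun N -> G * move}.
Local Notation tapes := {ffun N -> tape G}.

Definition scan (T : tapes) : syms := [ffun i => scanned (T i)].
Definition act (a : acts) (T : tapes) : tapes := [ffun i => write_move b (T i) (a i)].
Definition idle (s : syms) : acts := [ffun i => (s i, Stay)].

Lemma act_idle T : act (idle (scan T)) T = T.
Proof. by apply/ffunP => i; rewrite !ffunE; case: (T i). Qed.

(** A program with one entry and one exit ([None]). *)
Record frag := Frag {
  fstate : finType;
  fstart : fstate;
  fstep : fstate -> syms -> option fstate * acts }.

(** The last argument counts machine steps, the exiting one included. *)
Inductive frun (M : frag) : fstate M -> tapes -> tapes -> nat -> Prop :=
| frun_exit q T a : fstep q (scan T) = (None, a) -> frun q T (act a T) 1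
| frun_next q q' T T' a t : fstep q (scan T) = (Some q', a) ->
    frun q' (act a T) T' t -> frun q T T' t.+1.

Definition runs M := frun (fstart M).

Definition Act (f : syms -> acts) : frag :=
  @Frag unit tt (fun _ s => (None, f s)).

Lemma runs_Act f T : runs (Act f) T (act (f (scan T)) T) 1.
Proof. exact: frun_exit. Qed.

Definition Seq (M M' : frag) : frag :=
  @Frag (fstate M + fstate M')%type (inl (fstart M)) (fun q s =>
    match q with
    | inl q => let: (o, a) := fstep q s in
        (Some (if o is Some q' then inl q' else inr (fstart M')), a)
    | inr q => let: (o, a) := fstep q s in (omap inr o, a)
    end).

Lemma runs_Seq M M' T1 T2 T3 t t' :
  runs M T1 T2 t -> runs M' T2 T3 t' -> runs (Seq M M') T1 T3 (t + t').
Proof.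
move=> run1 run2.
have lift2 q T T' u : frun q T T' u -> @frun (Seq M M') (inr q) T T' u.
  elim=> [{}q {}T a e|{}q q' {}T {}T' a {}u e _ IH].
    by apply: frun_exit; rewrite /= e.
  by apply: frun_next IH; rewrite /= e.
rewrite /runs /=; elim: run1 run2 => [q T a e run2|q q' T T' a u e _ IH run2].
  by rewrite add1n; apply: frun_next (lift2 _ _ _ _ run2); rewrite /= e.
by rewrite addSn; apply: frun_next (IH run2); rewrite /= e.
Qed.

(** The extra state [None] spends one idle step on the test, so the chosen branch starts on
    unchanged tapes. *)
Definition If (c : syms -> bool) (M M' : frag) : frag :=
  @Frag (option (fstate M + fstate M')%type) None (fun q s =>
    match q with
    | None => (Some (Some (if c s then inl (fstart M) else inr (fstart M'))), idle s)
    | Some (inl q) => let: (o, a) := fstep q s in (omap (Some \o inl) o, a)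
    | Some (inr q) => let: (o, a) := fstep q s in (omap (Some \o inr) o, a)
    end).

Lemma runs_If_true (c : syms -> bool) M M' T T' t : c (scan T) -> runs M T T' t -> runs (If c M M') T T' t.+1.
Proof.
move=> cT run.
have lift q T1 T2 u : frun q T1 T2 u -> @frun (If c M M') (Some (inl q)) T1 T2 u.
  elim=> [{}q {}T1 a e|{}q q' {}T1 {}T2 a {}u e _ IH].
    by apply: frun_exit; rewrite /= e.
  by apply: frun_next IH; rewrite /= e.
apply: (@frun_next (If c M M') _ (Some (inl (fstart M))) _ _ (idle (scan T))).
  by rewrite /= cT.
by rewrite act_idle; apply: lift.
Qed.

Lemma runs_If_false (c : syms -> bool) M M' T T' t : ~~ c (scan T) -> runs M' T T' t -> runs (If c M M') T T' t.+1.
Proof.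
move=> /negPf cT run.
have lift q T1 T2 u : frun q T1 T2 u -> @frun (If c M M') (Some (inr q)) T1 T2 u.
  elim=> [{}q {}T1 a e|{}q q' {}T1 {}T2 a {}u e _ IH].
    by apply: frun_exit; rewrite /= e.
  by apply: frun_next IH; rewrite /= e.
apply: (@frun_next (If c M M') _ (Some (inr (fstart M'))) _ _ (idle (scan T))).
  by rewrite /= cT.
by rewrite act_idle; apply: lift.
Qed.

Definition While (c : syms -> bool) (M : frag) : frag :=
  @Frag (option (fstate M)) None (fun q s =>
    match q with
    | None => (if c s then Some (Some (fstart M)) else None, idle s)
    | Some q => let: (o, a) := fstep q s in (Some (if o is Some q' then Some q' else None), a)
    end).

Lemma runs_While_false (c : syms -> bool) M T : ~~ c (scan T) -> runs (While c M) T T 1.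
Proof.
move=> /negPf cT; rewrite -{2}(act_idle T); apply: frun_exit; by rewrite /= cT.
Qed.

Lemma runs_While_true (c : syms -> bool) M T T' T'' t t' : c (scan T) -> runs M T T' t ->
  runs (While c M) T' T'' t' -> runs (While c M) T T'' (t + t').+1.
Proof.
move=> cT run run'.
have lift q T1 T2 u : frun q T1 T2 u -> runs (While c M) T2 T'' t' ->
    @frun (While c M) (Some q) T1 T'' (u + t').
  elim=> [{}q {}T1 a e|{}q q' {}T1 {}T2 a {}u e _ IH] r.
    by rewrite add1n; apply: frun_next r; rewrite /= e.
  by rewrite addSn; apply: frun_next (IH r); rewrite /= e.
apply: (@frun_next (While c M) _ (Some (fstart M)) _ _ (idle (scan T))).
  by rewrite /= cT.
by rewrite act_idle; apply: lift run'.
Qed.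

End Fragments.

(** The tapes are named by [option V], where [None] is the input tape. *)
Section Machine.

Variables (I V G : finType) (b : G) (f : I -> G).
Hypotheses (f_inj : injective f) (f_blank : forall a, f a != b).

Local Notation N := (option V).
Variables (M : frag N G) (accept : {ffun N -> G} -> bool).

Definition name_of (i : 'I_#|V|.+1) : N := omap enum_val (unlift ord0 i).
Definition index_of (x : N) : 'I_#|V|.+1 := oapp (fun v => lift ord0 (enum_rank v)) ord0 x.

Lemma index_ofK : cancel index_of name_of.
Proof. by case=> [v|]; rewrite /name_of /= ?liftK ?unlift_none //= enum_rankK. Qed.

(** The [unit] state is entered when the fragment exits and spends one step on evaluating [accept];
    the [bool] states halt with the answer. *)
Definition tm_state : finType := (fstate M + unit + bool)%type.

Definition tm_delta (q : tm_state) (s : {ffun 'I_#|V|.+1 -> G}) :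
    tm_state * {ffun 'I_#|V|.+1 -> G * move} :=
  let s' := [ffun x => s (index_of x)] in
  match q with
  | inl (inl q) => let: (o, a) := fstep q s' in
      (inl (if o is Some q' then inl q' else inr tt), [ffun i => a (name_of i)])
  | inl (inr _) => (inr (accept s'), [ffun i => (s i, Stay)])
  | inr _ => (q, [ffun i => (s i, Stay)])
  end.

Definition tm_of : TM I := @MkTM I tm_state G b f f_inj f_blank #|V|
  (inl (inl (fstart M))) (fun q => if q is inr r then Some r else None) tm_delta.

Definition init_tapes (w : seq I) : {ffun N -> tape G} :=
  [ffun x => if x is None then Tape [::] (head b (map f w)) (behead (map f w))
             else Tape [::] b [::]].

Definition tm_config (q : tm_state) (T : {ffun N -> tape G}) : config tm_of :=
  @Config I tm_of q [ffun i => T (name_of i)].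

Lemma tm_step q (T : {ffun N -> tape G}) : @step I tm_of (tm_config (inl q) T) =
  @Config I tm_of (tm_delta (inl q) [ffun i => scanned (T (name_of i))]).1
    [ffun i => write_move b (T (name_of i))
       ((tm_delta (inl q) [ffun i => scanned (T (name_of i))]).2 i)].
Proof.
rewrite /step /=.
have -> : [ffun i => scanned ([ffun i0 => T (name_of i0)] i)] =
  [ffun i => scanned (T (name_of i))] :> {ffun 'I_#|V|.+1 -> G}.
  by apply/ffunP => i; rewrite !ffunE.
by congr Config; apply/ffunP => i; rewrite !ffunE.
Qed.

Lemma scan_index (T : {ffun N -> tape G}) : [ffun x => [ffun i => scanned (T (name_of i))] (index_of x)] = scan T.
Proof. by apply/ffunP => x; rewrite !ffunE index_ofK. Qed.

Lemma tm_run q T T' t : frun b q T T' t ->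
  iter t (@step I tm_of) (tm_config (inl (inl q)) T) = tm_config (inl (inr tt)) T'.
Proof.
elim=> [{}q {}T a e|{}q q' {}T {}T' a {}t e _ IH].
  rewrite /= tm_step /= scan_index e /tm_config; congr Config.
  by apply/ffunP => i; rewrite !ffunE.
rewrite iterSr tm_step /= scan_index e -IH; congr (iter _ _ _); congr Config.
by apply/ffunP => i; rewrite !ffunE.
Qed.

Lemma tm_answers w T t : runs b M (init_tapes w) T t ->
  @answers_within I tm_of w t.+1 (accept (scan T)).
Proof.
move=> run; exists t.+1 => //.
have -> : init tm_of w = tm_config (inl (inl (fstart M))) (init_tapes w).
  rewrite /init /tm_config; congr Config; apply/ffunP => i; rewrite !ffunE /name_of.
  by case: unliftP => [j ->|->]; rewrite ?eqxx //= eq_sym (negPf (neq_lift _ _)).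
by rewrite iterS (tm_run run) tm_step /= scan_index.
Qed.

End Machine.

(** * A loop language and its compilation *)

Section Rep.

Variables (G : Type) (b : G).

(** The tape is used as infinite to the right only: nothing is said about cells left of position 0,
    and moving left requires [0 < p]. *)
Definition rep (T : tape G) (f : nat -> G) (p : nat) :=
  [/\ forall j, j < p -> nth b (lefts T) j = f (p - j.+1),
      scanned T = f p & forall j, nth b (rights T) j = f (p + j.+1)].

Lemma rep_ext T f g p : f =1 g -> rep T f p -> rep T g p.
Proof. by move=> fg [h1 h2 h3]; split=> *; rewrite -fg; auto. Qed.

Lemma rep_right T f p : rep T f p -> rep (write_move b T (scanned T, MoveRight)) f p.+1.
Proof.
case: T => l a r [/= h1 h2 h3]; split=> [[|j] jp /=||j /=].
- by rewrite h2 subn1.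
- by rewrite h1.
- by rewrite -nth0 h3 addn1.
- by rewrite nth_behead h3 addSnnS.
Qed.

Lemma rep_left T f p : 0 < p -> rep T f p -> rep (write_move b T (scanned T, MoveLeft)) f p.-1.
Proof.
case: T => l a r p0 [/= h1 h2 h3]; split=> [j jp /=||[|j] /=].
- by rewrite nth_behead h1; [congr f; lia|lia].
- by rewrite -nth0 h1 // subn1.
- by rewrite h2; congr f; lia.
- by rewrite h3; congr f; lia.
Qed.

Lemma rep_write T f p g : rep T f p ->
  rep (write_move b T (g, Stay)) (fun i => if i == p then g else f i) p.
Proof.
case: T => l a r [/= h1 h2 h3]; split=> [j jp /=||j /=]; rewrite ?eqxx //.
- by rewrite h1 //; case: eqP => //; lia.
- by rewrite h3; case: eqP => //; lia.
Qed.

End Rep.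

(** On every tape but the input tape position 0 carries [lmark]; the tape of a
    register also carries [rmark] at position [size w]. *)
Notation Gs := (option symbol).
Notation lmark := (Some EndTable).
Notation rmark := (Some EndRow).

Section Language.

Variable R : finType.
Notation V := (option (option R)).
Notation N := (option V).
Notation In := (None : N).
Notation Ar := (Some None : N).
Notation Tmp := (Some (Some None) : N).
Notation Re x := (Some (Some (Some x)) : N).

(** A register holds a number of at most [size w], stored as a head position, and
    [Inc] saturates there.  [Loop x c] runs [c] for [x = 0, ..., size w].  There are
    also a read-only head on the word, and a head on an unbounded array of bits
    that moves right ([ArR]) or back to the start ([ArRew]). *)
Inductive cmd :=
| Skip | Cat of cmd & cmd | Inc of R | Zero of R | Loop of R & cmd
| IfLt of R & R & cmd & cmd | IfZ of R & cmd & cmd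
| InR | InRew | IfIn of symbol & cmd & cmd
| ArR | ArRew | ArSet of bool | IfAr of cmd & cmd.

Record mem := Mem { reg : R -> nat; pin : nat; par : nat; arr : nat -> bool }.

Definition setr s x v := Mem (fun y => if y == x then v else reg s y) (pin s) (par s) (arr s).
Definition setpin s v := Mem (reg s) v (par s) (arr s).
Definition setpar s v := Mem (reg s) (pin s) v (arr s).
Definition setarr s v := Mem (reg s) (pin s) (par s) (fun i => if i == par s then v else arr s i).

Definition meq s s' :=
  [/\ reg s =1 reg s', pin s = pin s', par s = par s' & arr s =1 arr s'].

Fixpoint written (c : cmd) (x : R) : bool :=
  match c with
  | Cat c1 c2 | IfLt _ _ c1 c2 | IfZ _ c1 c2 | IfIn _ c1 c2 | IfAr c1 c2 =>
      written c1 x || written c2 x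
  | Inc y | Zero y => x == y
  | Loop y c => (x == y) || written c x
  | _ => false
  end.

(** The compiled loop has no counter besides the head on the tape of its variable, while [denote]
    runs through a fixed list of values; they agree when the body does not write the variable. *)
Fixpoint wf (c : cmd) : bool :=
  match c with
  | Cat c1 c2 | IfLt _ _ c1 c2 | IfZ _ c1 c2 | IfIn _ c1 c2 | IfAr c1 c2 => wf c1 && wf c2
  | Loop y c => ~~ written c y && wf c
  | _ => true
  end.

(** Upper bounds for the running time increased by twice the displacement of the
    array head: with this potential [ArRew] has constant cost. *)
Fixpoint cost (c : cmd) (l : nat) : nat :=
  match c with
  | Cat c1 c2 => cost c1 l + cost c2 l
  | IfLt _ _ c1 c2 => 4 * l + 3 + cost c1 l + cost c2 l
  | IfZ _ c1 c2 | IfIn _ c1 c2 | IfAr c1 c2 => 1 + cost c1 l + cost c2 l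
  | Loop _ c => 2 * l + 2 + l.+1 * (cost c l + 2)
  | Zero _ => 2 * l + 1
  | InRew => 2 * l + 3
  | _ => 4
  end.

(** A loop multiplies the bound by a factor linear in [l] and adds linear terms; the other
    constructs only add. So the degree depends on the command alone. *)
Lemma cost_poly c : exists a d, forall l, cost c l <= a * l.+1 ^ d.
Proof.
have lift a d d' l : d <= d' -> a * l.+1 ^ d <= a * l.+1 ^ d'.
  by move=> dd; rewrite leq_mul2l leq_pexp2l ?orbT.
have const a m l : m <= a -> m <= a * l.+1 ^ 0 by rewrite expn0 muln1.
have add c1 c2 : (exists a d, forall l, cost c1 l <= a * l.+1 ^ d) ->
    (exists a d, forall l, cost c2 l <= a * l.+1 ^ d) ->
    exists a d, forall l, 4 * l + 4 + cost c1 l + cost c2 l <= a * l.+1 ^ d.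
  move=> [a1 [d1 h1]] [a2 [d2 h2]]; exists (4 + a1 + a2), (1 + d1 + d2) => l.
  have := h1 l; have := h2 l; have := lift a1 d1 (1 + d1 + d2) l; have := lift a2 d2 (1 + d1 + d2) l.
  have := lift 4 1 (1 + d1 + d2) l; rewrite expn1; lia.
elim: c => [|c1 h1 c2 h2|x|x|x c [a [d h]]|x y c1 h1 c2 h2|x c1 h1 c2 h2|||x c1 h1 c2 h2|||x|c1 h1 c2 h2];
  try by exists 4, 0 => l; rewrite expn0.
all: try by have [a [d h]] := add _ _ h1 h2; exists a, d => l; apply: leq_trans (h l) => /=; lia.
- by exists 3, 1 => l /=; lia.
- exists (a + 6), d.+1 => l /=; have := h l; have := lift 6 1 d.+1 l.
  rewrite expn1 => /(_ isT); rewrite !expnS; nia.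
- by exists 3, 1 => l /=; lia.
Qed.

(** * Encoding memories on tapes, and the simulation *)

Section Run.

Variable w : seq symbol.
Notation L := (size w).
Hypothesis L_gt0 : 0 < L.

Definition inp (i : nat) : Gs := nth None (map Some w) i.

Fixpoint denote (c : cmd) (s : mem) : mem :=
  match c with
  | Skip => s
  | Cat c1 c2 => denote c2 (denote c1 s)
  | Inc x => setr s x (if reg s x < L then (reg s x).+1 else reg s x)
  | Zero x => setr s x 0
  | Loop x c => foldl (fun s i => denote c (setr s x i)) s (iota 0 L.+1)
  | IfLt x y c1 c2 => if reg s x < reg s y then denote c1 s else denote c2 s
  | IfZ x c1 c2 => if reg s x == 0 then denote c1 s else denote c2 s
  | InR => setpin s (if pin s < L then (pin s).+1 else pin s)
  | InRew => setpin s 0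
  | IfIn g c1 c2 => if inp (pin s) == Some g then denote c1 s else denote c2 s
  | ArR => setpar s (par s).+1
  | ArRew => setpar s 0
  | ArSet v => setarr s v
  | IfAr c1 c2 => if arr s (par s) then denote c1 s else denote c2 s
  end.

(** [In], [Ar], [Tmp] and [Re x] are the tapes of the word (which starts at
    position 1, so that blanks delimit it on both sides), of the array, of a
    scratch counter used by [IfLt], and of the register [x]. *)
Definition fin (i : nat) : Gs := if i is j.+1 then inp j else None.
Definition fmark (i : nat) : Gs := if i == 0 then lmark else if i == L then rmark else None.
Definition fstack (i : nat) : Gs := if i == 0 then lmark else None.
Definition farr (a : nat -> bool) (i : nat) : Gs :=
  if i is j.+1 then (if a j then Some Tally else None) else lmark.

Definition content s (x : N) : nat -> Gs :=
  match x with None => fin | Some None => farr (arr s)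
  | Some (Some None) => fstack | Some (Some (Some _)) => fmark end.
Definition position s u (x : N) : nat :=
  match x with
  | None => (pin s).+1 | Some None => (par s).+1
  | Some (Some None) => u | Some (Some (Some x)) => reg s x
  end.

Definition bounded s := (forall x, reg s x <= L) /\ pin s <= L.

Definition enc s u (T : {ffun N -> tape Gs}) :=
  bounded s /\ forall x, rep None (T x) (content s x) (position s u x).

Lemma enc_meq s s' u T : meq s s' -> enc s u T -> enc s' u T.
Proof.
case=> hr hi ha harr [[hb1 hb2] h]; split; first by split=> [x|]; rewrite -?hr -?hi.
move=> x; have -> : position s' u x = position s u x.
  by case: x => [[[x|]|]|] /=; rewrite ?hr ?hi ?ha.
apply: rep_ext (h x); case: x => [[x|]|] //= [|i] //=; by rewrite harr.
Qed.

Lemma scan_enc s u T x : enc s u T -> scan T x = content s x (position s u x).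
Proof. by case=> _ h; rewrite ffunE; case: (h x). Qed.

Lemma scan_Re s u T x : enc s u T -> scan T (Re x) = fmark (reg s x).
Proof. by move/scan_enc->. Qed.

Definition upd (X : {set N}) (h : Gs -> Gs * move) (s : {ffun N -> Gs}) : {ffun N -> Gs * move} :=
  [ffun x => if x \in X then h (s x) else (s x, Stay)].

Lemma act_upd X h T x :
  act None (upd X h (scan T)) T x =
  if x \in X then write_move None (T x) (h (scanned (T x))) else T x.
Proof. by rewrite !ffunE; case: ifP => // _; case: (T x). Qed.

Definition right1 x := Act (upd [set x] (fun g => (g, MoveRight))).
Definition left1 x := Act (upd [set x] (fun g => (g, MoveLeft))).

Lemma run_right1 s s' u u' T x : enc s u T -> bounded s' ->
  position s' u' x = (position s u x).+1 ->
  (forall y, content s' y = content s y) ->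
  (forall y, y != x -> position s' u' y = position s u y) ->
  exists2 T', runs None (right1 x) T T' 1 & enc s' u' T'.
Proof.
move=> [_ h] b' px cx py; eexists; first exact: runs_Act.
split=> // y; rewrite act_upd inE cx; case: (altP (y =P x)) => [->|yx].
  by rewrite px; apply: rep_right (h x).
by rewrite py.
Qed.

Definition skip : frag N Gs := Act (@idle N Gs).

Lemma run_skip T : runs None skip T T 1.
Proof. by rewrite -{2}(act_idle None T); apply: runs_Act. Qed.

Definition sees (x : N) (g : Gs) (s : {ffun N -> Gs}) := s x == g.
Definition unsees (x : N) (g : Gs) (s : {ffun N -> Gs}) := s x != g.

Definition zero x := While (unsees (Re x) lmark) (left1 (Re x)).

Lemma fmark_l v : (fmark v == lmark) = (v == 0).
Proof. by rewrite /fmark; case: (v =P 0) => //; case: (v =P L). Qed.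

Lemma fmark_r v : (fmark v == rmark) = (v == L).
Proof. by rewrite /fmark; case: (v =P 0) => [->|_]; [case: (0 =P L) => //; lia | case: (v =P L)]. Qed.

Lemma bounded_setr s x v : bounded s -> v <= L -> bounded (setr s x v).
Proof. by case=> h1 h2 vL; split=> //= y; case: eqP. Qed.

Lemma content_setr s x v y : content (setr s x v) y = content s y.
Proof. by case: y => [[|]|]. Qed.

Lemma position_setr s u x v y : y != Re x -> position (setr s x v) u y = position s u y.
Proof.
case: y => [[[y|]|]|] //= yx; rewrite ifN //; by apply: contraNneq yx => ->.
Qed.

Lemma meq_setr_id s x : meq s (setr s x (reg s x)).
Proof. by split=> // y /=; case: eqP => [->|]. Qed.

(** While the head on the input or array tape is rewound it visits cell 0, which corresponds to no
    memory; so the position on one tape is given separately. *)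
Definition encx s x0 p (T : {ffun N -> tape Gs}) :=
  forall x, rep None (T x) (content s x) (if x == x0 then p else position s 0 x).

Lemma enc_encx s x0 T : enc s 0 T -> encx s x0 (position s 0 x0) T.
Proof. by case=> _ h x; case: (x =P x0) => [->|_]; apply: h. Qed.

Lemma encx_enc s s' x0 p T : encx s x0 p T -> bounded s' ->
  (forall x, content s' x = content s x) -> position s' 0 x0 = p ->
  (forall x, x != x0 -> position s' 0 x = position s 0 x) -> enc s' 0 T.
Proof.
move=> h b' cE px po; split=> // x; have := h x; rewrite cE.
by case: (altP (x =P x0)) => [->|/po->//]; rewrite px.
Qed.

Lemma scan_encx s x0 p T : encx s x0 p T -> scan T x0 = content s x0 p.
Proof. by move=> h; rewrite ffunE; case: (h x0) => _ -> _; rewrite eqxx. Qed.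

Lemma run_rightx s x0 p T : encx s x0 p T ->
  exists2 T', runs None (right1 x0) T T' 1 & encx s x0 p.+1 T'.
Proof.
move=> h; eexists; first exact: runs_Act.
move=> y; rewrite act_upd inE; have := h y; case: (altP (y =P x0)) => // -> hx.
exact: rep_right.
Qed.

Lemma run_leftx s x0 p T : encx s x0 p.+1 T ->
  exists2 T', runs None (left1 x0) T T' 1 & encx s x0 p T'.
Proof.
move=> h; eexists; first exact: runs_Act.
move=> y; rewrite act_upd inE; have := h y; case: (altP (y =P x0)) => // -> hx.
by have := rep_left (ltn0Sn p) hx.
Qed.

(** Each cell costs a test and a move; one more test ends the loop. *)
Lemma run_rewind s x0 p g T : encx s x0 p T -> content s x0 0 = g ->
  (forall j, 0 < j <= p -> content s x0 j != g) ->
  exists2 T', runs None (While (unsees x0 g) (left1 x0)) T T' (2 * p + 1) & encx s x0 0 T'.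
Proof.
move=> + c0; elim: p T => [|p IH] T h cj.
  exists T => //; rewrite muln0; apply: runs_While_false.
  by rewrite /unsees (scan_encx h) c0 eqxx.
have [T1 run1 h1] := run_leftx h.
have [|T2 run2 h2] := IH _ h1; first by move=> j /andP[j0 jp]; apply: cj; rewrite j0 ltnW.
exists T2 => //; have -> : 2 * p.+1 + 1 = (1 + (2 * p + 1)).+1 by lia.
by apply: runs_While_true run1 run2; rewrite /unsees (scan_encx h) cj // ltn0Sn /=.
Qed.

Lemma run_zero s T x : enc s 0 T ->
  exists2 T', runs None (zero x) T T' (2 * reg s x + 1) & enc (setr s x 0) 0 T'.
Proof.
move=> sT; have [||T' run h] := run_rewind (g := lmark) (enc_encx (Re x) sT) => //.
  by move=> j /andP[j0 _]; rewrite /= fmark_l -lt0n.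
exists T' => //; apply: encx_enc h _ _ _ _; first by apply: bounded_setr => //; case: sT.
- by move=> y; rewrite content_setr.
- by rewrite /= eqxx.
by move=> y; apply: position_setr.
Qed.

(** For [IfLt] both heads go left together until one meets its left mark; the second register is the
    larger one precisely when its head has not arrived. [Tmp] counts the moves, and either branch
    first undoes them. In [Loop] the run for value 0 precedes the while loop, which looks for the
    right mark before each increment. *)
Fixpoint compile (c : cmd) : frag N Gs :=
  match c with
  | Skip => skip
  | Cat c1 c2 => Seq (compile c1) (compile c2)
  | Inc x => If (sees (Re x) rmark) skip (right1 (Re x))
  | Zero x => zero x
  | Loop x c => Seq (zero x) (Seq (compile c)
      (While (unsees (Re x) rmark) (Seq (right1 (Re x)) (compile c))))
  | IfLt x y c1 c2 =>
      Seq (While (fun s => unsees (Re x) lmark s && unsees (Re y) lmark s)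
             (Act (fun s => [ffun z =>
                if z == Tmp then (s z, MoveRight)
                else if z \in [:: Re x; Re y] then (s z, MoveLeft) else (s z, Stay)])))
        (let restore := While (unsees Tmp lmark)
             (Act (fun s => [ffun z =>
                if z == Tmp then (s z, MoveLeft)
                else if z \in [:: Re x; Re y] then (s z, MoveRight) else (s z, Stay)])) in
         If (unsees (Re y) lmark) (Seq restore (compile c1)) (Seq restore (compile c2)))
  | IfZ x c1 c2 => If (sees (Re x) lmark) (compile c1) (compile c2)
  | InR => If (sees In None) skip (right1 In)
  | InRew => Seq (left1 In) (Seq (While (unsees In None) (left1 In)) (right1 In))
  | IfIn g c1 c2 => If (sees In (Some g)) (compile c1) (compile c2)
  | ArR => right1 Ar
  | ArRew => Seq (While (unsees Ar lmark) (left1 Ar)) (right1 Ar)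
  | ArSet v => Act (upd [set Ar] (fun _ => (if v then Some Tally else None, Stay)))
  | IfAr c1 c2 => If (sees Ar (Some Tally)) (compile c1) (compile c2)
  end.

Lemma den_unwritten c s x : ~~ written c x -> reg (denote c s) x = reg s x.
Proof.
elim: c s => //=.
- by move=> c1 h1 c2 h2 s; rewrite negb_or => /andP[w1 w2]; rewrite h2 // h1.
- by move=> y s /negPf->.
- by move=> y s /negPf->.
- move=> y c IH s; rewrite negb_or => /andP[/negPf xy wc].
  have IHf r s' : reg (foldl (fun s i => denote c (setr s y i)) s' r) x = reg s' x.
    by elim: r s' => //= i r IHr s'; rewrite IHr IH //= xy.
  by rewrite IHf IH //= xy.
- by move=> y z c1 h1 c2 h2 s; rewrite negb_or => /andP[w1 w2]; case: ifP => _; auto.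
- by move=> y c1 h1 c2 h2 s; rewrite negb_or => /andP[w1 w2]; case: ifP => _; auto.
- by move=> y c1 h1 c2 h2 s; rewrite negb_or => /andP[w1 w2]; case: ifP => _; auto.
- by move=> c1 h1 c2 h2 s; rewrite negb_or => /andP[w1 w2]; case: ifP => _; auto.
Qed.

Lemma run_loop x c S T i m : ~~ written c x ->
  (forall s T, enc s 0 T -> exists T' t, [/\ runs None (compile c) T T' t,
     enc (denote c s) 0 T' & t + 2 * par (denote c s) <= cost c L + 2 * par s]) ->
  reg S x = i -> i + m = L -> enc S 0 T ->
  let S' := foldl (fun s i => denote c (setr s x i)) S (iota i.+1 m) in
  exists T' t, [/\ runs None (While (unsees (Re x) rmark) (Seq (right1 (Re x)) (compile c))) T T' t,
     enc S' 0 T' & t + 2 * par S' <= m * (cost c L + 2) + 1 + 2 * par S].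
Proof.
move=> wx IHc; elim: m i S T => [|m IH] i S T Sx im sT /=.
  exists T, 1; split=> //; apply: runs_While_false.
  by rewrite /unsees (scan_Re _ sT) Sx fmark_r negbK -im addn0.
have [bS _] := sT.
have [T1 run1 enc1] : exists2 T', runs None (right1 (Re x)) T T' 1 & enc (setr S x i.+1) 0 T'.
  apply: (run_right1 sT).
  - by apply: bounded_setr => //; lia.
  - by rewrite /= eqxx Sx.
  - by move=> y; rewrite content_setr.
  - by move=> y; apply: position_setr.
have [T2 [t2 [run2 enc2 c2]]] := IHc _ _ enc1.
have [||T3 [t3 [run3 enc3 c3]]] := IH i.+1 _ T2 _ _ enc2.
- by rewrite den_unwritten //= eqxx.
- by lia.
exists T3, (1 + t2 + t3).+1; split=> //; last first.
  by move: c2 c3; rewrite /= mulSn; lia.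
apply: runs_While_true run3; last exact: runs_Seq run1 run2.
by rewrite /unsees (scan_Re _ sT) Sx fmark_r; lia.
Qed.

Section Compare.

Variables (x y : R) (s : mem).

(** The memory shown by the tapes after [v] joint moves to the left, when [Tmp] holds [v]. *)
Definition dec v := Mem (fun z => if z \in [:: x; y] then reg s z - v else reg s z)
  (pin s) (par s) (arr s).

Lemma bounded_dec v : bounded s -> bounded (dec v).
Proof.
case=> b1 b2; split=> // z; apply: leq_trans (b1 z).
by change ((if z \in [:: x; y] then reg s z - v else reg s z) <= reg s z); case: ifP; rewrite ?leq_subr.
Qed.

Lemma content_dec v z : content (dec v) z = content s z.
Proof. by case: z => [[|]|]. Qed.

Lemma position_dec v u z : position (dec v) u z =
  if z == Tmp then u else if z \in [:: Re x; Re y] then position s 0 z - v else position s 0 z.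
Proof. by case: z => [[[z|]|]|] //=; rewrite !inE. Qed.

Lemma run_dec T v : bounded s -> v < minn (reg s x) (reg s y) -> enc (dec v) v T ->
  enc (dec v.+1) v.+1 (act None [ffun z =>
                if z == Tmp then (scan T z, MoveRight)
                else if z \in [:: Re x; Re y] then (scan T z, MoveLeft) else (scan T z, Stay)] T).
Proof.
move=> bs vm [_ h]; split.
  exact: bounded_dec.
move=> z; have := h z; rewrite !content_dec !position_dec !ffunE.
case: (z =P Tmp) => _; first exact: rep_right.
case: ifP => zxy; last by case: (T z).
move=> hz; have -> : position s 0 z - v.+1 = (position s 0 z - v).-1.
  by move: zxy; rewrite !inE => /orP[] /eqP-> /=; lia.
by apply: rep_left hz; move: zxy; rewrite !inE => /orP[] /eqP-> /=; lia.
Qed.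

Lemma run_inc T v : bounded s -> v < minn (reg s x) (reg s y) -> enc (dec v.+1) v.+1 T ->
  enc (dec v) v (act None [ffun z =>
                if z == Tmp then (scan T z, MoveLeft)
                else if z \in [:: Re x; Re y] then (scan T z, MoveRight) else (scan T z, Stay)] T).
Proof.
move=> bs vm [_ h]; split.
  exact: bounded_dec.
move=> z; have := h z; rewrite !content_dec !position_dec !ffunE.
case: (z =P Tmp) => _; first by move=> hz; have := rep_left (ltn0Sn v) hz.
case: ifP => zxy; last by case: (T z).
move=> hz; have -> : position s 0 z - v = (position s 0 z - v.+1).+1.
  by move: zxy; rewrite !inE => /orP[] /eqP-> /=; lia.
exact: rep_right.
Qed.

Definition descend := While (fun s => unsees (Re x) lmark s && unsees (Re y) lmark s)
             (Act (fun s : {ffun N -> Gs} => [ffun z =>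
                if z == Tmp then (s z, MoveRight)
                else if z \in [:: Re x; Re y] then (s z, MoveLeft) else (s z, Stay)])).

Definition ascend := While (unsees Tmp lmark)
             (Act (fun s : {ffun N -> Gs} => [ffun z =>
                if z == Tmp then (s z, MoveLeft)
                else if z \in [:: Re x; Re y] then (s z, MoveRight) else (s z, Stay)])).

Lemma run_descend T v m : bounded s -> v + m = minn (reg s x) (reg s y) -> enc (dec v) v T ->
  exists2 T', runs None descend T T' (2 * m + 1) & enc (dec (v + m)) (v + m) T'.
Proof.
move=> bs; elim: m v T => [|m IH] v T vm h.
  exists T; last by rewrite addn0.
  rewrite muln0; apply: runs_While_false; rewrite /unsees !(scan_Re _ h) !fmark_l /= !inE !eqxx orbT /=.
  lia.
have vlt : v < minn (reg s x) (reg s y) by lia.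
have h' := run_dec bs vlt h.
have [|T' run h2] := IH _ _ _ h'; first by lia.
exists T'; last by rewrite addnS -addSn.
have -> : 2 * m.+1 + 1 = (1 + (2 * m + 1)).+1 by lia.
apply: runs_While_true run; last exact: runs_Act.
rewrite /unsees !(scan_Re _ h) !fmark_l /= !inE !eqxx orbT /=; lia.
Qed.

Lemma run_ascend T v : bounded s -> v <= minn (reg s x) (reg s y) -> enc (dec v) v T ->
  exists2 T', runs None ascend T T' (2 * v + 1) & enc (dec 0) 0 T'.
Proof.
move=> bs; elim: v T => [|v IH] T vm h.
  exists T => //; rewrite muln0; apply: runs_While_false.
  by rewrite /unsees (scan_enc _ h).
have h' := run_inc bs vm h.
have [|T' run h2] := IH _ _ h'; first by lia.
exists T' => //; have -> : 2 * v.+1 + 1 = (1 + (2 * v + 1)).+1 by lia.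
apply: runs_While_true run; last exact: runs_Act.
by rewrite /unsees (scan_enc _ h).
Qed.

Lemma dec0 : meq (dec 0) s.
Proof. by split=> // z /=; rewrite subn0 if_same. Qed.

Lemma run_compare M1 M2 T : enc s 0 T ->
  exists T1 m, enc s 0 T1 /\ m <= 4 * L + 3 /\
   forall T2 t, runs None (if reg s x < reg s y then M1 else M2) T1 T2 t ->
     runs None (Seq descend (If (unsees (Re y) lmark) (Seq ascend M1) (Seq ascend M2))) T T2 (m + t).
Proof.
move=> sT; have [bs _] := sT; pose m := minn (reg s x) (reg s y).
have mL : m <= L by case: bs => /(_ x) + _; rewrite /m; lia.
have h0 : enc (dec 0) 0 T by apply: enc_meq sT; case: dec0 => *; split=> // ?; rewrite -?H.
have [|T1 run1 h1] := @run_descend _ 0 m bs _ h0; first by [].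
have [|T2 run2 h2] := run_ascend bs _ h1; first by [].
exists T2, (2 * m + 1 + (2 * m + 1).+1); split; first exact: enc_meq dec0 h2.
split=> [|T3 t run3]; first by lia.
rewrite -addnA; apply: runs_Seq run1 _; rewrite addSn.
have see : unsees (Re y) lmark (scan T1) = (reg s x < reg s y).
  by rewrite /unsees (scan_Re _ h1) fmark_l /= !inE eqxx orbT /m; lia.
move: run3; case: ifP => lt run3.
  by apply: runs_If_true; [rewrite see|apply: runs_Seq run2 run3].
by apply: runs_If_false; [rewrite see lt|apply: runs_Seq run2 run3].
Qed.

End Compare.

Lemma compileP c s T : wf c -> enc s 0 T ->
  exists T' t, [/\ runs None (compile c) T T' t, enc (denote c s) 0 T' &
    t + 2 * par (denote c s) <= cost c L + 2 * par s].
Proof.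
elim: c s T => [|c1 IH1 c2 IH2|x|x|x c IH|x y c1 IH1 c2 IH2|x c1 IH1 c2 IH2|||g c1 IH1 c2 IH2|||v|c1 IH1 c2 IH2] s T.
- move=> _ sT; exists T, 1; split=> //=; last by lia.
  exact: run_skip.
- move=> /= /andP[w1 w2] sT; have [T1 [t1 [r1 e1 l1]]] := IH1 _ _ w1 sT.
  have [T2 [t2 [r2 e2 l2]]] := IH2 _ _ w2 e1.
  by exists T2, (t1 + t2); split=> //; [apply: runs_Seq r1 r2|lia].
- move=> _ sT; have [[bx bp] _] := sT; rewrite [denote _ _]/=.
  case: ltnP => sx; last first.
    exists T, 2; split=> /=; [|by apply: enc_meq sT; apply: meq_setr_id|by lia].
    apply: runs_If_true (run_skip _); rewrite /sees (scan_Re _ sT) fmark_r; have := bx x; lia.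
  have [T1 run1 enc1] : exists2 T', runs None (right1 (Re x)) T T' 1 &
      enc (setr s x (reg s x).+1) 0 T'.
    apply: (run_right1 sT).
    - exact: bounded_setr.
    - by rewrite /= eqxx.
    - by move=> y; rewrite content_setr.
    - by move=> y; apply: position_setr.
  exists T1, 2; split=> //=; last by lia.
  by apply: runs_If_false run1; rewrite /sees (scan_Re _ sT) fmark_r; lia.
- move=> _ sT; have [T1 run1 enc1] := run_zero x sT.
  exists T1, (2 * reg s x + 1); split=> //=; have [[/(_ x) bx _] _] := sT; lia.
- move=> /= /andP[wx wc] sT; have [T1 run1 enc1] := run_zero x sT.
  have [T2 [t2 [run2 enc2 l2]]] := IH _ _ wc enc1.
  have [||T3 [t3 [run3 enc3 l3]]] := @run_loop x c (denote c (setr s x 0)) T2 0 L wx (fun s T => IH s T wc) _ _ enc2.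
  + by rewrite den_unwritten //= eqxx.
  + by [].
  exists T3, (2 * reg s x + 1 + (t2 + t3)); split=> //.
    by apply: runs_Seq run1 (runs_Seq run2 run3).
  have [[/(_ x) bx _] _] := sT; move: l2 l3; rewrite /= mulSn; lia.
- move=> /= /andP[w1 w2] sT; have [T1 [m [e1 [mL run]]]] := run_compare x y (compile c1) (compile c2) sT.
  move: run; case: ifP => _ run.
    have [T2 [t2 [r2 e2 l2]]] := IH1 _ _ w1 e1.
    by exists T2, (m + t2); split=> //; [apply: run|lia].
  have [T2 [t2 [r2 e2 l2]]] := IH2 _ _ w2 e1.
  by exists T2, (m + t2); split=> //; [apply: run|lia].
- move=> /= /andP[w1 w2] sT; case: eqP => sx.
    have [T2 [t2 [r2 e2 l2]]] := IH1 _ _ w1 sT.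
    exists T2, t2.+1; split=> //; last by lia.
    by apply: runs_If_true r2; rewrite /sees (scan_Re _ sT) sx.
  have [T2 [t2 [r2 e2 l2]]] := IH2 _ _ w2 sT.
  exists T2, t2.+1; split=> //; last by lia.
  by apply: runs_If_false r2; rewrite /sees (scan_Re _ sT) fmark_l; apply/eqP.
- move=> _ sT; have [[bx bp] _] := sT; rewrite [denote _ _]/=.
  have inpE i : i <= L -> (inp i == None) = (i == L).
    rewrite /inp leq_eqVlt => /orP[/eqP->|iL]; first by rewrite nth_default ?size_map ?eqxx.
    by rewrite (nth_map Tally) // ltn_eqF.
  case: ltnP => sx; last first.
    exists T, 2; split=> /=; [|apply: enc_meq sT; by split|by lia].
    by apply: runs_If_true (run_skip _); rewrite /sees (scan_enc _ sT) /= inpE //; lia.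
  have [T1 run1 enc1] : exists2 T', runs None (right1 In) T T' 1 &
      enc (setpin s (pin s).+1) 0 T'.
    by apply: (run_right1 sT) => // -[[|]|].
  exists T1, 2; split=> //=; last by lia.
  by apply: runs_If_false run1; rewrite /sees (scan_enc _ sT) /= inpE //; lia.
- move=> _ sT; have [[bx bp] _] := sT.
  (* The head may stand on the blank behind the word. One move to the left takes it off, so that the
     blank met next is the one in front of the word. *)
  have [T1 run1 h1] := run_leftx (enc_encx In sT).
  have [||T2 run2 h2] := run_rewind (g := None) h1; first by [].
    by move=> [|j] //= jp; rewrite /inp (nth_map Tally) //; lia.
  have [T3 run3 h3] := run_rightx h2.
  exists T3, (1 + (2 * pin s + 1 + 1)); split=> /=; last by lia.
    exact: runs_Seq run1 (runs_Seq run2 run3).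
  apply: encx_enc h3 _ _ _ _ => //; by case=> [[|]|].
- move=> /= /andP[w1 w2] sT; case: eqP => sx.
    have [T2 [t2 [r2 e2 l2]]] := IH1 _ _ w1 sT.
    exists T2, t2.+1; split=> //; last by lia.
    by apply: runs_If_true r2; rewrite /sees (scan_enc _ sT) /= sx.
  have [T2 [t2 [r2 e2 l2]]] := IH2 _ _ w2 sT.
  exists T2, t2.+1; split=> //; last by lia.
  by apply: runs_If_false r2; rewrite /sees (scan_enc _ sT) /=; apply/eqP.
- move=> _ sT; have [[bx bp] _] := sT.
  have [T1 run1 enc1] : exists2 T', runs None (right1 Ar) T T' 1 &
      enc (setpar s (par s).+1) 0 T'.
    by apply: (run_right1 sT) => // -[[|]|].
  by exists T1, 1; split=> //=; lia.
- move=> _ sT; have [[bx bp] _] := sT.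
  have [||T2 run2 h2] := run_rewind (g := lmark) (enc_encx Ar sT); first by [].
    by move=> [|j] //= jp; case: ifP.
  have [T3 run3 h3] := run_rightx h2.
  (* The potential drops by [2 * par s], which pays for all of these steps but 4. *)
  exists T3, (2 * (par s).+1 + 1 + 1); split=> /=; last by lia.
    exact: runs_Seq run2 run3.
  apply: encx_enc h3 _ _ _ _ => //; by case=> [[|]|].
- move=> _ [bs h]; eexists; exists 1; split; [exact: runs_Act| |by rewrite /=; lia].
  split=> // x; rewrite act_upd inE; have := h x; case: x => [[[x|]|]|] //= hx.
  apply: rep_ext (rep_write _ hx) => -[|i] //=.
  by rewrite eqSS; case: eqP => // _; case: v.
- move=> /= /andP[w1 w2] sT; case: ifP => sx.
    have [T2 [t2 [r2 e2 l2]]] := IH1 _ _ w1 sT.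
    exists T2, t2.+1; split=> //; last by lia.
    by apply: runs_If_true r2; rewrite /sees (scan_enc _ sT) /= sx.
  have [T2 [t2 [r2 e2 l2]]] := IH2 _ _ w2 sT.
  exists T2, t2.+1; split=> //; last by lia.
  by apply: runs_If_false r2; rewrite /sees (scan_enc _ sT) /= sx.
Qed.

End Run.
End Language.

(** * Preparing the tapes, and the test for one element *)

Section Program.

Variables (R : finType) (fl : R) (c : cmd R).
Notation V := (option (option R)).
Notation N := (option V).
Notation In := (None : N).
Notation Ar := (Some None : N).
Notation Tmp := (Some (Some None) : N).
Notation Re x := (Some (Some (Some x)) : N).

Definition is_reg (x : N) := if x is Some (Some (Some _)) then true else false.

Definition mark_left := Act (fun s : {ffun N -> Gs} => [ffun x : N =>
  if x == In then (s x, MoveRight) else (lmark, Stay)]).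

Definition advance := Act (fun s : {ffun N -> Gs} => [ffun x : N =>
  if (x == In) || is_reg x then (s x, MoveRight) else (s x, Stay)]).

Definition mark_right := Act (fun s : {ffun N -> Gs} => [ffun x : N =>
  if is_reg x then (rmark, Stay) else if x == In then (s x, Stay)
  else if x == Ar then (s x, MoveRight) else (s x, Stay)]).

(** The second letter is tested before anything that takes time depending on the length of the word.
    In the short branch the register heads still stand on their left marks, which will be read as
    the value 0, that is, as acceptance. In the long branch they follow the input head, which lays
    off the length of the word for the right marks. *)
Definition program : frag N Gs :=
  Seq mark_left
   (If (sees In (Some EndNum)) (skip _)
     (Seq (left1 In) (Seq (While (unsees In None) advance) (Seq mark_right (compile c))))).

Variable w : seq symbol.
Notation L := (size w).
Hypothesis L_gt0 : 0 < L.

Definition full_mem : mem R := Mem (fun _ => L) L 0 (fun _ => false).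

Definition sync (p q : nat) (T : {ffun N -> tape Gs}) := forall x : N,
  rep None (T x) (if x == In then fin w else fstack) (if x == In then q else if is_reg x then p else 0).

Lemma sync_mark_left : sync 0 2 (act None [ffun x : N =>
  if x == In then (scan (init_tapes V None Some w) x, MoveRight) else (lmark, Stay)]
  (init_tapes V None Some w)).
Proof.
move=> x; rewrite !ffunE; case: x => [v|] /=.
  rewrite if_same; split=> //= j; by rewrite nth_nil.
have h : rep None (Tape [::] (head None (map Some w)) (behead (map Some w))) (fin w) 1.
  split=> [[|j]||j]; try by [].
  by rewrite /= nth_behead.
exact: rep_right h.
Qed.

Lemma write_stay (G : Type) (b : G) T : write_move b T (scanned T, Stay) = T.
Proof. by case: T. Qed.

Lemma fin_eq_None i : 0 < i -> (fin w i == None) = (L < i).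
Proof.
case: i => // i _; rewrite /= /inp; case: (ltnP i L) => iL.
  by rewrite (nth_map Tally) //= ltnS leqNgt iL.
by rewrite nth_default ?size_map //= ltnS iL.
Qed.

Lemma run_advance m p T : p + m = L -> sync p p.+1 T ->
  exists2 T', runs None (While (unsees In None) advance) T T' (2 * m + 1) & sync L L.+1 T'.
Proof.
elim: m p T => [|m IH] p T pm h.
  rewrite addn0 in pm; subst p; exists T => //; apply: runs_While_false.
  by rewrite /unsees ffunE; case: (h In) => _ -> _; rewrite /= negbK -/(fin w L.+1) fin_eq_None.
have [||T' run h'] := IH p.+1 (act None [ffun x : N =>
  if (x == In) || is_reg x then (scan T x, MoveRight) else (scan T x, Stay)] T); first by lia.
  move=> x; rewrite !ffunE; have := h x; case: x => [[[x|]|]|] /=;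
    first [exact: rep_right | by rewrite write_stay].
exists T' => //; have -> : 2 * m.+1 + 1 = (1 + (2 * m + 1)).+1 by lia.
apply: runs_While_true run; last exact: runs_Act.
rewrite /unsees ffunE; case: (h In) => _ -> _; rewrite eqxx fin_eq_None //; lia.
Qed.

Lemma program_EndNum : inp w 1 = Some EndNum ->
  exists2 T, runs None program (init_tapes V None Some w) T 3 & scan T (Re fl) == lmark.
Proof.
move=> w1; have h := sync_mark_left; set T := act _ _ _ in h.
exists T; last by rewrite ffunE; case: (h (Re fl)) => _ -> _.
apply: (@runs_Seq _ _ _ _ _ _ _ _ 1 2 (runs_Act _ _ _)).
apply: runs_If_true (run_skip _); rewrite /sees ffunE; case: (h In) => _ -> _.
by rewrite /= w1.
Qed.

Lemma program_main : inp w 1 <> Some EndNum -> wf c ->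
  exists T t, [/\ runs None program (init_tapes V None Some w) T t,
     t <= cost c L + 2 * L + 10 &
     (scan T (Re fl) == lmark) = (reg (denote w c full_mem) fl == 0)].
Proof.
move=> w1 wfc; have h := sync_mark_left; set T := act _ _ _ in h.
have [T1 run1 h1] : exists2 T1, runs None (left1 In) T T1 1 & sync 0 1 T1.
  eexists; first exact: runs_Act.
  move=> x; rewrite act_upd inE; have := h x; case: (x =P In) => // -> hx.
  by have := rep_left (ltn0Sn 1) hx.
have [|T2 run2 h2] := run_advance _ h1 (m := L); first by [].
pose T3 := act None [ffun x : N => if is_reg x then (rmark, Stay)
  else if x == In then (scan T2 x, Stay) else if x == Ar then (scan T2 x, MoveRight)
  else (scan T2 x, Stay)] T2.
have run3 : runs None mark_right T2 T3 1 by exact: runs_Act.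
have enc3 : enc w full_mem 0 T3.
  split=> [|x]; first by split.
  rewrite !ffunE; have := h2 x; case: x => [[[x|]|]|] /= hx.
  - have := rep_write rmark hx; apply: rep_ext => i; rewrite /fmark /fstack.
    by case: (i =P L) => // ->; case: eqP => // L0; move: L_gt0; rewrite L0.
  - by rewrite write_stay.
  - have := rep_right hx; apply: rep_ext => -[|i] //.
  - by rewrite write_stay.
have [T4 [t [run4 enc4 tle]]] := compileP L_gt0 wfc enc3.
exists T4, (1 + (1 + (2 * L + 1 + (1 + t))).+1); split.
- apply: runs_Seq; first exact: runs_Act.
  apply: runs_If_false.
    by rewrite /sees ffunE; case: (h In) => _ -> _; apply/eqP.
  exact: runs_Seq run1 (runs_Seq run2 (runs_Seq run3 run4)).
- by move: tle; rewrite /=; lia.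
by rewrite (scan_Re _ enc4) fmark_l.
Qed.

End Program.

Lemma Some_neq_None (T : eqType) (a : T) : Some a != None. Proof. by []. Qed.

Theorem cmd_machine (R : finType) (fl : R) (c : cmd R) : wf c ->
  exists (M : TM symbol) (a d : nat), forall w, 0 < size w ->
    (inp w 1 = Some EndNum -> answers_within M w 4 true) /\
    (inp w 1 <> Some EndNum ->
       answers_within M w (a * (size w).+1 ^ d) (reg (denote w c (full_mem R w)) fl == 0)).
Proof.
move=> wfc; have [a [d cost_le]] := cost_poly c.
pose M := tm_of (@Some_inj _) (@Some_neq_None symbol) (program c)
  (fun s => s (Some (Some (Some fl))) == lmark).
(* The 13 and the extra degree absorb the at most [2 * size w + 10] steps outside the cost of [c]
   and the step that forms the verdict. *)
exists M, (a + 13), d.+1 => w w0; split=> w1.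
  have [T run acc] := program_EndNum fl c w1.
  have := tm_answers (@Some_inj _) (@Some_neq_None symbol) (fun s => s (Some (Some (Some fl))) == lmark) run.
  by rewrite acc.
have [T [t [run tle acc]]] := program_main fl w0 w1 wfc.
have := tm_answers (@Some_inj _) (@Some_neq_None symbol) (fun s => s (Some (Some (Some fl))) == lmark) run.
rewrite acc => -[s st vs]; exists s => //; apply: leq_trans st _.
apply: leq_ltn_trans tle _; apply: leq_ltn_trans (leq_add (leq_add (cost_le _) (leqnn _)) (leqnn _)) _.
have : 0 < (size w).+1 ^ d by rewrite expn_gt0.
rewrite expnS; nia.
Qed.

(** * Rules for loop programs *)

Section Rules.

Variables (R : finType) (w : seq symbol).
Notation L := (size w).
Implicit Types (c : cmd R) (s : mem R) (x y : R).
Notation den := (denote w).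

Fixpoint keeps_arr c : bool :=
  match c with
  | Cat c1 c2 | IfLt _ _ c1 c2 | IfZ _ c1 c2 | IfIn _ c1 c2 | IfAr c1 c2 =>
      keeps_arr c1 && keeps_arr c2
  | Loop _ c => keeps_arr c
  | ArSet _ => false
  | _ => true
  end.

Fixpoint keeps_par c : bool :=
  match c with
  | Cat c1 c2 | IfLt _ _ c1 c2 | IfZ _ c1 c2 | IfIn _ c1 c2 | IfAr c1 c2 =>
      keeps_par c1 && keeps_par c2
  | Loop _ c => keeps_par c
  | ArR | ArRew => false
  | _ => true
  end.

Lemma reg_setr s x v : reg (setr s x v) x = v. Proof. by rewrite /= eqxx. Qed.

Lemma reg_setr_neq s x v y : y != x -> reg (setr s x v) y = reg s y.
Proof. by move=> /negPf yx; rewrite /= yx. Qed.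

Lemma pin_setr s x v : pin (setr s x v) = pin s. Proof. by []. Qed.

Lemma den_inr s : den (InR R) s = setpin s (if pin s < L then (pin s).+1 else pin s).
Proof. by []. Qed.

Lemma den_zero x s : den (Zero x) s = setr s x 0. Proof. by []. Qed.

Lemma den_cat c1 c2 s : den (Cat c1 c2) s = den c2 (den c1 s). Proof. by []. Qed.

Lemma den_ifz x c1 c2 s :
  den (IfZ x c1 c2) s = if reg s x == 0 then den c1 s else den c2 s.
Proof. by []. Qed.

Lemma den_ifin g c1 c2 s :
  den (IfIn g c1 c2) s = if inp w (pin s) == Some g then den c1 s else den c2 s.
Proof. by []. Qed.

Lemma den_iflt x y c1 c2 s :
  den (IfLt x y c1 c2) s = if reg s x < reg s y then den c1 s else den c2 s.
Proof. by []. Qed.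

Lemma den_ifar c1 c2 s :
  den (IfAr c1 c2) s = if arr s (par s) then den c1 s else den c2 s.
Proof. by []. Qed.

Lemma den_inc x s : den (Inc x) s = setr s x (if reg s x < L then (reg s x).+1 else reg s x).
Proof. by []. Qed.

Lemma loop_rule (I : nat -> mem R -> Prop) x c s :
  I 0 s -> (forall i s, i <= L -> I i s -> I i.+1 (den c (setr s x i))) ->
  I L.+1 (den (Loop x c) s).
Proof.
move=> I0 IS; rewrite /=.
have H m i s' : i + m = L.+1 -> I i s' ->
    I L.+1 (foldl (fun s i => den c (setr s x i)) s' (iota i m)).
  elim: m i s' => [|m IH] i s' /=; first by rewrite addn0 => ->.
  by move=> im Is; apply: IH; [lia|apply: IS => //; lia].
by have := H L.+1 0 s erefl I0.
Qed.

Lemma loop_inv (I : mem R -> Prop) x c s :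
  I s -> (forall i s, i <= L -> I s -> I (den c (setr s x i))) -> I (den (Loop x c) s).
Proof. exact: (loop_rule (I := fun _ => I)). Qed.

Lemma den_keeps_arr c s : keeps_arr c -> arr (den c s) = arr s.
Proof.
elim: c s => [|c1 IH1 c2 IH2|||x c IH|x y c1 IH1 c2 IH2|x c1 IH1 c2 IH2|||x c1 IH1 c2 IH2||||c1 IH1 c2 IH2] s //;
  try (by move=> /= /andP[h1 h2]; case: ifP => _; auto).
- by move=> /= /andP[h1 h2]; rewrite IH2 // IH1.
- by move=> h; apply: (loop_inv (I := fun s' => arr s' = arr s)) => // i s' _ <-; rewrite IH.
Qed.

Lemma den_keeps_par c s : keeps_par c -> par (den c s) = par s.
Proof.
elim: c s => [|c1 IH1 c2 IH2|||x c IH|x y c1 IH1 c2 IH2|x c1 IH1 c2 IH2|||x c1 IH1 c2 IH2||||c1 IH1 c2 IH2] s //;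
  try (by move=> /= /andP[h1 h2]; case: ifP => _; auto).
- by move=> /= /andP[h1 h2]; rewrite IH2 // IH1.
- by move=> h; apply: (loop_inv (I := fun s' => par s' = par s)) => // i s' _ <-; rewrite IH.
Qed.

Lemma den_bounded c s : bounded w s -> bounded w (den c s).
Proof.
elim: c s => [|c1 IH1 c2 IH2|x|x|x c IH|x y c1 IH1 c2 IH2|x c1 IH1 c2 IH2|||x c1 IH1 c2 IH2||||c1 IH1 c2 IH2] s b //;
  try (by rewrite [denote _ _ _]/=; case: ifP => _; [exact: IH1|exact: IH2]).
- by apply: IH2; apply: IH1.
- by apply: bounded_setr => //; case: b => /(_ x) xL _; case: ifP.
- exact: bounded_setr.
- by apply: (loop_inv (I := @bounded R w)) => // i s' iL bs; apply: IH; apply: bounded_setr.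
- by case: b => b1 b2 /=; split=> //=; case: ifP.
- by case: b.
Qed.

(** The built-in loop always runs up to [L]; rounds in which [t] is not below [x] change only [t].
    Hence the rule below asks that the final invariant survive a change of [t]. *)
Definition For t x c := Loop t (IfLt t x c (Skip R)).

Lemma for_rule (I : nat -> mem R -> Prop) t x c s : t != x -> ~~ written c x ->
  bounded w s -> I 0 s ->
  (forall i s', i < reg s x -> bounded w s' -> I i s' -> I i.+1 (den c (setr s' t i))) ->
  (forall s' i, I (reg s x) s' -> I (reg s x) (setr s' t i)) -> I (reg s x) (den (For t x c) s).
Proof.
move=> tx wx bs I0 IS Iset.
have := @loop_rule (fun i s' => [/\ bounded w s', I (minn i (reg s x)) s' & reg s' x = reg s x])
  t (IfLt t x c (Skip R)) s.
rewrite min0n => /(_ (And3 bs I0 erefl)); case=> [i s' iL [bs' Is' xs']|_ + _]; last first.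
  by move: bs => [/(_ x) xL _]; have -> : minn L.+1 (reg s x) = reg s x by lia.
have xs2 : reg (setr s' t i) x = reg s x by rewrite /= eq_sym (negPf tx).
have bs2 : bounded w (setr s' t i) by apply: bounded_setr.
split; first exact: (@den_bounded (IfLt t x c (Skip R))).
  change (I (minn i.+1 (reg s x)) (if reg (setr s' t i) t < reg (setr s' t i) x then den c (setr s' t i) else setr s' t i)).
  rewrite xs2 [reg _ t]/= eqxx; case: ltnP => ix.
    have -> : minn i.+1 (reg s x) = i.+1 by lia.
    by apply: IS => //; move: Is'; have -> : minn i (reg s x) = i by lia.
  have -> : minn i.+1 (reg s x) = reg s x by lia.
  by apply: Iset; move: Is'; have -> : minn i (reg s x) = reg s x by lia.
change (reg (if reg (setr s' t i) t < reg (setr s' t i) x then den c (setr s' t i) else setr s' t i) x = reg s x).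
by case: ifP => _; rewrite ?den_unwritten.
Qed.

Definition nest (rs : seq R) c := foldr (fun x c => Loop x c) c rs.

Lemma written_nest rs c x : written (nest rs c) x = (x \in rs) || written c x.
Proof. by elim: rs => //= y rs ->; rewrite inE orbA. Qed.

Lemma wf_nest rs c : uniq rs -> (forall x, x \in rs -> ~~ written c x) -> wf c -> wf (nest rs c).
Proof.
elim: rs => //= x rs IH /andP[xrs urs] h wc; rewrite written_nest negb_or xrs h ?mem_head //=.
by apply: IH => // y yrs; apply: h; rewrite inE yrs orbT.
Qed.

Lemma nest_inv (I : mem R -> Prop) rs c s : I s ->
  (forall s x i, x \in rs -> i <= L -> I s -> I (setr s x i)) ->
  (forall s, I s -> I (den c s)) -> I (den (nest rs c) s).
Proof.
move=> Is h Ic; elim: rs s Is h => [|x rs IH] s Is h; first exact: Ic.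
apply: loop_inv => // i s' iL Is'; apply: IH; first by apply: h => //; exact: mem_head.
by move=> s2 y j yrs; apply: h; rewrite inE yrs orbT.
Qed.

(** [Q] is established when the loop variables take the values [v], and persists. *)
Lemma nest_visit (P Q : mem R -> Prop) (v : R -> nat) rs c s : uniq rs ->
  (forall x, x \in rs -> ~~ written c x /\ v x <= L) ->
  (forall s x i, x \in rs -> i <= L -> P s -> P (setr s x i)) ->
  (forall s, P s -> P (den c s)) ->
  (forall s x i, x \in rs -> i <= L -> P s -> Q s -> Q (setr s x i)) ->
  (forall s, P s -> Q s -> Q (den c s)) ->
  (forall s, P s -> (forall x, x \in rs -> reg s x = v x) -> Q (den c s)) ->
  P s -> Q (den (nest rs c) s).
Proof.
elim: rs s P => [|x rs IH] s P urs hv Pset Pc Qset Qc PQ Ps; first exact: PQ.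
have Pset' s' y i : y \in rs -> i <= L -> P s' -> P (setr s' y i).
  by move=> yrs; apply: Pset; rewrite inE yrs orbT.
have Qset' s' y i : y \in rs -> i <= L -> P s' -> Q s' -> Q (setr s' y i).
  by move=> yrs; apply: Qset; rewrite inE yrs orbT.
have Pn s' : P s' -> P (den (nest rs c) s') by move=> Ps'; apply: nest_inv.
have /andP[xrs urs'] := urs.
have hv' y : y \in rs -> ~~ written c y /\ v y <= L.
  by move=> yrs; apply: hv; rewrite inE yrs orbT.
have [wx vx] := hv _ (mem_head _ _).
suff : P (den (Loop x (nest rs c)) s) /\ (v x < L.+1 -> Q (den (Loop x (nest rs c)) s)).
  by case=> _; apply.
apply: (@loop_rule (fun i s => P s /\ (v x < i -> Q s))) => // i s' iL [Ps' Qs'].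
have Ps2 : P (setr s' x i) by apply: Pset => //; exact: mem_head.
split; first exact: Pn.
rewrite ltnS leq_eqVlt => /orP[/eqP vi|vi]; last first.
  have : P (den (nest rs c) (setr s' x i)) /\ Q (den (nest rs c) (setr s' x i)); last by case.
  apply: (@nest_inv (fun s => P s /\ Q s)).
  - by split=> //; apply: Qset; rewrite ?mem_head //; exact: Qs'.
  - by move=> s2 y j yrs jL [P2 Q2]; split; [apply: Pset'|apply: Qset'].
  - by move=> s2 [P2 Q2]; split; auto.
apply: (IH _ (fun s => P s /\ reg s x = v x)) => //.
- move=> s2 y j yrs jL [P2 <-]; split; first exact: Pset'.
  by rewrite /=; case: eqP => // xy; rewrite xy yrs in xrs.
- by move=> s2 [P2 <-]; split; [exact: Pc|rewrite den_unwritten].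
- by move=> s2 y j yrs jL [P2 _]; apply: Qset'.
- by move=> s2 [P2 _]; apply: Qc.
- move=> s2 [P2 s2x] h; apply: PQ => // y; rewrite inE => /orP[/eqP->//|]; exact: h.
- by rewrite /= eqxx.
Qed.

(** For uses in which only the number of runs of the body matters: clearing the array and repeating
    passes. *)
Lemma nest_count (I : nat -> mem R -> Prop) rs c t s :
  (forall t s x i, x \in rs -> i <= L -> I t s -> I t (setr s x i)) ->
  (forall t s, I t s -> I t.+1 (den c s)) -> I t s ->
  I (t + L.+1 ^ size rs) (den (nest rs c) s).
Proof.
move=> h Ic; elim: rs t s h => [|x rs IH] t s h It; first by rewrite expn0 addn1; exact: Ic.
rewrite expnS; apply: (@loop_rule (fun i s => I (t + i * L.+1 ^ size rs) s)).
  by rewrite addn0.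
move=> i s' iL Is'; have -> : t + i.+1 * L.+1 ^ size rs = t + i * L.+1 ^ size rs + L.+1 ^ size rs by lia.
apply: IH; first by move=> t' s2 y j yrs; apply: h; rewrite inE yrs orbT.
by apply: h => //; exact: mem_head.
Qed.

Definition seqs (cs : seq (cmd R)) := foldr (@Cat R) (Skip R) cs.

Lemma written_seqs cs x : written (seqs cs) x = has (fun c => written c x) cs.
Proof. by elim: cs => //= c cs ->. Qed.

Lemma wf_seqs cs : wf (seqs cs) = all (@wf R) cs.
Proof. by elim: cs => //= c cs ->. Qed.

Lemma keeps_arr_seqs cs : keeps_arr (seqs cs) = all keeps_arr cs.
Proof. by elim: cs => //= c cs ->. Qed.

Lemma seqs_rule (J : eqType) (P : seq J -> mem R -> Prop) (f : J -> cmd R) js s : uniq js ->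
  P [::] s -> (forall d j s, j \notin d -> P d s -> P (rcons d j) (den (f j) s)) ->
  P js (den (seqs [seq f j | j <- js]) s).
Proof.
move=> ujs P0 Pf.
suff H d : uniq (d ++ js) -> P d s -> P (d ++ js) (den (seqs [seq f j | j <- js]) s) by exact: (H [::]).
elim: js d s {P0 ujs} => [|j js IH] d s /=; first by rewrite cats0.
move=> ud Pd; rewrite -cat_rcons; apply: IH; first by rewrite cat_rcons.
by apply: Pf => //; move: ud; rewrite -cat_rcons cat_uniq rcons_uniq => /andP[/andP[]].
Qed.

(** * Moving heads, addressing the array, reading numbers *)

Definition goto t x := Cat (InRew R) (For t x (InR R)).

Lemma goto_pin t x s : t != x -> bounded w s -> pin (den (goto t x) s) = reg s x.
Proof.
move=> tx bs; change (pin (den (For t x (InR R)) (setpin s 0)) = reg s x).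
have bs0 : bounded w (setpin s 0) by case: bs.
apply: (@for_rule (fun i s' => pin s' = i) t x (InR R) (setpin s 0)) => //.
by move=> i s' ix [_ _] /= ->; rewrite ifT //; case: bs => /(_ x) xL _; apply: leq_trans ix xL.
Qed.

Definition copy t x y := Cat (Zero y) (For t x (Inc y)).

Lemma copy_reg t x y s : uniq [:: t; x; y] -> bounded w s ->
  reg (den (copy t x y) s) y = reg s x.
Proof.
rewrite /= !inE negb_or => /and3P[/andP[tx ty] xy _] bs.
have bs0 : bounded w (setr s y 0) by apply: bounded_setr.
have xs : reg (setr s y 0) x = reg s x by rewrite /= (negPf xy).
have [xL _] := bs; have := @for_rule (fun i s' => reg s' y = i) t x (Inc y) (setr s y 0) tx.
rewrite xs; apply=> //.
- by rewrite /= eqxx.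
- move=> i s' ix _ s'y; rewrite /= eqxx !(eq_sym y) (negPf ty) s'y ifT //.
  exact: leq_trans ix (xL x).
- by move=> s' i; rewrite /= eq_sym (negPf ty).
Qed.

(** A numeral of value [v] occupies one letter more than [v], so this moves a cursor past it. *)
Definition add_succ t v x := Cat (For t v (Inc x)) (Inc x).

Lemma add_succ_reg t v x s : uniq [:: t; v; x] -> bounded w s -> reg s x + reg s v < L ->
  reg (den (add_succ t v x) s) x = (reg s x + reg s v).+1.
Proof.
rewrite /= !inE negb_or => /and3P[/andP[tv tx] vx _] bs xvL.
have h : reg (den (For t v (Inc x)) s) x = reg s x + reg s v.
  apply: (@for_rule (fun i s' => reg s' x = reg s x + i)) => //.
  - by rewrite addn0.
  - move=> i s' iv _ s'x; rewrite /= eqxx !(eq_sym x) (negPf tx) s'x ifT ?addnS //; lia.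
  - by move=> s' i; rewrite /= eq_sym (negPf tx).
change (reg (den (Inc x) (den (For t v (Inc x)) s)) x = (reg s x + reg s v).+1).
by move: h; move: (den _ _) => s' h; rewrite /= eqxx h xvL.
Qed.

(** Runs [c] as often as the number with digits [rs], least significant first, in
    base [L.+1]; the loops over [us] multiply by the base. *)
Fixpoint walk t (rs us : seq R) c :=
  match rs, us with
  | r :: rs, u :: us => Cat (For t r c) (walk t rs us (Loop u c))
  | _, _ => Skip R
  end.

(** Registers never exceed [L], so their values are digits in base [L.+1]. *)
Definition code := foldr (fun v a => v + L.+1 * a) 0.

Lemma code_inj l1 l2 : size l1 = size l2 -> all (fun v => v <= L) l1 -> all (fun v => v <= L) l2 ->
  code l1 = code l2 -> l1 = l2.
Proof.
elim: l1 l2 => [|v1 l1 IH] [|v2 l2] //= [sz] /andP[v1L l1L] /andP[v2L l2L] cE.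
have v12 : v1 = v2.
  have := congr1 (modn^~ L.+1) cE.
  by rewrite ![_ + L.+1 * _]addnC ![L.+1 * _]mulnC !modnMDl !modn_small.
rewrite v12 in cE *; congr cons; apply: IH => //; move/addnI: cE => /eqP.
by rewrite eqn_mul2l /= => /eqP.
Qed.

Lemma code_lt l : all (fun v => v <= L) l -> code l < L.+1 ^ size l.
Proof.
elim: l => //= v l IH /andP[vL /IH]; rewrite expnS.
move: (code l) (_ ^ _) => a b ab; apply: (@leq_trans (L.+1 * a.+1)); first by rewrite mulnS; lia.
by rewrite leq_mul2l.
Qed.

Lemma written_walk t rs us c x :
  written (walk t rs us c) x -> [|| x == t, x \in us | written c x].
Proof.
elim: rs us c => [|r rs IH] [|u us] c //= /orP[|/IH] /=.
  by rewrite orbF => /orP[->//|->]; rewrite !orbT.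
by rewrite inE => /or3P[->|->|/orP[->|->]]; rewrite ?orbT.
Qed.

Lemma keeps_arr_walk t rs us c : keeps_arr c -> keeps_arr (walk t rs us c).
Proof. by elim: rs us c => [|r rs IH] [|u us] c //= kc; rewrite IH ?kc. Qed.

Lemma wf_walk t rs us c : uniq us -> t \notin us -> ~~ written c t ->
  (forall u, u \in us -> ~~ written c u) -> wf c -> wf (walk t rs us c).
Proof.
elim: rs us c => [|r rs IH] [|u us] c //= /andP[uus uus'] tu wt wu wc.
have [wcu tu'] : ~~ written c u /\ (t != u) && (t \notin us).
  by rewrite wu ?mem_head //; move: tu; rewrite inE negb_or.
case/andP: tu' => tu1 tu2; rewrite orbF wt wc /= IH //=.
- by rewrite negb_or tu1.
- move=> u' u'us; rewrite negb_or wu ?inE ?u'us ?orbT // andbT.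
  by apply: contraNneq uus => <-.
- by rewrite wcu.
Qed.

(** A general displacement [m] of the body lets the induction pass to [Loop u c], which displaces
    the array head by [m * L.+1]. *)
Lemma walk_par t rs us c m s : size rs <= size us ->
  (forall r, r \in rs -> r != t /\ ~~ written c r) -> (forall r, r \in rs -> r \notin us) ->
  (forall s', par (den c s') = par s' + m) -> bounded w s ->
  par (den (walk t rs us c) s) = par s + m * code (map (reg s) rs).
Proof.
elim: rs us c m s => [|r rs IH] [|u us] c m s //= sz hw hu hc bs; first by lia.
  by lia.
have [rt wr] := hw r (mem_head _ _).
have par1 : par (den (For t r c) s) = par s + m * reg s r.
  apply: (@for_rule (fun i s' => par s' = par s + m * i)) => //; first by rewrite eq_sym.
    by rewrite muln0 addn0.
  by move=> i s' _ _ s'p; rewrite hc /= s'p mulnS; lia.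
have := IH us (Loop u c) (m * L.+1) (den (For t r c) s).
move=> walkE; change (par (den (walk t rs us (Loop u c)) (den (For t r c) s)) =
  par s + m * (reg s r + L.+1 * code (map (reg s) rs))).
rewrite walkE; first last.
- exact: den_bounded.
- move=> s'; apply: (@loop_rule (fun i s2 => par s2 = par s' + m * i)) => //; first by rewrite muln0 addn0.
  by move=> i s2 _ s2p; rewrite hc /= s2p mulnS; lia.
- by move=> r' r'rs; have := hu r'; rewrite !inE r'rs orbT negb_or => /(_ isT) /andP[].
- move=> r' r'rs; have [] := hw r'; first by rewrite inE r'rs orbT.
  move=> r't wr'; split=> //=; rewrite negb_or wr' andbT.
  by have := hu r'; rewrite !inE r'rs orbT negb_or => /(_ isT) /andP[].
- exact: sz.
rewrite par1 -addnA -mulnA -mulnDr; congr (_ + _ * (_ + _ * code _)).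
apply/eq_in_map => r' r'rs; apply: den_unwritten => /=.
have [] := hw r'; first by rewrite inE r'rs orbT.
by move=> r't wr'; rewrite negb_or r't /= orbF.
Qed.

(** The loop has [L.+1] rounds whatever the number is; [e] becomes nonzero at the end of the
    numeral, and the later rounds do nothing. *)
Definition num t e x v := Cat (goto t x) (Cat (Zero v) (Cat (Zero e)
  (Loop t (IfZ e (IfIn Tally (Cat (Inc v) (InR R)) (Inc e)) (Skip R))))).

Lemma inp_drop i : inp w i = ohead (drop i w).
Proof.
rewrite /inp; elim: w i => [|g u IH] [|i] //=.
Qed.

Lemma num_reg t e x v m u s : 0 < L -> uniq [:: t; e; v] -> t != x -> bounded w s ->
  drop (reg s x) w = nseq m Tally ++ EndNum :: u -> reg (den (num t e x v) s) v = m.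
Proof.
move=> L_gt0; rewrite /= !inE negb_or => /and3P[/andP[te tv] ev _] tx bs wE.
have ve : v != e by rewrite eq_sym.
set s1 := den (goto t x) s; have pin1 : pin s1 = reg s x by exact: goto_pin.
have mL : reg s x + m < L by have := congr1 size wE; rewrite size_drop size_cat size_nseq /=; lia.
have inpE i : i <= m -> inp w (reg s x + i) = Some (if i == m then EndNum else Tally).
  move=> im; rewrite inp_drop addnC -drop_drop wE drop_cat size_nseq drop_nseq.
  case: ltngtP im => // [im|->] _; last by rewrite subnn.
  by rewrite -(subnSK im).
have := @loop_rule (fun i s' => [/\ reg s' v = minn i m, pin s' = reg s x + minn i m &
  reg s' e = 0 /\ i <= m \/ 0 < reg s' e /\ m < i]) t
  (IfZ e (IfIn Tally (Cat (Inc v) (InR R)) (Inc e)) (Skip R)) (setr (setr s1 v 0) e 0).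
case.
- rewrite min0n addn0 /=; split=> //; first by rewrite (eq_sym v) (negPf ev) eqxx.
  by left; rewrite eqxx.
- move=> i s' iL [s'v s'p s'e]; set s2 := setr s' t i.
  have s2e : reg s2 e = reg s' e by rewrite /= eq_sym (negPf te).
  have s2v : reg s2 v = reg s' v by rewrite /= eq_sym (negPf tv).
  have s2p : pin s2 = pin s' by [].
  rewrite den_ifz s2e; case: s'e => [[e0 im]|[e0 im]]; last first.
    by rewrite -[_ == 0]negbK -lt0n e0; split; rewrite ?s2v ?s2p ?s2e; try lia; right; lia.
  have im' : minn i m = i by lia.
  rewrite e0 eqxx den_ifin s2p s'p im' inpE //; case: (i =P m) => [iE|iE].
    rewrite [_ == _]/= den_inc s2e e0 L_gt0 reg_setr pin_setr (reg_setr_neq _ _ ve).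
    by split; [rewrite s2v; lia|rewrite s2p; lia|right; lia].
  rewrite eqxx den_cat den_inc s2v s'v im' ifT; last by lia.
  rewrite den_inr pin_setr s2p s'p im' ifT; last by lia.
  rewrite /setpin [reg _ v]reg_setr [reg _ e](reg_setr_neq _ _ ev).
  by split; [lia|rewrite /=; lia|left; rewrite s2e; lia].
move=> vE _ _; apply: etrans vE _; lia.
Qed.

End Rules.

(** * The rows of an encoded algebra *)

Definition isnum (g : symbol) := (g == Tally) || (g == EndNum).

Notation block := (seq symbol * symbol)%type.

(** The word of an algebra consists of a header and of blocks ending in a
    separator: one block per row, and an empty one at the end of each table. *)
Definition flat (bs : seq block) := flatten [seq rcons b.1 b.2 | b <- bs].
Definition isblock (b : block) := all isnum b.1 && ~~ isnum b.2.
Definition ntables (bs : seq block) := count (fun b : block => b.2 == EndTable) bs.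

Lemma flat_cat bs1 bs2 : flat (bs1 ++ bs2) = flat bs1 ++ flat bs2.
Proof. by rewrite /flat map_cat flatten_cat. Qed.

Lemma count_EndTable_flat bs : all isblock bs -> count_mem EndTable (flat bs) = ntables bs.
Proof.
elim: bs => //= b bs IH /andP[/andP[nb _] /IH]; rewrite /flat /= count_cat => ->.
rewrite -cats1 count_cat /= addn0 (eq_in_count (a2 := pred0)) ?count_pred0 //.
by move=> g /(allP nb); case: g.
Qed.

(** Separators occur only at ends of blocks, so a number letter right after one begins a nonempty
    block; the [EndRow] put in front lets position 0 count. *)
Lemma block_start bs p : all isblock bs ->
  ~~ isnum (nth EndRow (EndRow :: flat bs) p) -> isnum (nth EndRow (flat bs) p) ->
  exists b1 b b2, [/\ bs = b1 ++ b :: b2, p = size (flat b1) & b.1 != [::]].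
Proof.
elim: bs p => [|b bs IH] p /=; first by rewrite nth_nil.
move=> /andP[/andP[nb sb] wbs]; rewrite -/(flat bs) /flat /= -/(flat bs).
case: p => [_|p].
  rewrite nth_cat size_rcons ltn0Sn => nb0.
  exists [::], b, bs; split=> //; case: b.1 nb0 => //=.
  by rewrite (negPf sb).
rewrite [nth _ (_ :: _) _]/= !nth_cat !size_rcons.
case: (ltngtP p (size b.1)) => pb.
- by rewrite (leqW pb) nth_rcons pb (allP nb) ?mem_nth.
- have -> : (p < (size b.1).+1) = false by lia.
  have -> : (p.+1 < (size b.1).+1) = false by lia.
  move=> h1 h2.
  have [|b1 [b' [b2 [bsE pE b'n]]]] := IH (p.+1 - (size b.1).+1) wbs _ h2.
    by rewrite subSS; have -> : p - size b.1 = (p - (size b.1).+1).+1 by lia.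
  exists (b :: b1), b', b2; split=> //; first by rewrite bsE.
  by rewrite /flat /= size_cat size_rcons -/(flat b1) -pE; lia.
- rewrite -pb ltnSn ltnn subnn nth_rcons -pb ltnn eqxx => _ h2.
  have [|b1 [b' [b2 [bsE pE b'n]]]] := IH 0 wbs _ h2; first by [].
  exists (b :: b1), b', b2; split=> //; first by rewrite bsE.
  by rewrite /flat /= size_cat size_rcons -/(flat b1) -pE pb addn0.
Qed.

Definition table_blocks (ts : seq (seq block)) := flatten [seq rcons t ([::], EndTable) | t <- ts].

(** Only the empty closing blocks carry [EndTable], so counting them before a nonempty block gives
    the index of its table. *)
Lemma table_blocks_split ts b1 b b2 : all (all (fun b : block => b.2 != EndTable)) ts ->
  table_blocks ts = b1 ++ b :: b2 -> b.1 != [::] ->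
  ntables b1 < size ts /\ b \in nth [::] ts (ntables b1).
Proof.
elim: ts b1 => [|t ts IH] b1 /=; first by case: b1.
move=> /andP[ht hts]; rewrite /table_blocks /= -/(table_blocks ts) => E bn.
have n0 u : all (fun b : block => b.2 != EndTable) u -> ntables u = 0.
  by move=> hu; apply/eqP; rewrite -leqn0 leqNgt -has_count -all_predC.
case: (ltngtP (size b1) (size t)) => bt.
- have tE : t = b1 ++ b :: take (size t - (size b1).+1) b2.
    have := congr1 (take (size t)) E; rewrite -cats1 -catA take_size_cat // take_cat ltnNge ltnW //=.
    by rewrite -(subnSK bt) /=.
  have : ntables b1 = 0 by apply: n0; move: ht; rewrite tE all_cat => /andP[].
  by move=> ->; rewrite /= tE mem_cat mem_head orbT.
- move: E; rewrite -{1}(cat_take_drop (size t).+1 b1) -catA => /eqP.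
  rewrite eqseq_cat ?size_takel ?size_rcons // => /andP[/eqP aE /eqP E'].
  have [nlt bin] := IH _ hts E' bn.
  by rewrite -(cat_take_drop (size t).+1 b1) -aE /ntables count_cat -cats1 count_cat -!/(ntables _) n0.
- have := congr1 (nth ([::], EndTable) ^~ (size t)) E.
  rewrite nth_cat size_rcons ltnSn nth_rcons ltnn eqxx nth_cat bt ltnn subnn /= => bE.
  by rewrite -bE in bn.
Qed.

Lemma table_blocks_ex ts b f : all (all (fun b : block => b.2 != EndTable)) ts ->
  f < size ts -> b \in nth [::] ts f ->
  exists b1 b2, table_blocks ts = b1 ++ b :: b2 /\ ntables b1 = f.
Proof.
have n0 u : all (fun b : block => b.2 != EndTable) u -> ntables u = 0.
  by move=> hu; apply/eqP; rewrite -leqn0 leqNgt -has_count -all_predC.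
elim: ts f => [|t ts IH] [|f] //= /andP[ht hts]; rewrite /table_blocks /= -/(table_blocks ts).
  move=> _ bt; case/path.splitPr: bt ht => t1 t2; rewrite all_cat => /andP[ht1 _].
  by exists t1, (rcons t2 ([::], EndTable) ++ table_blocks ts); rewrite rcons_cat -catA n0.
move=> fts bf; have [b1 [b2 [E nf]]] := IH f hts fts bf.
exists (rcons t ([::], EndTable) ++ b1), b2; rewrite E catA; split=> //.
by rewrite /ntables count_cat -cats1 count_cat -!/(ntables _) n0 // nf.
Qed.

Section Rows.

Variable A : algebra.
Notation w := (encode_alg A).
Notation n := #|carrier A|.

(** The first row follows the header, which ends in a letter of a numeral, hence the separate case
    [n.+1]. The condition at [p] itself excludes the closing of a table. The defaults make position
    0 and the positions behind the word fail. *)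
Definition rowstart (n : nat) (w : seq symbol) p :=
  ((p == n.+1) || ~~ isnum (nth EndNum (EndNum :: w) p)) && isnum (nth EndRow w p).

Definition tabidx (w : seq symbol) p := count_mem EndTable (take p w).

Definition row_nums (f : 'I_(nops A)) (x : (arity f).-tuple (carrier A)) :=
  [seq (enum_rank y : nat) | y <- rcons x (op x)].

Definition encode_nums (ns : seq nat) := flatten (map encode_nat ns).

Definition row_at p (f : 'I_(nops A)) (x : (arity f).-tuple (carrier A)) :=
  exists u, drop p w = encode_nums (row_nums x) ++ EndRow :: u.

Definition row_block (f : 'I_(nops A)) (x : (arity f).-tuple (carrier A)) : block := (encode_nums (row_nums x), EndRow).
Definition alg_tables := [seq [seq row_block x | x <- enum {: (arity f).-tuple (carrier A)}] | f <- enum 'I_(nops A)].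

Lemma encode_alg_blocks : w = encode_nat n ++ flat (table_blocks alg_tables).
Proof.
congr (_ ++ _); rewrite /alg_tables; elim: (enum 'I_(nops A)) => //= f fs ->.
rewrite /table_blocks /= flat_cat -/(table_blocks _); congr (_ ++ _).
rewrite /encode_table -!cats1 flat_cat; congr (_ ++ _).
rewrite /flat -map_comp; congr flatten; apply: eq_map => x /=.
by rewrite /encode_row /encode_nums /row_nums -map_comp.
Qed.

Lemma isnum_encode_nat m : all isnum (encode_nat m).
Proof. by rewrite /encode_nat all_rcons all_nseq orbT. Qed.

Lemma isnum_encode_nums ns : all isnum (encode_nums ns).
Proof. by elim: ns => //= m ns IH; rewrite /encode_nums /= all_cat isnum_encode_nat. Qed.

Lemma alg_tables_row : all (all (fun b : block => b.2 != EndTable)) alg_tables.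
Proof. by apply/allP => t /mapP[f _ ->]; apply/allP => b /mapP[x _ ->]. Qed.

Lemma isblock_alg : all isblock (table_blocks alg_tables).
Proof.
apply/allP => b /flattenP[t /mapP[t' /mapP[f _ ->] ->]].
rewrite mem_rcons inE => /orP[/eqP-> //|/mapP[x _ ->]].
by rewrite /isblock /= isnum_encode_nums.
Qed.

Lemma size_encode_nat m : size (encode_nat m) = m.+1.
Proof. by rewrite size_rcons size_nseq. Qed.

Lemma mem_alg_tables b i : i < size alg_tables -> b \in nth [::] alg_tables i ->
  exists (f : 'I_(nops A)) (x : (arity f).-tuple (carrier A)), i = f :> nat /\ b = row_block x.
Proof.
rewrite size_map size_enum_ord => ilt; rewrite (nth_map (Ordinal ilt)) ?size_enum_ord //.
by move=> /mapP[x _ ->]; exists (nth (Ordinal ilt) (enum 'I_(nops A)) i), x; rewrite nth_enum_ord.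
Qed.

Lemma block_row b1 b2 (f : 'I_(nops A)) (x : (arity f).-tuple (carrier A)) : table_blocks alg_tables = b1 ++ row_block x :: b2 ->
  let p := n.+1 + size (flat b1) in
  [/\ p <= size w, row_at p x & tabidx w p = ntables b1].
Proof.
move=> E; have wE := encode_alg_blocks.
have := isblock_alg; rewrite E all_cat => /andP[ib1 _].
rewrite E flat_cat in wE; split.
- by rewrite wE !size_cat size_encode_nat; lia.
- exists (flat b2); rewrite wE addnC -drop_drop drop_size_cat ?size_encode_nat //.
  by rewrite drop_size_cat // /flat /= cat_rcons.
- rewrite /tabidx wE catA take_size_cat; last by rewrite size_cat size_encode_nat.
  rewrite count_cat count_EndTable_flat // (eq_in_count (a2 := pred0)) ?count_pred0 //.
  by move=> g /(allP (isnum_encode_nat _)); case: g.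
Qed.

Lemma rowstart_row p : rowstart n w p ->
  exists (f : 'I_(nops A)) (x : (arity f).-tuple (carrier A)), row_at p x /\ tabidx w p = f.
Proof.
rewrite /rowstart => /andP[h1 h2]; have wE := encode_alg_blocks; set bs := table_blocks _ in wE.
(* The header consists of number letters only, so no position inside it passes the test. *)
have pn : n < p.
  rewrite ltnNge; apply/negP => pn; move: h1; rewrite ltn_eqF //= => /negP; apply.
  case: p pn {h2} => // p pn; have pn' : p < size (encode_nat n) by rewrite size_encode_nat ltnW.
  by rewrite /= wE nth_cat pn' (allP (isnum_encode_nat n)) // mem_nth.
have [||b1 [b [b2 [bsE pE bn]]]] := @block_start bs (p - n.+1) isblock_alg.
- case: (p =P n.+1) h1 => [->|/eqP pn1] /=; first by rewrite subnn.
  case: p pn pn1 {h2} => // p pn pn1; have np : n < p by lia.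
  rewrite /= wE nth_cat size_encode_nat ltnNge np /=.
  move=> h; rewrite subSS -(subnSK np) /=.
  move: h; case: (ltnP (p - n.+1) (size (flat bs))) => h; last by rewrite !nth_default.
  by rewrite (set_nth_default EndRow).
- by move: h2; rewrite wE nth_cat size_encode_nat ltnNge pn.
have [nlt bin] := table_blocks_split alg_tables_row bsE bn.
have [f [x [nE bE]]] := mem_alg_tables nlt bin.
rewrite bE in bsE; have [_ r t] := block_row bsE.
have pE' : n.+1 + size (flat b1) = p by rewrite -pE; lia.
by exists f, x; rewrite -pE' t nE.
Qed.

Lemma row_rowstart (f : 'I_(nops A)) (x : (arity f).-tuple (carrier A)) : exists p, [/\ p <= size w, rowstart n w p, row_at p x & tabidx w p = f].
Proof.
have [||b1 [b2 [E nE]]] := @table_blocks_ex alg_tables (row_block x) f alg_tables_row.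
- by rewrite size_map size_enum_ord.
- rewrite (nth_map f) ?size_enum_ord // nth_ord_enum; apply: map_f; exact: mem_enum.
have [pw r t] := block_row E; exists (n.+1 + size (flat b1)); split=> //; last by rewrite t.
have wE := encode_alg_blocks; apply/andP; split.
  case: (lastP b1) E {pw r t nE} => [|b1' b] E; first by rewrite addn0 eqxx.
  have := isblock_alg; rewrite E all_cat all_rcons => /andP[/andP[/andP[_ sb] _] _].
  apply/orP; right.
  have -> : EndNum :: w = (EndNum :: encode_nat n ++ flat b1' ++ b.1) ++ b.2 :: flat (row_block x :: b2).
    by rewrite wE E flat_cat -cats1 flat_cat {2}/flat /= cats0 -cats1 -!catA.
  have -> : n.+1 + size (flat (rcons b1' b)) = size (EndNum :: encode_nat n ++ flat b1' ++ b.1).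
    rewrite -cats1 flat_cat {2}/flat /= cats0 !size_cat size_encode_nat size_rcons; lia.
  by rewrite nth_cat ltnn subnn.
case: r => u; move/(congr1 (nth EndRow ^~ 0)); rewrite nth_drop addn0 => ->.
have [m [ns ->]] : exists m ns, row_nums x = m :: ns.
  case rE: (row_nums x) => [|m ns]; last by exists m, ns.
  by have := congr1 size rE; rewrite size_map size_rcons.
by rewrite /encode_nums /= /encode_nat; case: m.
Qed.

End Rows.

(** * The decision procedure *)

(** A name and a coordinate; scalar registers use coordinate 0. The number 32 merely exceeds all
    names in use. *)
Definition register (m : nat) : finType := ('I_32 * 'I_m.+1)%type.

Section Commands.

Variable m : nat.
Notation R := (register m).

Notation fm a i := ((@Ordinal 32 a isT, i) : R).
Notation sc a := (fm a ord0).
(** [nn] and [hd] hold the number of elements and the length of the header; [fl]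
    counts the tuples [rc] for which no constant was found; [rp i] is the start of
    the row applied in the [i]-th coordinate, [cur i] a cursor in it, [rv i] the
    number read last and [tb i] the index of its table; [bad] is nonzero when the
    rows do not belong to one table or an argument tuple is not in the array. *)
Notation t0 := (sc 0).
Notation e := (sc 1).
Notation nn := (sc 2).
Notation hd := (sc 3).
Notation fl := (sc 4).
Notation bad := (sc 5).
Notation dn := (sc 6).
Notation t2 := (sc 7).
Notation fnd := (sc 8).
Notation aa := (sc 9).
Notation zz := (sc 10).
Notation st := (sc 11).
Notation gd := (sc 12).
Notation rc i := (fm 16 i).
Notation rp i := (fm 17 i).
Notation rv i := (fm 18 i).
Notation cur i := (fm 19 i).
Notation tb i := (fm 23 i).
Notation fam a := [seq (fm a i) | i <- enum 'I_m.+1].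

Definition each (f : 'I_m.+1 -> cmd R) := seqs [seq f i | i <- enum 'I_m.+1].

Definition ifeq (x y : R) c1 c2 := IfLt x y c2 (IfLt y x c2 c1).

(** [st] is zero exactly after a separator; its initial value 1 corresponds to the [EndNum] that
    [rowstart] puts in front of the word. *)
Definition check_row i : cmd R :=
  Cat (InRew R) (Cat (Zero (tb i)) (Cat (Zero st) (Cat (Inc st) (Cat
    (For t0 (rp i) (Cat (Zero st) (Cat (IfIn EndTable (Inc (tb i)) (IfIn EndRow (Skip R) (Inc st))) (InR R))))
    (Cat (IfZ st (Skip R) (ifeq (rp i) hd (Skip R) (Inc bad)))
         (IfIn Tally (Skip R) (IfIn EndNum (Skip R) (Inc bad)))))))).

Definition check_table i : cmd R := ifeq (tb i) (tb ord0) (Skip R) (Inc bad).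

Definition check_rows := Cat (Zero bad) (Cat (each check_row) (each check_table)).

Definition read i : cmd R := Cat (num t0 e (cur i) (rv i)) (add_succ t0 (rv i) (cur i)).

Definition addr (rs : seq R) : cmd R := Cat (ArRew R) (walk t0 rs (fam 20) (ArR R)).

(** One number is read from each row. They form an argument tuple, to be looked up in the array,
    unless [EndRow] follows: then they form the tuple of values, whose bit is to be set. One cursor
    decides this, as rows of one table have equally many entries. *)
Definition scan_column :=
  Cat (each read) (Cat (addr (fam 18)) (Cat (goto t0 (cur ord0))
   (IfIn EndRow (Cat (IfZ bad (ArSet R true) (Skip R)) (Inc dn)) (IfAr (Skip R) (Inc bad))))).

(** A row has fewer entries than the word has letters, so the loop reaches its end; [dn] idles the
    remaining rounds. *)
Definition apply_op := Cat check_rows (Cat (each (fun i => copy t0 (rp i) (cur i))) (Cat (Zero dn)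
  (Loop t2 (IfZ dn scan_column (Skip R))))).

Definition clear_array : cmd R := Cat (ArRew R) (nest (fam 20) (Cat (ArSet R false) (ArR R))).

Definition add_perms : cmd R := seqs [seq Cat (addr [seq rc (s i) | i <- enum 'I_m.+1]) (ArSet R true) | s : {perm 'I_m.+1}].

Definition find_const := Cat (Zero fnd) (Loop aa (IfLt aa nn
   (Cat (addr [seq aa | i <- enum 'I_m.+1]) (IfAr (Inc fnd) (Skip R))) (Skip R))).

(** The variables of [fam 21] are read nowhere: their loops only repeat a pass over all tuples of
    positions [L.+1 ^ m.+1] times. *)
Definition test_tuple := Cat clear_array (Cat add_perms (Cat (nest (fam 21) (nest (fam 17) apply_op))
  (Cat find_const (IfZ fnd (Inc fl) (Skip R))))).

(** The loop variables [rc i] run up to the length of the word, but only values below [nn] denote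
    elements. *)
Definition guarded := Cat (Zero gd) (Cat (each (fun i => IfLt (rc i) nn (Skip R) (Inc gd)))
  (IfZ gd test_tuple (Skip R))).

Definition qWNU_program := Cat (Zero zz) (Cat (num t0 e zz nn) (Cat (copy t0 nn hd) (Cat (Inc hd)
  (Cat (Zero fl) (nest (fam 16) guarded))))).

Variable w : seq symbol.
Notation L := (size w).
Hypothesis L_gt0 : 0 < L.
Notation den := (denote w).

Lemma den_ifeq x y c1 c2 s : den (ifeq x y c1 c2) s = if reg s x == reg s y then den c1 s else den c2 s.
Proof. by rewrite /ifeq !den_iflt; case: ltngtP. Qed.

(** Counters such as [bad] and [fl] saturate but are only compared with 0, so an increment may be
    read as raising a flag. *)
Lemma reg_inc_eq0 (s : mem R) x : (reg (den (Inc x) s) x == 0) = false.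
Proof. by rewrite den_inc reg_setr; case: ifP => //; case: (reg s x) => //; rewrite L_gt0. Qed.

(** * Correctness of one application of an operation *)

Section Header.

Variable n : nat.

Lemma check_row_spec i s : bounded w s -> reg s hd = n.+1 ->
  reg (den (check_row i) s) (tb i) = tabidx w (reg s (rp i)) /\
  (reg (den (check_row i) s) bad == 0) = (reg s bad == 0) && rowstart n w (reg s (rp i)).
Proof.
move=> bs hds; set s0 := den (Inc st) (den (Zero st) (den (Zero (tb i)) (den (InRew R) s))).
have bs0 : bounded w s0 by do 4!apply: den_bounded.
pose B := Cat (Zero st) (Cat (IfIn EndTable (Inc (tb i)) (IfIn EndRow (Skip R) (Inc st))) (InR R)).
have p0 : reg s0 (rp i) = reg s (rp i) by rewrite /s0 !den_unwritten.
have pL : reg s (rp i) <= L by case: bs.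
have := @for_rule R w (fun j s' => [/\ pin s' = j, reg s' (tb i) = tabidx w j &
  (reg s' st == 0) = ~~ isnum (nth EndNum (EndNum :: w) j)]) t0 (rp i) B s0.
rewrite p0; case=> //.
- split=> //.
  + by rewrite /s0 den_unwritten // den_unwritten // reg_setr /tabidx take0.
  + by rewrite /s0 reg_inc_eq0.
- move=> j s' jp bs' [s'p s'tb s'st]; set s2 := den (Zero st) (setr s' t0 j).
  have jL : j < L := leq_trans jp pL.
  have s2tb : reg s2 (tb i) = tabidx w j by rewrite /s2 den_unwritten // reg_setr_neq.
  have tabS : tabidx w j.+1 = tabidx w j + (nth EndNum w j == EndTable).
    by rewrite /tabidx (take_nth EndNum) // -cats1 count_cat /= addn0.
  have tabL : tabidx w j <= j by rewrite (leq_trans (count_size _ _)) // size_take jL.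
  have inpE : inp w (pin s2) = Some (nth EndNum w j).
    by rewrite /s2 /= s'p /inp (nth_map EndNum).
  have jL2 : forall s3, pin s3 = pin s2 -> pin (den (InR R) s3) = j.+1.
    by move=> s3 s3p; rewrite den_inr /= s3p /s2 /= s'p jL.
  have regR s3 x : reg (den (InR R) s3) x = reg s3 x by [].
  have st2 : reg s2 st = 0 by rewrite /s2 reg_setr.
  have nthS : nth EndNum (EndNum :: w) j.+1 = nth EndNum w j by [].
  rewrite /B den_cat -/s2 den_cat den_ifin (den_ifin _ EndRow) inpE tabS nthS.
  case gE: (nth EndNum w j); rewrite ![Some _ == Some _]/=; (split; first by apply: jL2); rewrite regR.
  + by rewrite den_unwritten // s2tb addn0.
  + by rewrite reg_inc_eq0.
  + by rewrite den_unwritten // s2tb addn0.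
  + by rewrite reg_inc_eq0.
  + by rewrite s2tb addn0.
  + by apply/eqP; exact: st2.
  + by rewrite den_inc reg_setr s2tb ifT ?addn1 //; apply: leq_ltn_trans tabL jL.
  + by rewrite den_unwritten // st2.
set s1 := denote w (For _ _ _) s0 => pin1 [tb1 st1].
have bad1 : reg s1 bad = reg s bad by rewrite /s1 /s0 !den_unwritten.
have rp1 : reg s1 (rp i) = reg s (rp i) by rewrite /s1 /s0 !den_unwritten.
have hd1 : reg s1 hd = n.+1 by rewrite /s1 /s0 !den_unwritten.
set s3 := den (IfZ st (Skip R) (ifeq (rp i) hd (Skip R) (Inc bad))) s1.
have tb3 : reg s3 (tb i) = tabidx w (reg s (rp i)) by rewrite /s3 den_unwritten.
have bad3 : (reg s3 bad == 0) = (reg s bad == 0) &&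
    ((reg s (rp i) == n.+1) || ~~ isnum (nth EndNum (EndNum :: w) (reg s (rp i)))).
  rewrite /s3 den_ifz st1; case: (~~ isnum _); first by rewrite orbT andbT -bad1.
  rewrite orbF den_ifeq rp1 hd1; case: (reg s (rp i) =P n.+1) => _; first by rewrite andbT -bad1.
  by rewrite reg_inc_eq0 andbF.
have pin3 : pin s3 = reg s (rp i).
  by rewrite /s3 den_ifz; case: ifP => // _; rewrite den_ifeq; case: ifP.
rewrite -[den (check_row i) s]/(den (IfIn Tally (Skip R) (IfIn EndNum (Skip R) (Inc bad))) s3).
split; first by rewrite den_unwritten.
rewrite /rowstart andbA -bad3 !den_ifin pin3 /inp.
case: (ltnP (reg s (rp i)) L) => ltp; last first.
  by rewrite nth_default ?size_map // [nth EndRow _ _]nth_default // andbF reg_inc_eq0.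
rewrite (nth_map EndRow) //; case: (nth EndRow w _); rewrite ![Some _ == Some _]/= ?andbT ?andbF //.
all: by rewrite reg_inc_eq0.
Qed.

Lemma each_rule (P : seq 'I_m.+1 -> mem R -> Prop) f s : P [::] s ->
  (forall d i s, i \notin d -> P d s -> P (rcons d i) (den (f i) s)) ->
  P (enum 'I_m.+1) (den (each f) s).
Proof. by apply: seqs_rule; rewrite enum_uniq. Qed.

Lemma each_unwritten f x s : (forall i, ~~ written (f i) x) -> reg (den (each f) s) x = reg s x.
Proof.
by move=> h; apply: den_unwritten; rewrite written_seqs has_map -all_predC; apply/allP => i _ /=.
Qed.

Lemma each_keeps_arr f : (forall i, keeps_arr (f i)) -> keeps_arr (each f).
Proof. by move=> h; rewrite keeps_arr_seqs all_map; apply/allP => i _ /=. Qed.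

Lemma written_check_row i x : written (check_row i) x = (x \in [:: t0; tb i; st; bad]).
Proof.
rewrite /check_row /= !inE.
by move: (x == t0) (x == tb i) (x == st) (x == bad) => [] [] [] [].
Qed.

Definition rows_ok (ps : 'I_m.+1 -> nat) :=
  all (fun i => rowstart n w (ps i)) (enum 'I_m.+1) &&
  all (fun i => tabidx w (ps i) == tabidx w (ps ord0)) (enum 'I_m.+1).

Lemma check_rows_spec s : bounded w s -> reg s hd = n.+1 ->
  (reg (den check_rows s) bad == 0) = rows_ok (fun i => reg s (rp i)).
Proof.
move=> bs hds; pose ps i := reg s (rp i).
have [] : [/\ bounded w (den (each check_row) (den (Zero bad) s)),
    forall i, i \in enum 'I_m.+1 -> reg (den (each check_row) (den (Zero bad) s)) (tb i) = tabidx w (ps i) &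
    (reg (den (each check_row) (den (Zero bad) s)) bad == 0) = all (fun i => rowstart n w (ps i)) (enum 'I_m.+1)].
  have [] // := @each_rule (fun d s' => [/\ bounded w s' /\ reg s' hd = n.+1,
      forall i, reg s' (rp i) = ps i, forall i, i \in d -> reg s' (tb i) = tabidx w (ps i) &
      (reg s' bad == 0) = all (fun i => rowstart n w (ps i)) d]) check_row (den (Zero bad) s).
  - by split=> //; split; [exact: den_bounded|rewrite den_unwritten].
  - move=> d i s' id [[bs' hds'] s'p s'tb s'bad]; have [tb' bad'] := check_row_spec i bs' hds'.
    split.
    + by split; [exact: den_bounded|rewrite den_unwritten].
    + by move=> j; rewrite den_unwritten.
    + move=> j; rewrite mem_rcons inE; case: (altP (j =P i)) => [-> _|ji jd]; first by rewrite tb' s'p.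
      rewrite den_unwritten ?s'tb // written_check_row !inE !xpair_eqE /=.
      by rewrite (negPf ji) ?andbF.
    + by rewrite all_rcons bad' s'bad s'p andbC.
  - by case.
set s2 := den (each check_row) _ => bs2 tb2 bad2.
have [] // := @each_rule (fun d s' => (forall i, reg s' (tb i) = tabidx w (ps i)) /\
      (reg s' bad == 0) = all (fun i => rowstart n w (ps i)) (enum 'I_m.+1) &&
        all (fun i => tabidx w (ps i) == tabidx w (ps ord0)) d) check_table s2.
- by split=> [i|]; rewrite ?tb2 ?mem_enum // andbT bad2.
move=> d i s' id [s'tb s'bad]; split=> [j|]; first by rewrite den_unwritten.
rewrite /check_table den_ifeq !s'tb all_rcons; case: (tabidx w (ps i) == _); first exact: s'bad.
by rewrite reg_inc_eq0 andbF.
Qed.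

Lemma read_spec i s v u : bounded w s -> drop (reg s (cur i)) w = encode_nat v ++ u ->
  reg (den (read i) s) (rv i) = v /\ drop (reg (den (read i) s) (cur i)) w = u.
Proof.
move=> bs; rewrite cat_rcons => dE; set s1 := den (num t0 e (cur i) (rv i)) s.
have v1 : reg s1 (rv i) = v by apply: num_reg dE.
have c1 : reg s1 (cur i) = reg s (cur i) by rewrite /s1 den_unwritten.
have bs1 : bounded w s1 by exact: den_bounded.
have cv : reg s (cur i) + v < L.
  have := congr1 size dE; rewrite size_drop size_cat size_nseq /=; lia.
have -> : den (read i) s = den (add_succ t0 (rv i) (cur i)) s1 by [].
split; first by rewrite den_unwritten.
rewrite add_succ_reg // ?c1 ?v1 // -addnS addnC -drop_drop dE -cat_rcons drop_size_cat //.
by rewrite size_rcons size_nseq.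
Qed.

Lemma written_read i x : written (read i) x = (x \in [:: t0; e; rv i; cur i]).
Proof.
rewrite /read /= !inE.
by move: (x == t0) (x == e) (x == rv i) (x == cur i) => [] [] [] [].
Qed.

Lemma reads_spec s (v : 'I_m.+1 -> nat) u : bounded w s ->
  (forall i, drop (reg s (cur i)) w = encode_nat (v i) ++ u i) ->
  forall i, reg (den (each read) s) (rv i) = v i /\ drop (reg (den (each read) s) (cur i)) w = u i.
Proof.
move=> bs dE i.
suff [_ /(_ i)] : bounded w (den (each read) s) /\ forall i,
   if i \in enum 'I_m.+1 then reg (den (each read) s) (rv i) = v i /\ drop (reg (den (each read) s) (cur i)) w = u i
   else drop (reg (den (each read) s) (cur i)) w = encode_nat (v i) ++ u i by rewrite mem_enum.
apply: (@each_rule (fun d s' => bounded w s' /\ forall i,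
   if i \in d then reg s' (rv i) = v i /\ drop (reg s' (cur i)) w = u i
   else drop (reg s' (cur i)) w = encode_nat (v i) ++ u i)) => // d j s' jd [bs' h].
split=> [|i']; first exact: den_bounded.
have := h j; rewrite (negPf jd) => /read_spec[]// r1 r2.
rewrite mem_rcons inE; case: (altP (i' =P j)) => [->//|ij]; rewrite orFb.
have := h i'; rewrite !den_unwritten // written_read !inE !xpair_eqE /= (negPf ij) ?andbF //.
Qed.

Lemma mem_fam (a : 'I_32) (x : R) : (x \in [seq (a, i) | i <- enum 'I_m.+1]) = (x.1 == a).
Proof.
apply/mapP/eqP => [[i _ ->]//|<-]; exists x.2; rewrite ?mem_enum //; by case: x.
Qed.

Lemma written_addr rs x : x != t0 -> x.1 != @Ordinal 32 20 isT -> ~~ written (addr rs) x.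
Proof.
move=> xt x20; apply/negP => /= /written_walk /or3P[|xf|//]; first by rewrite (negPf xt).
by rewrite -(mem_fam (@Ordinal 32 20 isT) x) xf in x20.
Qed.

Lemma addr_par rs s : size rs <= m.+1 -> bounded w s ->
  (forall r, r \in rs -> (r != t0) && (r.1 != @Ordinal 32 20 isT)) ->
  par (den (addr rs) s) = code w (map (reg s) rs).
Proof.
move=> sz bs h; rewrite /addr den_cat (@walk_par _ _ _ _ _ _ 1) //.
- by rewrite mul1n.
- by rewrite size_map size_enum_ord.
- by move=> r /h /andP[].
- by move=> r /h /andP[_ r20]; apply: contra r20; rewrite mem_fam.
- by move=> s'; rewrite addn1.
Qed.

Lemma addr_arr rs s : arr (den (addr rs) s) = arr s.
Proof. by apply: den_keeps_arr; apply: (@keeps_arr_walk R t0 rs). Qed.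

Section Scan.

Variables (nums : 'I_m.+1 -> seq nat) (us : 'I_m.+1 -> seq symbol) (r : nat).
Hypothesis size_nums : forall i, size (nums i) = r.+1.

Definition col j := [seq nth 0 (nums i) j | i <- enum 'I_m.+1].

Definition at_col t s := forall i, drop (reg s (cur i)) w = encode_nums (drop t (nums i)) ++ EndRow :: us i.

Lemma scan_column_spec t s : t <= r -> bounded w s -> at_col t s ->
  if t < r then
    [/\ at_col t.+1 (den scan_column s), reg (den scan_column s) dn = reg s dn,
      (reg (den scan_column s) bad == 0) = (reg s bad == 0) && arr s (code w (col t)) &
      arr (den scan_column s) = arr s]
  else reg (den scan_column s) dn != 0 /\ (forall a,
      arr (den scan_column s) a = arr s a || (reg s bad == 0) && (a == code w (col r))).
Proof.
move=> tr bs ats; set s1 := den (each read) s.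
have bs1 : bounded w s1 by exact: den_bounded.
have h1 i : reg s1 (rv i) = nth 0 (nums i) t /\
    drop (reg s1 (cur i)) w = encode_nums (drop t.+1 (nums i)) ++ EndRow :: us i.
  apply: (reads_spec (v := fun i => nth 0 (nums i) t) (u := fun i => encode_nums (drop t.+1 (nums i)) ++ EndRow :: us i)) => // j; rewrite ats (drop_nth 0) ?size_nums ?ltnS //.
  by rewrite /encode_nums /= catA.
pose s2 := den (addr (fam 18)) s1.
have p2 : par s2 = code w (col t).
  rewrite /s2 addr_par //; first by rewrite -map_comp; congr code; apply: eq_map => i; case: (h1 i).
    by rewrite size_map size_enum_ord.
  by move=> x /mapP[i _ ->].
have bs2 : bounded w s2 by exact: den_bounded.
have addrE x : x != t0 -> x.1 != @Ordinal 32 20 isT -> reg s2 x = reg s1 x.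
  by move=> x1 x2; apply: den_unwritten; apply: written_addr.
have arr1 : arr s1 = arr s by apply: den_keeps_arr; apply: each_keeps_arr.
have arr2 : arr s2 = arr s by rewrite /s2 addr_arr.
pose s3 := den (goto t0 (cur ord0)) s2.
have pin3 : pin s3 = reg s1 (cur ord0) by rewrite /s3 goto_pin // addrE.
have par3 : par s3 = code w (col t) by rewrite /s3 den_keeps_par.
have arr3 : arr s3 = arr s by rewrite /s3 den_keeps_arr.
have reg3 x : x != t0 -> x.1 != @Ordinal 32 20 isT -> reg s3 x = reg s1 x.
  by move=> x1 x2; rewrite /s3 den_unwritten ?addrE //= orbF.
have bad3 : reg s3 bad = reg s bad by rewrite reg3 // /s1 each_unwritten.
have dn3 : reg s3 dn = reg s dn by rewrite reg3 // /s1 each_unwritten.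
have cur3 i : drop (reg s3 (cur i)) w = encode_nums (drop t.+1 (nums i)) ++ EndRow :: us i.
  by rewrite reg3 //; case: (h1 i).
have -> : den scan_column s = den (IfIn EndRow (Cat (IfZ bad (ArSet R true) (Skip R)) (Inc dn)) (IfAr (Skip R) (Inc bad))) s3 by [].
have inpE : (inp w (pin s3) == Some EndRow) = (t == r).
  rewrite inp_drop pin3; have [_ ->] := h1 ord0.
  case: (ltngtP t r) tr => // [tr _|-> _]; last by rewrite drop_oversize // size_nums.
  rewrite (drop_nth 0) ?size_nums //; by case: (nth _ _ _).
rewrite den_ifin inpE; case: (ltngtP t r) tr => // [tr _|tr _].
  rewrite den_ifar arr3 par3; case: (arr s _).
    by split=> //; rewrite bad3 andbT.
  by split=> //; rewrite reg_inc_eq0 andbF.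
rewrite den_cat; split; first by rewrite reg_inc_eq0.
move=> a; rewrite den_ifz bad3; case: (_ == 0); last by rewrite orbF -arr3.
by rewrite -tr -par3 -arr3 /=; case: eqP => //= _; rewrite ?orbT ?orbF.
Qed.

End Scan.

(** Nothing is assumed about the cursors: after a failed check they may point anywhere in the
    word. *)
Lemma scan_column_bad s : reg s bad != 0 ->
  reg (den scan_column s) bad != 0 /\ arr (den scan_column s) = arr s.
Proof.
move=> sb; set s1 := den (each read) s.
have arr1 : arr s1 = arr s by apply: den_keeps_arr; apply: each_keeps_arr.
have bad1 : reg s1 bad = reg s bad by rewrite /s1 each_unwritten.
pose s2 := den (addr (fam 18)) s1; pose s3 := den (goto t0 (cur ord0)) s2.
have arr3 : arr s3 = arr s by rewrite /s3 den_keeps_arr // /s2 addr_arr.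
have bad3 : reg s3 bad = reg s bad by rewrite /s3 den_unwritten // /s2 den_unwritten ?written_addr.
have -> : den scan_column s = den (IfIn EndRow (Cat (IfZ bad (ArSet R true) (Skip R)) (Inc dn)) (IfAr (Skip R) (Inc bad))) s3 by [].
rewrite den_ifin; case: ifP => _.
  rewrite den_cat den_ifz bad3 (negPf sb); split; last exact: arr3.
  by rewrite den_unwritten // -[den (Skip R) s3]/s3 bad3.
rewrite den_ifar; case: ifP => _; first by split; [rewrite -[den (Skip R) s3]/s3 bad3|].
by split; [rewrite reg_inc_eq0|].
Qed.

Definition prepare := Cat check_rows (Cat (each (fun i => copy t0 (rp i) (cur i))) (Zero dn)).
Definition scan_columns := Loop t2 (IfZ dn scan_column (Skip R)).

Lemma den_apply_op s : den apply_op s = den scan_columns (den prepare s).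
Proof. by []. Qed.

Lemma keeps_arr_prepare : keeps_arr prepare.
Proof. by rewrite /prepare /check_rows /= !each_keeps_arr. Qed.

Lemma prepare_spec s : bounded w s -> reg s hd = n.+1 ->
  [/\ bounded w (den prepare s), reg (den prepare s) dn = 0,
    (reg (den prepare s) bad == 0) = rows_ok (fun i => reg s (rp i)),
    arr (den prepare s) = arr s & forall i, reg (den prepare s) (cur i) = reg s (rp i)].
Proof.
move=> bs hds; have bp : bounded w (den prepare s) by exact: den_bounded.
have pE : den prepare s = den (Zero dn) (den (each (fun i => copy t0 (rp i) (cur i))) (den check_rows s)) by [].
have bc : bounded w (den check_rows s) by exact: den_bounded.
have rpE i : reg (den check_rows s) (rp i) = reg s (rp i).
  by rewrite /check_rows !den_cat each_unwritten // each_unwritten // den_unwritten.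
split=> //.
- by rewrite pE den_unwritten // each_unwritten //; exact: check_rows_spec.
- by rewrite den_keeps_arr ?keeps_arr_prepare.
move=> i; rewrite pE den_unwritten //.
pose P (d : seq 'I_m.+1) s' := [/\ bounded w s', forall i, reg s' (rp i) = reg s (rp i) &
    forall i, i \in d -> reg s' (cur i) = reg s (rp i)].
suff [_ _ ->] : P (enum 'I_m.+1) (den (each (fun i => copy t0 (rp i) (cur i))) (den check_rows s)) by rewrite ?mem_enum.
apply: each_rule; first by [].
move=> d j s' jd [bs' h1 h2]; split.
- exact: den_bounded.
- by move=> i'; rewrite den_unwritten.
move=> i'; rewrite mem_rcons inE; case: (altP (i' =P j)) => [-> _|ij]; first by rewrite copy_reg.
rewrite orFb => i'd; rewrite den_unwritten ?h2 //= !xpair_eqE /= (negPf ij) ?andbF //.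
Qed.

Lemma apply_op_bad s : bounded w s -> reg s hd = n.+1 -> ~~ rows_ok (fun i => reg s (rp i)) ->
  arr (den apply_op s) = arr s.
Proof.
move=> bs hds nok; have [_ _ badE arrE _] := prepare_spec bs hds.
rewrite den_apply_op; set s1 := den prepare s in badE arrE *.
suff [] : reg (den scan_columns s1) bad != 0 /\ arr (den scan_columns s1) = arr s by [].
apply: (@loop_inv R w (fun s' => reg s' bad != 0 /\ arr s' = arr s)); first by rewrite badE.
move=> i s' _ [s'b s'a]; rewrite den_ifz; case: ifP => _; last by [].
by have [] := @scan_column_bad (setr s' t2 i) s'b; rewrite s'a.
Qed.

Lemma size_encode_nums ns : size ns <= size (encode_nums ns).
Proof. by elim: ns => //= v ns IH; rewrite /encode_nums /= size_cat size_encode_nat -/(encode_nums ns); lia. Qed.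

(** All arguments are looked up in the old array, since a bit is set only in the last column. *)
Lemma apply_op_good s nums us r : bounded w s -> reg s hd = n.+1 -> rows_ok (fun i => reg s (rp i)) ->
  (forall i, size (nums i) = r.+1) ->
  (forall i, drop (reg s (rp i)) w = encode_nums (nums i) ++ EndRow :: us i) ->
  forall a, arr (den apply_op s) a = arr s a ||
    all (fun j => arr s (code w (col nums j))) (iota 0 r) && (a == code w (col nums r)).
Proof.
move=> bs hds ok sz dE a; have [bs1 dn1 badE arrE curE] := prepare_spec bs hds.
rewrite den_apply_op; set s1 := den prepare s in bs1 dn1 badE arrE curE *.
have rL : r < L.
  have := congr1 size (dE ord0); rewrite size_drop size_cat /=.
  by have := size_encode_nums (nums ord0); rewrite sz; lia.
pose I t s' := bounded w s' /\ if t <= r then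
    [/\ at_col nums us t s', reg s' dn = 0,
      (reg s' bad == 0) = all (fun j => arr s (code w (col nums j))) (iota 0 t) & arr s' = arr s]
  else reg s' dn != 0 /\ forall a, arr s' a = arr s a ||
    all (fun j => arr s (code w (col nums j))) (iota 0 r) && (a == code w (col nums r)).
suff : I L.+1 (den scan_columns s1) by rewrite /I leqNgt (leqW rL) => -[_ [_ ->]].
apply: loop_rule => [|t s' tL [bs' It]].
  by split=> //; split=> //; [move=> i; rewrite curE drop0 dE|rewrite badE ok].
have bs2 : bounded w (setr s' t2 t) by exact: bounded_setr.
split; first exact: (@den_bounded R w (IfZ dn scan_column (Skip R))).
rewrite den_ifz reg_setr_neq //; case: (leqP t r) It => [tr [atc dn0 badt arrt]|tr [/negPf dn0 arrt]]; last first.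
  by rewrite dn0 leqNgt (leqW tr); split=> //; exact: (negbT dn0).
rewrite dn0 eqxx; have atc2 : at_col nums us t (setr s' t2 t) by [].
have := scan_column_spec sz tr bs2 atc2; case: (ltnP t r) => [_ [h1 h2 h3 h4]|rt [h1 h2]].
  split=> //; first by rewrite h2 reg_setr_neq.
    by rewrite h3 reg_setr_neq // badt -[t.+1]addn1 iotaD all_cat /= andbT arrt.
  by rewrite h4 -arrt.
have {rt}tE : t = r by apply/eqP; rewrite eqn_leq tr rt.
by split=> // b; rewrite h2 reg_setr_neq // badt arrt tE.
Qed.

End Header.
End Commands.

(** * Correctness of the closure computation and of the procedure *)

Section Algorithm.

Variables (m : nat) (A : algebra).
Notation K := m.+1.
Notation R := (register m).
Notation fm a i := ((@Ordinal 32 a isT, i) : R).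
Notation sc a := (fm a ord0).
Notation t0 := (sc 0).
Notation e := (sc 1).
Notation nn := (sc 2).
Notation hd := (sc 3).
Notation fl := (sc 4).
Notation fnd := (sc 8).
Notation aa := (sc 9).
Notation zz := (sc 10).
Notation gd := (sc 12).
Notation rc i := (fm 16 i).
Notation rp i := (fm 17 i).
Notation fam a := [seq (fm a i) | i <- enum 'I_m.+1].

Notation T := (carrier A).
Notation n := #|T|.
Notation w := (encode_alg A).
Notation L := (size w).
Notation den := (denote w).
Notation state := {ffun 'I_m.+1 -> T}.

Lemma size_word : n.+1 <= L.
Proof. by rewrite size_cat size_encode_nat leq_addr. Qed.

Lemma word_gt0 : 0 < L.
Proof. exact: leq_trans size_word. Qed.

Definition ranks (u : state) := [seq (enum_rank (u i) : nat) | i <- enum 'I_m.+1].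
Definition address u := code w (ranks u).

Lemma rank_lt (a : T) : enum_rank a < L.
Proof. by apply: leq_trans (ltn_ord _) _; apply: leq_trans size_word. Qed.

Lemma ranks_bounded u : all (fun v => v <= L) (ranks u).
Proof. by apply/allP => v /mapP[i _ ->]; apply: ltnW (rank_lt _). Qed.

Lemma size_ranks u : size (ranks u) = K.
Proof. by rewrite size_map size_enum_ord. Qed.

Lemma address_inj : injective address.
Proof.
move=> u v /code_inj; rewrite !size_ranks => /(_ erefl (ranks_bounded u) (ranks_bounded v)) uv.
apply/ffunP => i; apply: enum_rank_inj; apply: val_inj.
by move/eq_in_map: uv => /(_ i (mem_enum _ _)).
Qed.

Lemma address_lt u : address u < L.+1 ^ K.
Proof. by rewrite -(size_ranks u); apply: code_lt (ranks_bounded u). Qed.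

(** The bit at [address u] tells whether [u] has been generated. *)
Definition states (s : mem R) : {set state} := [set u | arr s (address u)].

Definition header_ok (s : mem R) := [/\ bounded w s, reg s nn = n & reg s hd = n.+1].

Lemma states_arr s s' : arr s = arr s' -> states s = states s'.
Proof. by move=> ss; apply/setP => u; rewrite !inE ss. Qed.

Ltac other H := by apply: (contraNN _ H) => /eqP ->.

Lemma each_written f (x : R) : (forall i, ~~ written (f i) x) -> ~~ written (each f) x.
Proof. by move=> h; rewrite written_seqs has_map -all_predC; apply/allP => i _ /=. Qed.

Lemma apply_op_written (x : R) :
  (x.1 : nat) \notin [:: 0; 1; 5; 6; 7; 11; 18; 19; 20; 23] -> ~~ written (apply_op m) x.
Proof.
move=> H.
have o a (lt : a < 32) i : a \in [:: 0; 1; 5; 6; 7; 11; 18; 19; 20; 23] -> (x == (Ordinal lt, i)) = false.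
  by move=> aH; apply: contraNF H => /eqP->.
rewrite /apply_op /check_rows /scan_column /= !negb_or !o //= ?orbF !each_written //=.
- by rewrite written_addr //; apply/eqP => x1; rewrite x1 in H.
all: by move=> i; rewrite ?o.
Qed.

Lemma apply_op_header_ok s : header_ok s -> header_ok (den (apply_op m) s).
Proof. by case=> bs nns hds; split; rewrite ?den_unwritten ?apply_op_written //; exact: den_bounded. Qed.

(** One row of the table of [f] per coordinate amounts to one application of [f] in the power: the
    arguments are the columns of entries, and the result is the column of values. *)
Definition args_of (f : 'I_(nops A)) (xs : 'I_m.+1 -> (arity f).-tuple T) (j : 'I_(arity f)) : state :=
  [ffun i => tnth (xs i) j].

Lemma op_args (f : 'I_(nops A)) (xs : 'I_m.+1 -> (arity f).-tuple T) : @op_state A K f (args_of xs) = [ffun i => op (xs i)].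
Proof.
apply/ffunP => i; rewrite !ffunE; congr op; apply: eq_from_tnth => j.
by rewrite tnth_mktuple ffunE.
Qed.

Lemma apply_op_row s (f : 'I_(nops A)) (xs : 'I_m.+1 -> (arity f).-tuple T) : header_ok s ->
  (forall i, rowstart n w (reg s (rp i))) -> (forall i, row_at (reg s (rp i)) (xs i)) ->
  (forall i, tabidx w (reg s (rp i)) = f) ->
  forall u, (u \in states (den (apply_op m) s)) = (u \in states s) ||
    [forall j, args_of xs j \in states s] && (u == op_state (args_of xs)).
Proof.
move=> [bs nns hds] rs ra tf u; have [us dE] := fin_all_exists ra.
have ok : rows_ok w n (fun i => reg s (rp i)).
  by apply/andP; split; apply/allP => i _ //; rewrite !tf.
rewrite inE (apply_op_good (r := arity f) word_gt0 bs hds ok (nums := fun i => row_nums (xs i)) _ dE); last first.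
  by move=> i; rewrite size_map size_rcons size_tuple.
rewrite inE; congr (_ || (_ && _)).
- have colE (j : 'I_(arity f)) : col (fun i => row_nums (xs i)) j = ranks (args_of xs j).
    apply: eq_map => i; rewrite (nth_map (tnth (xs i) j)) ?size_rcons ?size_tuple; last by rewrite ltnW ?ltnS.
    by rewrite nth_rcons size_tuple ltn_ord ffunE -tnth_nth.
  apply/allP/forallP => [h j|h j].
    by rewrite inE /address -colE h // mem_iota /= add0n.
  by rewrite mem_iota /= add0n => ja; have := h (Ordinal ja); rewrite inE /address -colE.
- rewrite -(inj_eq address_inj) op_args; congr (_ == code _ _).
  apply: eq_map => i; rewrite (nth_map (op (xs i))) ?size_rcons ?size_tuple //.
  by rewrite nth_rcons size_tuple ltnn eqxx ffunE.
Qed.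

(** This holds for arbitrary contents of the row registers; equal table indices force the rows found
    there to belong to one operation. *)
Lemma apply_op_cases s : header_ok s ->
  states (den (apply_op m) s) = states s \/
  exists (f : 'I_(nops A)) (args : 'I_(arity f) -> state), (forall j, args j \in states s) /\
    states (den (apply_op m) s) = op_state args |: states s.
Proof.
move=> cs; have [bs nns hds] := cs.
case: (boolP (rows_ok w n (fun i => reg s (rp i)))) => [ok|nok]; last first.
  by left; apply: states_arr; apply: apply_op_bad nok => //; exact: word_gt0.
have /andP[/allP rs /allP tE] := ok.
have rs' i : rowstart n w (reg s (rp i)) by apply: rs; rewrite mem_enum.
have [f [_ [_ f0]]] := rowstart_row (rs' ord0).
have tf i : tabidx w (reg s (rp i)) = f by have /eqP-> := tE i (mem_enum _ _).
have [xs ra] : exists xs : 'I_m.+1 -> (arity f).-tuple T, forall i, row_at (reg s (rp i)) (xs i).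
  have xs_ex i : exists x : (arity f).-tuple T, row_at (reg s (rp i)) x; last exact: fin_all_exists xs_ex.
  have [g [x [rx tg]]] := rowstart_row (rs' i).
  have gf : g = f by apply: val_inj; rewrite /= -tg tf.
  by subst g; exists x.
have uE := apply_op_row cs rs' ra tf.
case: (boolP [forall j, args_of xs j \in states s]) => [/forallP aX|na]; [right|left].
  exists f, (args_of xs); split=> //; apply/setP => u; rewrite uE !inE orbC.
  by have -> : [forall j, args_of xs j \in states s] by apply/forallP.
by apply/setP => u; rewrite uE (negPf na) orbF.
Qed.

(** The positions are chosen before the memory, because a pass changes the memory until its loops
    reach them. *)
Lemma apply_op_complete (f : 'I_(nops A)) (args : 'I_(arity f) -> state) :
  exists ps : 'I_m.+1 -> nat, (forall i, ps i <= L) /\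
  forall s, header_ok s -> (forall i, reg s (rp i) = ps i) -> (forall j, args j \in states s) ->
    op_state args \in states (den (apply_op m) s).
Proof.
pose xs i := [tuple args j i | j < arity f].
have [ps h] := fin_all_exists (fun i => row_rowstart (xs i)).
exists ps; split=> [i|s cs sp aX]; first by case: (h i).
have aE j : args_of xs j = args j by apply/ffunP => i; rewrite ffunE tnth_mktuple.
rewrite (@apply_op_row s f xs) //; try by move=> i; rewrite sp; case: (h i).
apply/orP; right; apply/andP; split; first by apply/forallP => j; rewrite aE.
by apply/eqP/ffunP => i; rewrite !ffunE; congr op; apply: eq_mktuple => j; rewrite aE.
Qed.

Definition pass := nest (fam 17) (apply_op m).

Lemma header_ok_setr s x i : header_ok s -> x != nn -> x != hd -> i <= L -> header_ok (setr s x i).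
Proof.
case=> bs nns hds xn xh iL; split; first exact: bounded_setr.
- by rewrite reg_setr_neq // eq_sym.
- by rewrite reg_setr_neq // eq_sym.
Qed.

Lemma fam_neq (a : 'I_32) x b i : x \in [seq ((a, i) : R) | i <- enum 'I_m.+1] -> a != b -> x != ((b, i) : R).
Proof. by rewrite mem_fam => /eqP xa ab; apply: contraNneq ab => xE; rewrite -xa xE. Qed.

Lemma pass_inv (P : mem R -> Prop) s : header_ok s -> P s ->
  (forall s x i, P s -> P (setr s x i)) -> (forall s, header_ok s -> P s -> P (den (apply_op m) s)) ->
  header_ok (den pass s) /\ P (den pass s).
Proof.
move=> cs Ps Pset Pone; apply: (@nest_inv R w (fun s => header_ok s /\ P s)) => //.
- move=> s' x i xf iL [cs' Ps']; split; last exact: Pset.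
  by apply: header_ok_setr => //; apply: fam_neq xf _.
- by move=> s' [cs' Ps']; split; [exact: apply_op_header_ok|exact: Pone].
Qed.

Lemma apply_op_mono s : header_ok s -> states s \subset states (den (apply_op m) s).
Proof. by move/apply_op_cases => [->|[f [args [_ ->]]]]; rewrite ?subsetUr. Qed.

Lemma pass_header_ok s : header_ok s -> header_ok (den pass s).
Proof. by move=> cs; have [] := @pass_inv (fun _ => True) s cs I. Qed.

Lemma pass_mono s : header_ok s -> states s \subset states (den pass s).
Proof.
move=> cs; have [] // := @pass_inv (fun s' => states s \subset states s') s cs (subxx _).
by move=> s' cs' h; apply: subset_trans h (apply_op_mono cs').
Qed.

Lemma pass_sound c (G : {set state}) s : (forall v, v \in G <-> gen c v) -> header_ok s ->
  states s \subset G -> states (den pass s) \subset G.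
Proof.
move=> GE cs XG; have [] // := @pass_inv (fun s' => states s' \subset G) s cs XG.
move=> s' cs' h; case: (apply_op_cases cs') => [->//|[f [args [aX ->]]]].
rewrite subUset sub1set h andbT; apply/GE; apply: gen_op => j; apply/GE.
exact: subsetP h _ (aX j).
Qed.

(** Bits are never removed during a pass, so the arguments are still present when the loops reach
    their rows, and the result stays present afterwards. *)
Lemma pass_complete s (f : 'I_(nops A)) (args : 'I_(arity f) -> state) : header_ok s ->
  (forall j, args j \in states s) -> op_state args \in states (den pass s).
Proof.
move=> cs aX; have [ps [psL h]] := apply_op_complete args.
apply: (@nest_visit R w (fun s' => header_ok s' /\ states s \subset states s')
  (fun s' => op_state args \in states s') (fun x => ps x.2) (fam 17) (apply_op m) s) => //.
- by rewrite map_inj_uniq ?enum_uniq // => i j [].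
- by move=> x xf; split; rewrite // apply_op_written //; move: xf; rewrite mem_fam => /eqP->.
- by move=> s' x i xf iL [cs' ss']; split=> //; apply: header_ok_setr => //; apply: fam_neq xf _.
- move=> s' [cs' ss']; split; first exact: apply_op_header_ok.
  exact: subset_trans ss' (apply_op_mono cs').
- by move=> s' [cs' _]; apply: (subsetP (apply_op_mono cs')).
- move=> s' [cs' ss'] sp; apply: h => // [i|j]; last exact: subsetP ss' _ (aX j).
  by rewrite sp ?mem_fam.
Qed.

(** A pass that adds nothing reaches a closed set, so the number of passes done
    bounds the cardinality from below until then. *)
Lemma passes_spec c (G : {set state}) s : (forall v, v \in G <-> gen c v) -> header_ok s ->
  states s \subset G -> (forall p : {perm 'I_m.+1}, [ffun l => c (p l)] \in states s) ->
  header_ok (den (nest (fam 21) pass) s) /\ states (den (nest (fam 21) pass) s) = G.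
Proof.
move=> GE cs XG Xp.
have := @nest_count R w (fun t s' => [/\ header_ok s', states s \subset states s', states s' \subset G &
  G \subset states s' \/ t <= #|states s'|]) (fam 21) pass 0 s.
case=> //; last first.
(* The number of passes [L.+1 ^ m.+1] exceeds the number [n ^ m.+1] of all states, which rules out
   the second alternative. *)
- move=> cs' _ X'G [GX|]; first by split=> //; apply/eqP; rewrite eqEsubset X'G.
  rewrite size_map size_enum_ord add0n leqNgt; case/negP.
  apply: leq_ltn_trans (max_card _) _; rewrite card_ffun card_ord ltn_exp2r //.
  exact: leq_trans size_word (leqnSn _).
- by split=> //; right.
- move=> t s' [cs' ss' X'G tX]; have m' := pass_mono cs'.
  have sG : states (den pass s') \subset G by exact: pass_sound GE cs' X'G.
  split=> //; [exact: pass_header_ok|exact: subset_trans ss' m'|].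
  case: tX => [GX|tX]; first by left; apply: subset_trans GX m'.
  case: (ltnP t #|states (den pass s')|) => [|le]; [by right|left].
  have eX : states s' = states (den pass s') by apply/eqP; rewrite eqEcard m' (leq_trans le tX).
  apply/subsetP => v /GE; apply: gen_sub; split=> [p|f args aX].
    by apply: (subsetP m'); apply: (subsetP ss').
  by rewrite -eX in aX; apply: pass_complete.
by move=> t s' x i xf iL [cs' h1 h2 h3]; split=> //; apply: header_ok_setr => //; apply: fam_neq xf _.
Qed.

Lemma den_header_ok c s : header_ok s -> ~~ written c nn -> ~~ written c hd -> header_ok (den c s).
Proof. by case=> bs nns hds wn wh; split; rewrite ?den_unwritten //; exact: den_bounded. Qed.

Lemma clear_array_spec s : states (den (clear_array m) s) = set0.
Proof.
have [_ h] : par (den (clear_array m) s) = 0 + L.+1 ^ size (fam 20) /\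
    (forall a, a < 0 + L.+1 ^ size (fam 20) -> arr (den (clear_array m) s) a = false).
  apply: (@nest_count R w (fun t s => par s = t /\ forall a, a < t -> arr s a = false)) => //.
  move=> t s' [s't h]; split=> [|a]; first by rewrite /= s't.
  rewrite ltnS leq_eqVlt /= s't; case: eqP => //= _; exact: h.
apply/setP => u; rewrite !inE h // add0n size_map size_enum_ord; exact: address_lt.
Qed.

Lemma add_perms_spec (c : state) s : header_ok s -> (forall i, reg s (rc i) = enum_rank (c i)) ->
  forall u, (u \in states (den (add_perms m) s)) = (u \in states s) || [exists p : {perm 'I_m.+1}, u == [ffun l => c (p l)]].
Proof.
move=> cs sc u.
pose P (d : seq {perm 'I_m.+1}) s' := [/\ bounded w s', forall i, reg s' (rc i) = enum_rank (c i) &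
  forall u, (u \in states s') = (u \in states s) || has (fun p : {perm 'I_m.+1} => u == [ffun l => c (p l)]) d].
suff [_ _ ->] : P (enum {perm 'I_m.+1}) (den (add_perms m) s).
  congr (_ || _); apply/hasP/existsP => [[p _ up]|[p up]]; exists p => //; exact: mem_enum.
apply: seqs_rule; first exact: enum_uniq.
  by case: cs => bs _ _; split=> // v; rewrite orbF.
move=> d p s' _ [bs' sc' states']; set s2 := den (addr [seq rc (p i) | i <- enum 'I_m.+1]) s'.
have par2 : par s2 = address [ffun l => c (p l)].
  rewrite /s2 addr_par //; first last.
    by move=> r /mapP[i _ ->].
    by rewrite size_map size_enum_ord.
  by rewrite /address -map_comp; congr (code w _); apply: eq_map => i /=; rewrite sc' ffunE.
split; first exact: den_bounded.
- by move=> i; rewrite den_cat -/s2 den_unwritten // den_unwritten ?written_addr.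
move=> v; rewrite den_cat -/s2 inE /= par2 (inj_eq address_inj) has_rcons /s2 addr_arr.
by rewrite orbCA -states' inE; case: eqP.
Qed.

Lemma find_const_spec s : header_ok s ->
  (reg (den (find_const m) s) fnd == 0) = [forall a : T, [ffun=> a] \notin states s].
Proof.
move=> [bs nns hds].
pose ca a := code w [seq a | i <- enum 'I_m.+1].
pose P j s' := [/\ bounded w s', arr s' = arr s, reg s' nn = n &
  (reg s' fnd == 0) = all (fun a => ~~ arr s (ca a)) (iota 0 (minn j n))].
have : P L.+1 (den (find_const m) s).
  rewrite /find_const den_cat; apply: loop_rule.
    by rewrite /P min0n; split=> //; exact: den_bounded.
  move=> j s' jL [bs' as' ns' fs']; set s2 := setr s' aa j.
  have bs2 : bounded w s2 by exact: bounded_setr.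
  have n2 : reg s2 nn = n by rewrite /s2 reg_setr_neq.
  have f2 : reg s2 fnd = reg s' fnd by rewrite /s2 reg_setr_neq.
  rewrite den_iflt n2 {2}/s2 reg_setr; case: ltnP => jn; last first.
    split=> //; rewrite -[den _ _]/s2 f2 fs'; congr (all _ (iota 0 _)); lia.
  set s3 := den (addr [seq aa | i <- enum 'I_m.+1]) s2.
  have p3 : par s3 = ca j.
    rewrite /s3 addr_par //; first last.
      by move=> r /mapP[i _ ->].
      by rewrite size_map size_enum_ord.
    by rewrite /ca -map_comp; congr (code w _); apply: eq_map => i /=; rewrite eqxx.
  have a3 : arr s3 = arr s by rewrite /s3 addr_arr.
  have f3 : reg s3 fnd = reg s' fnd by rewrite /s3 den_unwritten ?written_addr.
  have n3 : reg s3 nn = n by rewrite /s3 den_unwritten ?written_addr.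
  have b3 : bounded w s3 by exact: den_bounded.
  have mj : minn j n = j by lia.
  have mj1 : minn j.+1 n = j + 1 by lia.
  rewrite den_cat -/s3 den_ifar a3 p3; rewrite mj in fs'; rewrite /P mj1 iotaD all_cat /= add0n andbT.
  case: (arr s (ca j)); split; rewrite ?andbT ?andbF ?reg_inc_eq0 //.
  - exact: (@den_bounded R w (Inc fnd) s3).
  - exact: word_gt0.
  - by rewrite -fs' -f3.
case=> _ _ _ ->; have -> : minn L.+1 n = n by have := size_word; lia.
have caE a : ca (enum_rank a) = address [ffun=> a].
  by rewrite /address; congr (code w _); apply: eq_map => i; rewrite ffunE.
apply/allP/forallP => [h a|h j]; first by rewrite inE -caE; apply: h; rewrite mem_iota /= add0n ltn_ord.
rewrite mem_iota /= add0n => jn; have := h (enum_val (Ordinal jn)).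
by rewrite inE -caE enum_valK.
Qed.

Lemma test_tuple_spec c (G : {set state}) s : (forall v, v \in G <-> gen c v) -> header_ok s ->
  (forall i, reg s (rc i) = enum_rank (c i)) ->
  (reg (den (test_tuple m) s) fl == 0) = (reg s fl == 0) && [exists a : T, [ffun=> a] \in G].
Proof.
move=> GE cs sc; set s1 := den (clear_array m) s; set s2 := den (add_perms m) s1.
have ctxE c' s' : header_ok s' -> ~~ written c' nn -> ~~ written c' hd -> header_ok (den c' s') by exact: den_header_ok.
have clw (x : R) : x.1 != @Ordinal 32 20 isT -> ~~ written (clear_array m) x.
  by move=> x20; rewrite /clear_array /= written_nest /= orbF mem_fam.
have pew (x : R) : x != t0 -> x.1 != @Ordinal 32 20 isT -> ~~ written (add_perms m) x.
  move=> xt x20; rewrite written_seqs has_map -all_predC; apply/allP => p _.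
  by rewrite /= orbF; apply: (@written_addr m _ x).
have paw (x : R) : x.1 != @Ordinal 32 21 isT -> x.1 != @Ordinal 32 17 isT ->
    ~~ written (apply_op m) x -> ~~ written (nest (fam 21) pass) x.
  by move=> x1 x2 /negPf x3; rewrite written_nest mem_fam /pass written_nest mem_fam (negPf x1) (negPf x2) x3.
have sew (x : R) : x != t0 -> x != aa -> x != fnd -> x.1 != @Ordinal 32 20 isT -> ~~ written (find_const m) x.
  move=> x1 x2 x3 x4; rewrite /find_const /= (negPf x2) (negPf x3) ?orbF.
  exact: (@written_addr m _ x).
have cs1 : header_ok s1 by apply: ctxE; rewrite ?clw.
have sc1 i : reg s1 (rc i) = enum_rank (c i) by rewrite /s1 den_unwritten ?clw.
have X1 : states s1 = set0 by exact: clear_array_spec.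
have cs2 : header_ok s2 by apply: ctxE; rewrite ?pew.
have X2 u : (u \in states s2) = [exists p : {perm 'I_m.+1}, u == [ffun l => c (p l)]].
  by rewrite (add_perms_spec cs1 sc1) X1 inE.
have [||cs3 X3] := passes_spec GE cs2.
- by apply/subsetP => u; rewrite X2 => /existsP[p /eqP->]; apply/GE; apply: gen_perm.
- by move=> p; rewrite X2; apply/existsP; exists p.
set s3 := den _ s2 in cs3 X3; have := find_const_spec cs3; rewrite X3; set s4 := den (find_const m) s3 => f4.
have fl4 : reg s4 fl = reg s fl.
  by rewrite /s4 den_unwritten ?sew // /s3 den_unwritten ?paw ?apply_op_written // /s2 den_unwritten ?pew // /s1 den_unwritten ?clw.
have -> : den (test_tuple m) s = den (IfZ fnd (Inc fl) (Skip R)) s4 by [].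
rewrite den_ifz f4 -negb_exists; case: (boolP [exists a, _]) => _.
  by rewrite andbT -fl4.
by rewrite andbF reg_inc_eq0 // word_gt0.
Qed.

Lemma test_tuple_written (x : R) :
  (x.1 : nat) \notin [:: 0; 1; 4; 5; 6; 7; 8; 9; 11; 17; 18; 19; 20; 21; 23] -> ~~ written (test_tuple m) x.
Proof.
move=> H; have o a (lt : a < 32) i : a \in [:: 0; 1; 4; 5; 6; 7; 8; 9; 11; 17; 18; 19; 20; 21; 23] ->
    (x == (Ordinal lt, i)) = false by move=> aH; apply: contraNF H => /eqP->.
have o1 a (lt : a < 32) : a \in [:: 0; 1; 4; 5; 6; 7; 8; 9; 11; 17; 18; 19; 20; 21; 23] ->
    (x.1 == Ordinal lt) = false by move=> aH; apply: contraNF H => /eqP->.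
have wa rs : written (addr rs) x = false by apply/negbTE/written_addr; rewrite ?o ?o1.
have wc : written (clear_array m) x = false by rewrite /clear_array [LHS]/= written_nest mem_fam o1.
have wp : written (add_perms m) x = false.
  apply/negbTE; rewrite written_seqs has_map -all_predC; apply/allP => p _.
  by rewrite /= orbF; exact: (negbT (wa [seq rc (p i) | i <- enum 'I_m.+1])).
have wo : written (apply_op m) x = false.
  apply/negbTE/apply_op_written; apply: contra H; rewrite !inE => /or4P[].
  by move=> ->. by move=> ->; rewrite ?orbT. by move=> ->; rewrite ?orbT.
  by do ![case/orP] => ->; rewrite ?orbT.
have wn : written (nest (fam 21) (nest (fam 17) (apply_op m))) x = false.
  by rewrite written_nest mem_fam o1 // written_nest mem_fam o1.
have ws : written (find_const m) x = false.
  by apply/negbTE; rewrite /find_const /= !o // ?orbF; exact: (negbT (wa [seq aa | i <- enum 'I_m.+1])).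
have wcat c1 c2 : written (Cat c1 c2) x = written c1 x || written c2 x by [].
by rewrite /test_tuple wcat wc wcat wp wcat wn wcat ws /= o.
Qed.

Lemma guard_spec s : header_ok s ->
  let s' := den (Cat (Zero gd) (each (fun i => IfLt (rc i) nn (Skip R) (Inc gd)))) s in
  [/\ header_ok s', forall i, reg s' (rc i) = reg s (rc i), reg s' fl = reg s fl &
    (reg s' gd == 0) = all (fun i => reg s (rc i) < n) (enum 'I_m.+1)].
Proof.
move=> cs; rewrite den_cat; set s1 := den (Zero gd) s.
pose P (d : seq 'I_m.+1) s' := [/\ header_ok s', forall i, reg s' (rc i) = reg s (rc i), reg s' fl = reg s fl &
    (reg s' gd == 0) = all (fun i => reg s (rc i) < n) d].
change (P (enum 'I_m.+1) (den (each (fun i => IfLt (rc i) nn (Skip R) (Inc gd))) s1)).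
apply: each_rule.
  by split=> //; apply: den_header_ok.
move=> d i s' _ [cs' rs' fs' gs']; split.
- exact: den_header_ok.
- by move=> j; rewrite den_unwritten.
- by rewrite den_unwritten.
have [_ ns' _] := cs'; rewrite den_iflt rs' ns' all_rcons; case: ltnP => _; first by rewrite -gs'.
by rewrite reg_inc_eq0 // word_gt0.
Qed.

Lemma guarded_written (x : R) : x.1 = @Ordinal 32 16 isT -> ~~ written (guarded m) x.
Proof.
move=> x16; have h (y : R) : y.1 != @Ordinal 32 16 isT -> x != y by apply: contraNneq => <-; rewrite x16.
have -> : written (guarded m) x = (x == gd) ||
  (written (each (fun i => IfLt (rc i) nn (Skip R) (Inc gd))) x || (written (test_tuple m) x || false)) by [].
rewrite (negPf (h _ _)) // (negPf (test_tuple_written _)) ?x16 // !orbF.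
by apply: each_written => i; exact: h.
Qed.

Lemma guarded_header_ok s : header_ok s -> header_ok (den (guarded m) s).
Proof.
move=> cs; have [cs' _ _ _] := guard_spec cs.
have -> : den (guarded m) s = den (IfZ gd (test_tuple m) (Skip R))
   (den (Cat (Zero gd) (each (fun i => IfLt (rc i) nn (Skip R) (Inc gd)))) s) by [].
rewrite den_ifz; case: ifP => _ //; apply: den_header_ok => //; exact: test_tuple_written.
Qed.

Lemma guarded_spec c (G : {set state}) s : (forall v, v \in G <-> gen c v) -> header_ok s ->
  (forall i, reg s (rc i) = enum_rank (c i)) ->
  (reg (den (guarded m) s) fl == 0) = (reg s fl == 0) && [exists a : T, [ffun=> a] \in G].
Proof.
move=> GE cs sc; have [cs' rs' fs' gs'] := guard_spec cs.
have -> : den (guarded m) s = den (IfZ gd (test_tuple m) (Skip R))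
   (den (Cat (Zero gd) (each (fun i => IfLt (rc i) nn (Skip R) (Inc gd)))) s) by [].
have -> : reg s fl = reg (den (Cat (Zero gd) (each (fun i => IfLt (rc i) nn (Skip R) (Inc gd)))) s) fl by [].
rewrite den_ifz gs' ifT; last by apply/allP => i _; rewrite sc ltn_ord.
by apply: test_tuple_spec GE cs' _ => i; rewrite rs' sc.
Qed.

Lemma guarded_skip s i : header_ok s -> n <= reg s (rc i) -> reg (den (guarded m) s) fl = reg s fl.
Proof.
move=> cs ni; have [cs' rs' fs' gs'] := guard_spec cs.
have -> : den (guarded m) s = den (IfZ gd (test_tuple m) (Skip R))
   (den (Cat (Zero gd) (each (fun i => IfLt (rc i) nn (Skip R) (Inc gd)))) s) by [].
rewrite den_ifz gs' ifF //; apply/negbTE/allPn; exists i; first by rewrite mem_enum.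
by rewrite -leqNgt.
Qed.

Definition header := Cat (Zero zz) (Cat (num t0 e zz nn) (Cat (copy t0 nn hd) (Cat (Inc hd) (Zero fl)))).

Lemma header_spec s : bounded w s -> header_ok (den header s) /\ reg (den header s) fl = 0.
Proof.
move=> bs; set s1 := den (Zero zz) s; set s2 := den (num t0 e zz nn) s1.
have bs1 : bounded w s1 by exact: den_bounded.
have bs2 : bounded w s2 by exact: den_bounded.
have n2 : reg s2 nn = n.
  apply: (num_reg word_gt0 (u := flatten [seq encode_table (@op A f) | f <- enum 'I_(nops A)])) => //.
  by rewrite /s1 den_zero reg_setr drop0 -cat_rcons.
set s3 := den (copy t0 nn hd) s2; have h3 : reg s3 hd = n by rewrite /s3 copy_reg.
have n3 : reg s3 nn = n by rewrite /s3 den_unwritten.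
have -> : den header s = den (Zero fl) (den (Inc hd) s3) by [].
split; last by rewrite den_zero reg_setr.
split; first by do 3!apply: den_bounded.
- by rewrite den_unwritten // den_unwritten.
- by rewrite den_unwritten // den_inc reg_setr h3 ifT // size_word.
Qed.

(** [fl] is reset only before the loops, so one tuple without a constant leaves it nonzero to the
    end, whatever is tested afterwards. *)
Theorem qWNU_program_spec s : bounded w s ->
  reg (den (qWNU_program m) s) fl == 0 <-> forall c : state, exists a, gen c [ffun=> a].
Proof.
move=> bs; have [cs0 fl0] := header_spec bs.
have -> : den (qWNU_program m) s = den (nest (fam 16) (guarded m)) (den header s) by [].
set s0 := den header s in cs0 fl0 *.
have set_header_ok s' x i : x \in fam 16 -> i <= L -> header_ok s' -> header_ok (setr s' x i).
  by move=> xf iL cs'; apply: header_ok_setr => //; apply: fam_neq xf _.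
have set_fl s' x i : x \in fam 16 -> reg (setr s' x i) fl = reg s' fl.
  by move=> xf; rewrite reg_setr_neq // eq_sym; apply: fam_neq xf _.
split=> [fl_eq0 c|ex_gen].
  have [G GE] := gen_set c.
  case: (boolP [exists a : T, [ffun=> a] \in G]) => [/existsP[a /GE]|nex]; first by exists a.
  suff : reg (den (nest (fam 16) (guarded m)) s0) fl != 0 by rewrite fl_eq0.
  apply: (@nest_visit R w (header_ok) (fun s' => reg s' fl != 0) (fun x => enum_rank (c x.2)) (fam 16) (guarded m) s0) => //.
  - by rewrite map_inj_uniq ?enum_uniq // => i j [].
  - move=> x; rewrite mem_fam => /eqP x16; split; last exact: ltnW (rank_lt _).
    exact: guarded_written.
  - exact: guarded_header_ok.
  - by move=> s' x i xf iL cs'; rewrite set_fl.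
  - move=> s' cs'; case: (boolP (all (fun i => reg s' (rc i) < n) (enum 'I_m.+1))) => [/allP all_lt|].
      have lt i : reg s' (rc i) < n by apply: all_lt; rewrite mem_enum.
      have [G' GE'] := gen_set [ffun i => enum_val (Ordinal (lt i))].
      rewrite (guarded_spec GE' cs'); first by case: (_ == 0).
      by move=> i; rewrite ffunE enum_valK.
    by case/allPn => i _; rewrite -leqNgt => /(guarded_skip cs') ->.
  - move=> s' cs' sc; rewrite (guarded_spec GE cs'); first by rewrite (negPf nex) andbF.
    by move=> i; rewrite sc ?mem_fam.
suff [] : header_ok (den (nest (fam 16) (guarded m)) s0) /\ reg (den (nest (fam 16) (guarded m)) s0) fl == 0 by [].
apply: (@nest_inv R w (fun s' => header_ok s' /\ reg s' fl == 0)); first by rewrite fl0.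
  by move=> s' x i xf iL [cs' fl']; split; [exact: set_header_ok|rewrite set_fl].
move=> s' [cs' fl']; split; first exact: guarded_header_ok.
case: (boolP (all (fun i => reg s' (rc i) < n) (enum 'I_m.+1))) => [/allP all_lt|]; last first.
  by case/allPn => i _; rewrite -leqNgt => /(guarded_skip cs') ->.
have lt i : reg s' (rc i) < n by apply: all_lt; rewrite mem_enum.
have [G GE] := gen_set [ffun i => enum_val (Ordinal (lt i))].
rewrite (guarded_spec GE cs'); last by move=> i; rewrite ffunE enum_valK.
by rewrite fl' /=; have [a /GE aG] := ex_gen [ffun i => enum_val (Ordinal (lt i))]; apply/existsP; exists a.
Qed.

(** * Well-formedness of the procedure *)

Lemma uniq_fam (a : 'I_32) : uniq [seq ((a, i) : R) | i <- enum 'I_m.+1].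
Proof. by rewrite map_inj_uniq ?enum_uniq // => i j []. Qed.

Lemma wf_each f : (forall i, wf (f i)) -> wf (each (m := m) f).
Proof. by move=> h; rewrite wf_seqs all_map; apply/allP => i _ /=. Qed.

Lemma wf_addr rs : wf (addr (m := m) rs).
Proof. by rewrite /= wf_walk ?uniq_fam // mem_fam. Qed.

Lemma wf_apply_op : wf (apply_op m).
Proof.
have h : ~~ written (IfZ (sc 6) (scan_column m) (Skip R)) (sc 7).
  have -> : written (IfZ (sc 6) (scan_column m) (Skip R)) (sc 7) =
    (written (each (@read m)) (sc 7) || (written (addr (fam 18)) (sc 7) || false)) || false by [].
  by rewrite !orbF negb_or each_written //=; exact: (@written_addr m (fam 18) (sc 7)).
have w1 : wf (scan_column m).
  have -> : wf (scan_column m) = wf (each (@read m)) && (wf (addr (fam 18)) && true) by [].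
  by rewrite wf_each // wf_addr.
have -> : wf (apply_op m) = (wf (each (@check_row m)) && wf (each (@check_table m))) &&
   (wf (each (fun i => copy t0 (fm 17 i) (fm 19 i))) && (~~ written (IfZ (sc 6) (scan_column m) (Skip R)) (sc 7) && (wf (scan_column m) && true))) by [].
by rewrite h w1 !wf_each.
Qed.

Lemma wf_test_tuple : wf (test_tuple m).
Proof.
have wc : wf (clear_array m) by rewrite /= wf_nest // uniq_fam.
have wp : wf (add_perms m).
  rewrite wf_seqs all_map; apply/allP => p _.
  by rewrite /= wf_walk ?uniq_fam // mem_fam.
have wn : wf (nest (fam 21) (nest (fam 17) (apply_op m))).
  apply: wf_nest; first exact: uniq_fam.
    move=> x; rewrite mem_fam => /eqP x21; rewrite written_nest mem_fam x21 /=.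
    by apply: apply_op_written; rewrite x21.
  apply: wf_nest; rewrite ?uniq_fam ?wf_apply_op // => x.
  by rewrite mem_fam => /eqP x17; apply: apply_op_written; rewrite x17.
have ws : wf (find_const m).
  have -> : wf (find_const m) = ~~ (written (addr [seq aa | i <- enum 'I_m.+1]) aa || false || false) && (wf (addr [seq aa | i <- enum 'I_m.+1]) && true && true) by [].
  by rewrite wf_addr !orbF andbT written_addr.
have -> : wf (test_tuple m) = wf (clear_array m) && (wf (add_perms m) && (wf (nest (fam 21) (nest (fam 17) (apply_op m))) && (wf (find_const m) && true))) by [].
by rewrite wc wp wn ws.
Qed.

Lemma wf_qWNU_program : wf (qWNU_program m).
Proof.
have wg : wf (guarded m).
  have -> : wf (guarded m) = wf (each (fun i => IfLt (rc i) nn (Skip R) (Inc gd))) && (wf (test_tuple m) && true) by [].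
  by rewrite wf_each // wf_test_tuple.
have -> : wf (qWNU_program m) = wf (nest (fam 16) (guarded m)) by [].
apply: wf_nest => //; first exact: uniq_fam.
by move=> x; rewrite mem_fam => /eqP; exact: guarded_written.
Qed.

End Algorithm.

(** * The time bound *)

Section Size.

Variable A : algebra.
Notation T := (carrier A).
Notation n := #|T|.

Lemma size_encode_row (r : nat) (g : r.-tuple T -> T) v :
  size (encode_row g v) <= r.+1 * n + 1.
Proof.
rewrite size_rcons -addn1 leq_add2r size_flatten /shape -map_comp.
have -> : r.+1 = size (rcons v (g v)) by rewrite size_rcons size_tuple.
elim: (rcons _ _) => //= x s IH.
by rewrite mulSn leq_add // size_encode_nat.
Qed.

Lemma size_encode_table (r : nat) (g : r.-tuple T -> T) :
  size (encode_table g) <= n ^ r * (r.+1 * n + 1) + 1.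
Proof.
rewrite size_rcons -addn1 leq_add2r -card_tuple cardE size_flatten /shape -map_comp.
by elim: (enum _) => //= v s IH; rewrite mulSn leq_add // size_encode_row.
Qed.

(** With two or more elements an operation has more rows than its arity. So [N] bounds arities, the
    number of operations and, by admissibility, [n], and a row has at most [N * N + 1] letters. *)
Lemma size_encode_alg : 1 < n -> admissible A ->
  (size (encode_alg A)).+1 <= 5 * (alg_size A).+1 ^ 3.
Proof.
move=> n_gt1 [_ nN]; set N := alg_size A in nN *.
have ar_le (f : 'I_(nops A)) : n ^ arity f <= N by rewrite /N /alg_size (bigD1 f) //= leq_addr.
have arN (f : 'I_(nops A)) : arity f < N by apply: leq_trans (ar_le f); apply: ltn_expl.
have nopsN : nops A <= N.
  rewrite -[X in X <= _]card_ord -sum1_card; apply: leq_sum => f _.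
  by rewrite expn_gt0 (ltnW n_gt1).
have tabs : size (flatten [seq encode_table (@op A f) | f <- enum 'I_(nops A)]) <= N * (N * N + 1) + N.
  rewrite size_flatten /shape -map_comp sumnE big_map big_enum /=.
  apply: (@leq_trans (\sum_(f < nops A) (n ^ arity f * (N * N + 1) + 1))).
    apply: leq_sum => f _; apply: leq_trans (size_encode_table _) _.
    by rewrite leq_add2r leq_mul2l leq_add2r leq_mul ?orbT.
  by rewrite big_split /= -big_distrl /= sum1_card card_ord leq_add2l.
rewrite size_cat size_encode_nat; apply: (@leq_trans (n.+1 + (N * (N * N + 1) + N)).+1).
  by rewrite ltnS leq_add2l.
move: nN; clear; rewrite !expnS expn0 muln1; move: n => z; nia.
Qed.

End Size.

Lemma qWNU_card1 (A : algebra) k : #|carrier A| = 1 -> 0 < k -> has_qWNU k A.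
Proof.
move=> A1 k0; exists (fun v => eval (Var A (Ordinal k0)) v); split.
  by exists (Var A (Ordinal k0)).
have /fintype_le1P all_eq : #|carrier A| <= 1 by rewrite A1.
by move=> x y i j; apply: all_eq.
Qed.

Lemma answers_mono (I : finType) (M : TM I) w t t' b : t <= t' -> answers_within M w t b ->
  answers_within M w t' b.
Proof. by move=> tt' [s st vs]; exists s => //; apply: leq_trans tt'. Qed.

Theorem theorem12 (k : nat) (hk : 2 <= k) :
  poly_time_solvable encode_alg alg_size admissible (has_qWNU k).
Proof.
case: k hk => [|[|k]] // _.
have [M [a [d M_spec]]] := @cmd_machine (register k.+1) (@Ordinal 32 4 isT, ord0) (qWNU_program k.+1) (wf_qWNU_program k.+1).
(* The summand 4 serves the algebras with one element; the rest inserts the bound on the length of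
   the word into the time bound of the machine. *)
pose p : {poly nat} := (4%:P + a%:P * (5%:P * ('X + 1) ^+ 3) ^+ d)%R.
exists M, p => A admA; have [card1 cardn] := M_spec (encode_alg A) (word_gt0 A).
have pE : (p.[alg_size A])%R = 4 + a * (5 * (alg_size A).+1 ^ 3) ^ d.
  rewrite /p !(hornerD, hornerM, hornerXn, horner_exp, hornerC, hornerX).
  by rewrite !(natrDE, natrME, natrXE, natn) -[in RHS](addn1 (alg_size A)).
rewrite pE; have := carrier_gt0 A; rewrite leq_eqVlt => /orP[/eqP n1|n_gt1].
  exists true; last by split=> // _; apply: qWNU_card1.
  apply: answers_mono (card1 _); first by rewrite leq_addr.
  by rewrite /inp /encode_alg -n1.
exists (reg (denote (encode_alg A) (qWNU_program k.+1) (full_mem _ (encode_alg A))) (@Ordinal 32 4 isT, ord0) == 0).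
  apply: answers_mono (cardn _).
    rewrite (leq_trans _ (leq_addl _ _)) // leq_mul2l; apply/orP; right.
    by case: (d) => // d'; rewrite leq_exp2r // size_encode_alg.
  by rewrite /inp /encode_alg; case: #|_| n_gt1 => [|[]].
have bs : bounded (encode_alg A) (full_mem (register k.+1) (encode_alg A)) by split=> /=.
have [b1 b2] := qWNU_program_spec bs.
have [q1 q2] := qWNU_local k A.
by split=> [/b1/q2|/q1/b2].
Qed.
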